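(* Let $X=(\Omega,\mathscr{F}^0,\mathscr{F}^0_t,X_t,\theta_t,P^x)$ be a continuous Hunt process in $E$, and let $\mu$ be a probability measure on $(E,\mathscr{B}(E))$. If $\xi\in L^2(\Omega,\mathscr{F}^\mu,P^\mu)$, then the martingale $M_t=E^\mu\{\xi\mid\mathscr{F}^\mu_t\}$, $t\ge0$, is continuous; that is, square-integrable martingales on $(\Omega,\mathscr{F}^\mu,\mathscr{F}^\mu_t,P^\mu)$ are continuous. Consequently, local martingales on $(\Omega,\mathscr{F}^\mu,\mathscr{F}^\mu_t,P^\mu)$ are continuous.
   Context: $E$ is a locally compact separable metric space and $E'=E\cup\{\partial\}$, where $\partial$ is the cemetery (point at infinity). A Hunt process is a right-continuous strong Markov process with state space $E'$ which is quasi-left continuous; a continuous Hunt process is a Hunt process with continuous sample paths. $\mathscr{F}^0=\sigma\{X_s:s\ge0\}$, $\mathscr{F}^0_t=\sigma\{X_s:s\le t\}$. For a probability measure $\mu$ on $(E,\mathscr{B}(E))$: $P^\mu(\Lambda)=\int_E P^x(\Lambda)\,\mu(dx)$ for $\Lambda\in\mathscr{F}^0$; $\mathscr{F}^\mu$ is the $P^\mu$-completion of $\mathscr{F}^0$; $\mathscr{F}^\mu_t$ is the smallest $\sigma$-algebra containing $\mathscr{F}^0_t$ and all $P^\mu$-null sets of $\mathscr{F}^\mu$; $E^\mu$ is (conditional) expectation under $P^\mu$. Every martingale on $(\Omega,\mathscr{F}^\mu,\mathscr{F}^\mu_t,P^\mu)$ has a right-continuous modification, and ''martingale'' always means a martingale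 with right-continuous sample paths. A square-integrable martingale is one of the form $M_t=E^\mu(\xi\mid\mathscr{F}^\mu_t)$ with $\xi\in L^2(\Omega,\mathscr{F}^\mu,P^\mu)$. Continuity is understood $P^\mu$-almost surely. *)

(* Defs.v *)
From HB Require Import structures.
From mathcomp Require Import all_boot all_order all_algebra.
From mathcomp Require Import all_classical all_reals all_analysis.
From mathcomp Require Import measurable_realfun.

Set Implicit Arguments.
Unset Strict Implicit.
Unset Printing Implicit Defensive.

Import Order.TTheory GRing.Theory Num.Theory.
Import numFieldNormedType.Exports.

Local Open Scope classical_set_scope.
Local Open Scope ring_scope.

(* Nonempty metric spaces: measurable types are pointed in the library, and a
   space that carries a probability measure is nonempty anyway. *)
#[short(type="pmetricType")]
HB.structure Definition PMetric (K : numDomainType) :=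
  {M of Pointed M & Metric K M}.

Definition separable (T : topologicalType) :=
  exists2 D : set T, countable D & dense D.

Notation borel T := (g_sigma_algebraType (@open T)).

(* The cemetery is [None]; it is isolated when [E] is compact. *)
Notation opc := one_point_compactification.

Section filtrations.
Context d (T : measurableType d) (R : realType).
Implicit Types (F : R -> set (set T)) (G : set (set T)) (tau : T -> \bar R).

Definition measurable_wrt G (f : T -> R) :=
  forall B : set R, measurable B -> G (f @^-1` B).

Definition stopping_time F tau :=
  (forall w, 0 <= tau w)%E /\
  forall t, 0 <= t -> F t [set w | (tau w <= t%:E)%E].

Definition optional_time F tau :=
  (forall w, 0 <= tau w)%E /\
  forall t, 0 <= t -> F t [set w | (tau w < t%:E)%E].

(* the sigma-algebra F_{tau+} *)
Definition sigma_after F tau : set (set T) :=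
  [set A | measurable A /\
    forall t, 0 <= t -> F t (A `&` [set w | (tau w < t%:E)%E])].

End filtrations.

Section martingales.
Context d (T : measurableType d) (R : realType) (P : probability T R).
Implicit Types (F : R -> set (set T)) (M : R -> T -> R).

(* [Y] is a version of the conditional expectation of [xi] given [G]. *)
Definition is_cond_exp (G : set (set T)) (xi Y : T -> R) :=
  [/\ measurable_wrt G Y, P.-integrable setT (EFin \o Y) &
      forall A, G A ->
        (\int[P]_(w in A) (Y w)%:E = \int[P]_(w in A) (xi w)%:E)%E].

(* Processes are indexed by [R], but only nonnegative times are relevant. *)
Definition ae_right_continuous M :=
  \forall w \ae P, forall t, 0 <= t -> M s w @[s --> t^'+] --> M t w.

Definition ae_continuous M :=
  \forall w \ae P, {within `[0, +oo[, continuous (M ^~ w)}.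

Definition martingale F M :=
  [/\ ae_right_continuous M,
      forall t, 0 <= t -> P.-integrable setT (EFin \o M t) &
      forall s t, 0 <= s -> s <= t -> is_cond_exp (F s) (M t) (M s)].

Definition square_integrable_martingale F M :=
  ae_right_continuous M /\
  exists2 xi : T -> R, xi \in Lfun P 2%:E &
    forall t, 0 <= t -> is_cond_exp (F t) xi (M t).

Definition stopped M (tau : T -> \bar R) : R -> T -> R :=
  fun t w => M (fine (mine t%:E (tau w))) w.

Definition local_martingale F M :=
  [/\ ae_right_continuous M,
      forall t, 0 <= t -> measurable_wrt (F t) (M t) &
      exists tau : nat -> T -> \bar R,
        [/\ forall n, stopping_time F (tau n),
            \forall w \ae P, nondecreasing_seq (tau ^~ w) /\
              tau n w @[n --> \oo] --> +oo%E &
            forall n, martingale F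
              (fun t w => stopped M (tau n) t w - M 0 w)]].

End martingales.

Notation completion_type P :=
  (g_sigma_algebraType (measurable `|` negligible P)).

Section completion.
Context d (T : measurableType d) (R : realType) (P : probability T R).
Local Open Scope ereal_scope.
Local Open Scope measure_scope.

Local Notation cT := (completion_type P).

(* The restriction of the outer measure of [P] to the completed sigma-algebra
   is the only extension of [P]. *)
Definition completion : set cT -> \bar R := P^*.

Lemma completion_caratheodory (A : set cT) :
  measurable A -> P^*.-cara.-measurable A.
Proof.
move: A; apply: smallest_sub.
  split => //; [by move=> X mX; rewrite setTD; exact: measurableC |
                by move=> u mu; exact: bigcupT_measurable].
move=> A [mA|[B [mB PB0 AB]]]; first exact: caratheodory_measurable_mu_ext.
apply: measure_is_complete_caratheodory; exists B; split => //.
- exact: caratheodory_measurable_mu_ext.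
- by rewrite /= -PB0; exact: measurable_mu_extE.
Qed.

Let completion0 : completion set0 = 0.
Proof. exact: mu_ext0. Qed.

Let completion_ge0 A : 0 <= completion A.
Proof. exact: mu_ext_ge0. Qed.

Let completion_sigma_additive : semi_sigma_additive completion.
Proof.
move=> F mF tF mUF; apply: caratheodory_measure_sigma_additive => //.
- by move=> i; exact: completion_caratheodory.
- exact: completion_caratheodory.
Qed.

HB.instance Definition _ := isMeasure.Build _ _ _ completion
  completion0 completion_ge0 completion_sigma_additive.

Lemma completionE (A : set T) : measurable A -> completion A = P A.
Proof. by move=> mA; exact: measurable_mu_extE. Qed.

Let completion_setT : completion setT = 1.
Proof. by rewrite -[RHS](probability_setT P); exact: completionE. Qed.

HB.instance Definition _ :=
  Measure_isProbability.Build _ _ _ completion completion_setT.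

End completion.
Arguments completion {d T R} P _.

Section prob_from.
Context (R : realType) (E : ptopologicalType) d (Omega : measurableType d).
Variables (P : R.-pker borel (opc E) ~> Omega) (mu : probability (borel E) R).
Local Open Scope ereal_scope.

(* P^mu, on F^0 *)
Definition prob_from (A : set Omega) : \bar R :=
  \int[mu]_(x in setT) P (Some x : opc E) A.

Lemma measurable_Some :
  measurable_fun setT (Some : borel E -> borel (opc E)).
Proof.
have someP := (@continuousP E (opc E) Some).1.
apply: (@measurability _ _ (borel E) (borel (opc E)) setT Some
  (@open (opc E))) => // _ [U oU <-]; rewrite setTI.
apply: sub_sigma_algebra; apply: someP oU.
exact: one_point_compactification_some_continuous.
Qed.

Let measurable_P A : measurable A ->
  measurable_fun setT (fun x : borel E => P (Some x : opc E) A).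
Proof.
move=> mA; apply: (measurableT_comp (measurable_kernel P A mA)).
exact: measurable_Some.
Qed.

Let prob_from0 : prob_from set0 = 0.
Proof. by rewrite /prob_from integral0_eq. Qed.

Let prob_from_ge0 A : 0 <= prob_from A.
Proof. exact: integral_ge0. Qed.

Let prob_from_sigma_additive : semi_sigma_additive prob_from.
Proof.
move=> F mF tF mUF.
rewrite [X in _ --> X](_ : _ = \sum_(n <oo) prob_from (F n)); last first.
  rewrite -integral_nneseries//; last by move=> n; exact: measurable_P.
  by apply: eq_integral => x _; rewrite measure_semi_bigcup.
apply: is_cvg_ereal_nneg_natsum => n _; exact: prob_from_ge0.
Qed.

HB.instance Definition _ := isMeasure.Build _ _ _ prob_from
  prob_from0 prob_from_ge0 prob_from_sigma_additive.

Let prob_from_setT : prob_from setT = 1.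
Proof.
rewrite /prob_from; under eq_integral do rewrite prob_kernel.
rewrite integral_cst// mul1e; exact: probability_setT.
Qed.

HB.instance Definition _ :=
  Measure_isProbability.Build _ _ _ prob_from prob_from_setT.

End prob_from.

Section hunt_process.
Context (R : realType) (E : ptopologicalType) d (Omega : measurableType d).
Variables (X : R -> Omega -> opc E) (theta : R -> Omega -> Omega).
Variable P : R.-pker borel (opc E) ~> Omega.

Definition events_at (s : R) : set (set Omega) :=
  preimage_set_system setT (X s) (@measurable _ (borel (opc E))).

(* F^0 and F^0_t *)
Definition natural_sigma_algebra : set (set Omega) :=
  <<s \bigcup_(s in `[0, +oo[) events_at s >>.

Definition natural_filtration (t : R) : set (set Omega) :=
  <<s \bigcup_(s in `[0, t]) events_at s >>.

(* Optional times are the stopping times of the right-continuous filtration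
   F^0_{t+}. *)
Definition strong_markov :=
  forall (x : opc E) (tau : Omega -> \bar R) (A B : set Omega),
    optional_time natural_filtration tau ->
    sigma_after natural_filtration tau A ->
    measurable B ->
    (P x (A `&` [set w | tau w < +oo /\ B (theta (fine (tau w)) w)]) =
     \int[P x]_(w in A `&` [set w | tau w < +oo])
       P (X (fine (tau w)) w) B)%E.

Definition quasi_left_continuous :=
  forall (x : opc E) (tau_ : nat -> Omega -> \bar R) (tau : Omega -> \bar R),
    (forall n, optional_time natural_filtration (tau_ n)) ->
    (forall w, nondecreasing_seq (tau_ ^~ w)) ->
    (forall w, tau_ n w @[n --> \oo] --> tau w) ->
    \forall w \ae P x, (tau w < +oo)%E ->
      X (fine (tau_ n w)) w @[n --> \oo] --> X (fine (tau w)) w.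

Record hunt_process : Prop := HuntProcess {
  hunt_measurable : @measurable _ Omega = natural_sigma_algebra;
  hunt_shift : forall s t w, 0 <= s -> 0 <= t ->
    X s (theta t w) = X (s + t) w;
  hunt_initial : forall x : opc E, P x [set w | X 0 w = x] = 1%E;
  hunt_cemetery : forall s t w, 0 <= s -> s <= t ->
    X s w = None -> X t w = None;
  hunt_right_continuous : forall w t, 0 <= t ->
    X s w @[s --> t^'+] --> X t w;
  hunt_strong_markov : strong_markov;
  hunt_quasi_left_continuous : quasi_left_continuous }.

Definition continuous_hunt_process :=
  hunt_process /\ forall w, {within `[0, +oo[, continuous (X ^~ w)}.

(* F^mu_t; the sigma-algebra F^mu is that of
   [completion_type (prob_from P mu)]. *)
Definition augmented_filtration (mu : probability (borel E) R) (t : R) :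
    set (set (completion_type (prob_from P mu))) :=
  <<s natural_filtration t `|`
      [set N : set (completion_type (prob_from P mu)) |
        measurable N /\ completion (prob_from P mu) N = 0%E] >>.

End hunt_process.
Arguments augmented_filtration {R E d Omega} X P mu t.

(* Main.v *)
(* Let eta be a bounded functional whose values eta(theta_t w) along the shifts are
   continuous in t, and h(x) = E^x eta, so that E[eta o theta_tau] = E[h(X_tau)] at
   every optional time tau.  If K is closed and h >= b on K while tau_n increases to
   T with h(X_{tau_n}) <= a < b and X_{tau_n} approaching K, then X_T lies in K by
   continuity of the paths, and comparing both sides of this identity along tau_n
   and at T forces P(T < oo) = 0.  By inner regularity of the law of X at debuts of
   the level sets of h(X), this excludes jumps of h(X); alternating debuts exclude
   oscillations in the same way.  So t |-> h(X_t), read at dyadic times, almost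
   surely has a limit at every t > 0, equal to h(X_t) when t is dyadic.
   If xi is a combination of products of g_i(X_{t_i}), g_i continuous, then near a
   time s0 it is uniformly close to a combination of (past of s0) * eta(theta_t)
   with such functionals eta, so E[xi | F_t] is close to the regular process
   (past of s0) * h(X_t), uniformly in t by the maximal inequality.  These xi are
   dense in L^1, and the maximal inequality gives the general case.  A local
   martingale is, up to a stopping time, a martingale closed by an L^1 variable on
   each bounded interval. *)

Require Import Defs.
From HB Require Import structures.
From mathcomp Require Import all_boot all_order all_algebra.
From mathcomp Require Import all_classical all_reals all_analysis.
From mathcomp Require Import measurable_realfun.
From mathcomp Require Import zify ring lra.
Set Implicit Arguments.
Unset Strict Implicit.
Unset Printing Implicit Defensive.
Import Order.TTheory GRing.Theory Num.Theory.
Import numFieldNormedType.Exports.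
Local Open Scope classical_set_scope.
Local Open Scope ring_scope.

(** * Topology of the one-point compactification *)

(** The function h = [mean P eta] is only Borel: no Feller property is assumed, so continuity of the
    paths says nothing directly about t |-> h(X_t). All limits are therefore taken on the eta side
    of the strong Markov identity, where eta(theta_t w) is continuous in t. The conditional
    expectation of g(X_u) given the past of t is a function of X_t that itself changes with t, and
    no joint regularity in t and X_t is available. Delaying the times after s0 by t - s0 freezes
    that function; the price is an error that path continuity makes small off an event of small
    probability. Only dyadic times enter the debuts: this keeps them optional for the uncompleted
    filtration without a general debut theorem, and right-continuity of M carries the result from
    dyadic times to all times. The compactification is not treated as a metric space: sequences of
    Urysohn functions replace the distance to a closed set. They need not be monotone, so approach
    to the set is measured by the first n of them together. *)

Lemma ltr_invS (R : realType) (e : R) : 0 < e -> exists k : nat, k.+1%:R^-1 < e.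
Proof. by move=> /ltr_add_invr[k]; rewrite add0r; exists k. Qed.

Section one_point_compactification_separation.
Context (R : realType) (E : pmetricType R).
Hypotheses (E_lc : locally_compact [set: E]) (E_sep : separable E).

(** The closed balls of radius [k.+1%:R^-1] about the points of a countable dense set, kept when
    compact and inside V, cover V by local compactness. [C p] is such a ball or empty, since the
    injection [f] determines the centre. *)
Lemma open_bigcup_compact (V : set E) : open V ->
  exists2 C : nat -> set E, (forall n, compact (C n)) & V = \bigcup_n C n.
Proof.
move=> oV; have [D /countable_injP[f injf] dD] := E_sep.
pose B x k := closure (ball x (k.+1%:R^-1 : R)) : set E.
pose C (p : nat * nat) := [set y | exists x,
  [/\ D x, f x = p.1, compact (B x p.2), B x p.2 `<=` V & B x p.2 y]].
exists (fun n => if unpickle n is Some p then C p else set0).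
  move=> n; case: unpickle => [[i k]|]; last exact: compact0.
  have [[x [Dx fx cB BV]]|nB] := pselect (exists x,
      [/\ D x, f x = i, compact (B x k) & B x k `<=` V]).
    rewrite (_ : C _ = B x k)//; apply/seteqP; split => [y [z [Dz fz _ _]]|y].
      by rewrite (injf z x) ?inE//= fz fx.
    by exists x.
  rewrite (_ : C _ = set0); first exact: compact0.
  by apply/seteqP; split => // y [x [*]]; apply: nB; exists x.
apply/seteqP; split => [y Vy|y [n _]]; last first.
  by case: unpickle => // p [x [_ _ _]]; exact.
have [W yW [cW clW]] := E_lc (I : [set: E] y).
rewrite withinET in yW.
have : nbhs y (W `&` V) by apply: filterI => //; exact: open_nbhs_nbhs.
move=> /nbhs_ballP[e/= e0 eWV].
(* A point of the closed ball about x is reached from y in three steps of length [k.+1%:R^-1], hence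
   stays in the ball of radius e about y. *)
have [k ke] : exists k, k.+1%:R^-1 < e / 4 by apply: ltr_invS; rewrite divr_gt0.
have k0 : 0 < (k.+1%:R^-1 : R) by rewrite invr_gt0.
have [x []] : (ball y k.+1%:R^-1)^° `&` D !=set0.
  apply: dD; last exact: open_interior.
  by exists y; apply: nbhs_singleton; apply: nbhs_interior; exact: nbhsx_ballx.
move=> /interior_subset yx Dx.
have BWV : B x k `<=` W `&` V.
  move=> z /(_ _ (nbhsx_ballx _ _ k0))[u [xu zu]]; apply: eWV.
  have := ball_triangle (ball_triangle yx xu) (ball_sym zu).
  by apply: le_ball; move: ke; set v := (_^-1); lra.
exists (pickle (f x, k)) => //; rewrite pickleK; exists x; split => //.
- apply: subclosed_compact cW _; first exact: closed_closure.
  by move=> z /BWV[].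
- by move=> z /BWV[].
- by apply: subset_closure; exact: ball_sym.
Qed.

Lemma closed_some_compact (C : set E) : compact C ->
  @closed (opc E) (Some @` C).
Proof.
move=> cC; apply: compact_closed.
  exact: one_point_compactification_hausdorff E_lc (@metric_hausdorff _ _).
apply: continuous_compact => //; apply: continuous_subspaceT.
exact: one_point_compactification_some_continuous.
Qed.

(** The complement of K is a countable union of closed sets, compact pieces of E and possibly the
    cemetery. Urysohn functions for the finite unions give the indicator of K as a pointwise limit
    of continuous functions; being eventually equal to 0 off K stands in for a positive distance to
    K. *)
Lemma closed_separating_functions (K : set (opc E)) : closed K ->
  exists psi : nat -> opc E -> R, [/\
    forall n, continuous (psi n),
    forall n x, 0 <= psi n x <= 1,
    forall n x, K x -> psi n x = 1 &
    forall x, ~ K x -> \forall n \near \oo, psi n x = 0].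
Proof.
move=> clK; have oV : open (Some @^-1` (~` K) : set E).
  have := @one_point_compactification_some_continuous E.
  by move=> /continuousP; apply; exact: closed_openC.
have [C cC VE] := open_bigcup_compact oV.
(* The compact pieces come from E only; the cemetery has to be added by hand, and only when K misses
   it. *)
pose F n : set (opc E) := \big[setU/set0]_(i < n) ((Some : E ->
  opc E) @` C i) `|`
  ([set None] `\` K).
have clN : @closed (opc E) [set None].
  rewrite -[X in closed X]setCK; apply: open_closedC.
  rewrite (_ : ~` _ = Some @` [set: E]).
    by apply: one_point_compactification_open_some; exact: openT.
  apply/seteqP; split => [[x _|/(_ erefl)[]]|_ [x _ <-] //].
  by exists x.
have clF n : closed (F n).
  apply: closedU; first by apply: closed_bigsetU => i _;
    exact: closed_some_compact.
  have [KN|KN] := pselect (K None).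
    rewrite (_ : _ `\` _ = set0); first exact: closed0.
    by apply/seteqP; split => // x [->].
  rewrite (_ : _ `\` _ = [set None])//.
  by apply/seteqP; split => [x []//|x ->].
have FK n : F n `&` K = set0.
  apply/seteqP; split => // x [[|[]//]].
  rewrite -(bigcup_mkord n (fun i => (Some : E -> opc E) @` C i)).
  move=> [i _ [y Ciy <-]] Ky.
  have : (\bigcup_n C n) y by exists i.
  by rewrite -VE; exact.
have sepF n : uniform_separator (F n) K.
  have /normal_separatorP : normal_space (opc E).
    apply: compact_normal; last exact: one_point_compactification_compact.
    exact: one_point_compactification_hausdorff E_lc (@metric_hausdorff _ _).
  exact.
exists (fun n => Urysohn (F n) K : opc E -> R); split.
- by move=> n; exact: Urysohn_continuous.
- move=> n x; have /(_ (Urysohn (F n) K x)) := @Urysohn_range _ R (F n) K.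
  by rewrite /= in_itv/=; apply; exists x.
- by move=> n x Kx; apply: (@Urysohn_sub1 _ R _ _ (sepF n)); exists x.
- move=> x Kx; have [m Fm] : exists m, forall n, (m <= n)%N -> F n x.
    case: x Kx => [y|] Kx; last by exists 0%N => n _; right.
    have : (Some @^-1` (~` K) : set E) y by [].
    rewrite VE => -[i _ Ciy]; exists i.+1 => n ni; left.
    rewrite -(bigcup_mkord n (fun i => (Some : E -> opc E) @` C i)).
    by exists i => //; exists y.
  exists m => // n /= mn; apply: (@Urysohn_sub0 _ R _ _ (sepF n));
    exists x => //.
  exact: Fm.
Qed.

End one_point_compactification_separation.

(** * Inner regularity of finite Borel measures *)

Section inner_regularity.
Context (R : realType) (T : ptopologicalType).
Hypothesis open_Fsigma : forall U : set T, open U ->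
  exists2 F : nat -> set T, (forall n, closed (F n)) & U = \bigcup_n F n.
Local Open Scope ereal_scope.
Variable m : {measure set (borel T) -> \bar R}.
Hypothesis m_fin : m setT < +oo.

Let inner (B : set (borel T)) := measurable B /\ forall e : R, (0 < e)%R ->
  exists K : set T, [/\ closed K, K `<=` B & m (B `\` K) <= e%:E].

Lemma closed_borel (K : set T) : closed K -> @measurable _ (borel T) K.
Proof.
move=> clK; rewrite -[K]setCK; apply: measurableC.
by apply: sub_sigma_algebra; exact: closed_openC.
Qed.

Let inner_closed (K : set T) : closed K -> inner K.
Proof.
move=> clK; split; first exact: closed_borel.
by move=> e e0; exists K; split => //; rewrite setDv measure0 lee_fin ltW.
Qed.

Let inner_bigcup (B : nat -> set (borel T)) :
  (forall n, inner (B n)) -> inner (\bigcup_n B n).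
Proof.
move=> iB; have mB n : measurable (B n) by case: (iB n).
split; first exact: bigcupT_measurable.
move=> e e0.
have e20 : (0 < e / 2)%R by rewrite divr_gt0.
have /choice[K KP] n : exists K : set T, [/\ closed K, K `<=` B n &
    m (B n `\` K) <= (e / 2 / (2 ^ n.+1)%:R)%:E].
  by apply: (iB n).2; rewrite divr_gt0// ltr0n expn_gt0.
have clK n : closed (K n) by case: (KP n).
have mK n : @measurable _ (borel T) (K n) by exact: closed_borel.
pose U n : set (borel T) := \big[setU/set0]_(i < n) K i.
have mU n : measurable (U n) by apply: bigsetU_measurable => i _; exact: mK.
(* Half of e pays for replacing each [B n] by [K n]; the rest pays for cutting the union at a finite
   stage, since an infinite union of closed sets need not be closed. *)
have bnd : m (\bigcup_n B n `\` \bigcup_n (K n : set (borel T))) <= (e / 2)%:E.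
  apply: (@le_trans _ _ (\sum_(0 <= n <oo) m (B n `\` K n))).
    apply: measure_sigma_subadditive.
    - by move=> n; exact: measurableD.
    - by apply: measurableD; exact: bigcupT_measurable.
    - move=> x [[n _ Bnx] Kx]; exists n => //; split => // Knx.
      by apply: Kx; exists n.
  apply: (@le_trans _ _ (\sum_(0 <= n <oo) (0 + (e / 2 / (2 ^ n.+1)%:R)%:E))).
    by apply: lee_nneseries => // n _; rewrite add0e; case: (KP n).
  apply: le_trans (epsilon_trick (A := fun=> 0) xpredT (fun=>
    lexx 0) (ltW e20)) _.
  by rewrite eseries0// add0e.
have : m (\bigcup_n B n `\` U n) @[n --> \oo] -->
    m (\bigcap_n (\bigcup_n B n `\` U n)).
  apply: (@nonincreasing_cvg_mu _ _ _ m).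
  - apply: le_lt_trans m_fin; apply: le_measure => //; rewrite ?inE//.
    by apply: measurableD => //; exact: bigcupT_measurable.
  - by move=> n; apply: measurableD => //; exact: bigcupT_measurable.
  - apply: bigcapT_measurable => n; apply: measurableD => //.
    exact: bigcupT_measurable.
  - move=> p q pq; apply/subsetPset; apply: setDS.
    by apply: subset_bigsetU.
rewrite bigcupDr; last by exists 0%N.
rewrite (_ : \bigcup_i U i = \bigcup_n (K n : set (borel T))); last first.
  apply/seteqP; split => [x [n _]|x [n _ Kx]].
    by rewrite /U -bigcup_mkord => -[i _ Kx]; exists i.
  by exists n.+1 => //; rewrite /U -bigcup_mkord; exists n => /=.
move=> mUcvg; have : \forall n \near \oo, m (\bigcup_n B n `\` U n) < e%:E.
  apply: (mUcvg [set y | y < e%:E]).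
  apply: open_nbhs_nbhs; split; first exact: open_ereal_lt_ereal.
  by rewrite /=; apply: le_lt_trans bnd _; rewrite lte_fin; lra.
move=> [n _ /(_ n (leqnn n))/= /ltW mUe]; exists (U n); split => //.
- by apply: closed_bigsetU => i _; exact: clK.
- by rewrite /U -bigcup_mkord => x [i _ Kx]; exists i => //;
  case: (KP i) => _ + _; exact.
Qed.

Let inner_bigcap (B : nat -> set (borel T)) :
  (forall n, inner (B n)) -> inner (\bigcap_n B n).
Proof.
move=> iB; have mB n : measurable (B n) by case: (iB n).
split; first exact: bigcapT_measurable.
move=> e e0.
have /choice[K KP] n : exists K : set T, [/\ closed K, K `<=` B n &
    m (B n `\` K) <= (e / (2 ^ n.+1)%:R)%:E].
  by apply: (iB n).2; rewrite divr_gt0// ltr0n expn_gt0.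
have clK n : closed (K n) by case: (KP n).
have mK n : @measurable _ (borel T) (K n) by exact: closed_borel.
exists (\bigcap_n K n); split.
- by apply: closed_bigI => n _; exact: clK.
- by move=> x Kx n _; have [_ + _] := KP n; apply; exact: Kx.
apply: (@le_trans _ _ (\sum_(0 <= n <oo) m (B n `\` K n))).
  apply: measure_sigma_subadditive.
  - by move=> n; exact: measurableD.
  - by apply: measurableD; exact: bigcapT_measurable.
  - move=> x [Bx /existsNP[n /not_implyP[_ Kx]]]; exists n => //; split => //.
    exact: Bx.
apply: (@le_trans _ _ (\sum_(0 <= n <oo) (0 + (e / (2 ^ n.+1)%:R)%:E))).
  by apply: lee_nneseries => // n _; rewrite add0e; case: (KP n).
apply: le_trans (epsilon_trick (A := fun=> 0) xpredT (fun=> lexx 0) (ltW e0)) _.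
by rewrite eseries0// add0e.
Qed.

(** Inner approximability alone is not visibly stable under complements, so B and its complement are
    carried through the induction together. Open sets start it because they are countable unions of
    closed sets. *)
Let inner_borel (B : set (borel T)) : measurable B -> inner B /\ inner (~` B).
Proof.
move: B; apply: smallest_sub.
  split => [|B [iB iB']|B iB].
  - by rewrite setC0; split; apply: inner_closed;
    [exact: closed0|exact: closedT].
  - by rewrite setTD setCK.
  - split; first by apply: inner_bigcup => n; case: (iB n).
    by rewrite setC_bigcup; apply: inner_bigcap => n; case: (iB n).
move=> U oU; split; last by apply: inner_closed; exact: open_closedC.
have [F clF ->] := open_Fsigma oU.
by apply: inner_bigcup => n; exact: inner_closed.
Qed.

Lemma measure0_closed_inner (B : set (borel T)) : measurable B ->
  (forall K : set T, closed K -> K `<=` B -> m K = 0) -> m B = 0.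
Proof.
move=> mB mK0; apply/eqP; rewrite eq_le measure_ge0 andbT.
apply/lee_addgt0Pr => e e0; rewrite add0e.
have [[_ /(_ _ e0)[K [clK KB mBK]]] _] := inner_borel mB.
have mK := closed_borel clK.
rewrite -(setDKU KB) measureU//; last by rewrite setDKI.
  by rewrite [X in (_ + X)%E]mK0// adde0.
exact: measurableD.
Qed.

End inner_regularity.

(** * Integration against a mixture of measures *)

Section integral_mixture.
Local Open Scope ereal_scope.
Context d1 d2 (X : measurableType d1) (Z : measurableType d2) (R : realType).
Variables (m : {measure set Z -> \bar R}) (m' : {measure set X -> \bar R}).
Variables (D : set X) (k : X -> {measure set Z -> \bar R}).
Hypotheses (mD : measurable D)
  (mk : forall A, measurable A -> measurable_fun setT (k ^~ A))
  (mE : forall A, measurable A -> m A = \int[m']_(x in D) k x A).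
Import HBNNSimple.

Let integral_mixture_nnsfun (f : {nnsfun Z >-> R}) :
  \int[m]_z (f z)%:E = \int[m']_(x in D) \int[k x]_z (f z)%:E.
Proof.
have fT : f \_ [set: Z] = f by apply/funext => z; rewrite patchT// inE.
have intE (l : {measure set Z -> \bar R}) : \int[l]_z (f z)%:E =
    \sum_(r \in range f) r%:E * l (f @^-1` [set r]).
  by rewrite integral_nnsfun//= sintegralE fT.
rewrite intE; under [in RHS]eq_integral do rewrite intE.
rewrite ge0_integral_fsum//; last 2 first.
- by move=> r; apply: measurable_funeM; apply: measurable_funTS; exact: mk.
- move=> r x _.
  by have := mulemu_ge0 (fun r => f @^-1` [set r]); apply;
    exact: preimage_nnfun0.
apply: eq_fsbigr => r _; have mfr : measurable (f @^-1` [set r]) by [].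
have [r0|r0] := leP 0%R r.
  rewrite ge0_integralZl//; last exact: measurable_funTS (mk _).
  by rewrite mE.
rewrite preimage_nnfun0// measure0 mule0 integral0_eq// => x _.
by rewrite measure0 mule0.
Qed.

(** Applied to P^mu as a mixture of the P^x, and to the law of the shifted path, seen both as a
    mixture of Dirac masses and as a mixture of the laws started at X_tau. The identity passes from
    sets to simple functions, then to monotone limits. *)
Lemma integral_mixture (f : Z -> \bar R) : (forall z, 0 <= f z) ->
  measurable_fun setT f ->
  \int[m]_z f z = \int[m']_(x in D) \int[k x]_z f z.
Proof.
move=> f0 mf; pose f_ := nnsfun_approx measurableT mf.
have f_cvg (l : {measure set Z -> \bar R}) :
    \int[l]_z (f_ n z)%:E @[n --> \oo] --> \int[l]_z f z.
  have := @cvg_monotone_convergence _ Z R l setT measurableT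
    (fun n z => (f_ n z)%:E).
  rewrite (_ : (fun x => limn _) = f); last first.
    by apply/funext => z; apply/cvg_lim => //; exact: cvg_nnsfun_approx.
  apply => //.
  - by move=> n; exact/measurable_EFinP.
  - by move=> n z _; rewrite lee_fin.
  - by move=> z _ a b ab; rewrite lee_fin; exact/lefP/nd_nnsfun_approx.
have mf_ n : measurable_fun D (fun x => \int[k x]_z (f_ n z)%:E).
  apply: measurable_funTS; apply: measurable_fun_integral_kernel => //.
  - by move=> z; rewrite lee_fin.
  - exact/measurable_EFinP.
have := f_cvg m.
rewrite (_ : (fun n => \int[m]_z _) =
  fun n => \int[m']_(x in D) \int[k x]_z (f_ n z)%:E); last first.
  by apply/funext => n; exact: integral_mixture_nnsfun.
move=> /cvg_lim <- //; apply/cvg_lim => //.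
have := @cvg_monotone_convergence _ X R m' D mD
  (fun n x => \int[k x]_z (f_ n z)%:E).
rewrite (_ : (fun x => limn _) = fun x => \int[k x]_z f z); last first.
  by apply/funext => x; apply/cvg_lim => //; exact: f_cvg.
apply.
- by move=> n; exact: mf_.
- by move=> n x _; apply: integral_ge0 => z _; rewrite lee_fin.
- move=> x _ a b ab; apply: ge0_le_integral => //.
  + by move=> z _; rewrite lee_fin.
  + exact/measurable_EFinP.
  + exact/measurable_EFinP.
  + by move=> z _; rewrite lee_fin; exact/lefP/nd_nnsfun_approx.
Qed.

End integral_mixture.

(** * Measurability of a continuous Hunt process *)

Definition dyadic (R : realType) (m k : nat) : R := k%:R / 2 ^+ m.

(** Sequential form, because it is applied to sequences of random times under dominated convergence;
    only nonnegative times are relevant to the process. *)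
Definition seq_cont (R : realType) (y : R -> R) := forall (t_ : nat ->
  R) (t : R),
  (forall n, 0 <= t_ n) -> 0 <= t -> t_ n @[n --> \oo] --> t ->
  y (t_ n) @[n --> \oo] --> y t.

Lemma cvgr_ltP (R : realType) (u : nat -> R) (l : R) :
  (forall e, 0 < e -> exists N, forall n, (N <= n)%N -> `|u n - l| < e) <->
  u n @[n --> \oo] --> l.
Proof.
split=> [ul|/cvgrPdist_lt ul e /ul[N _ Nu]].
  apply/cvgrPdist_lt => e /ul[N Nu]; exists N => // n /= /Nu.
  by rewrite distrC.
by exists N => n Nn; rewrite distrC; exact: (Nu n).
Qed.

Lemma expr2_gt (R : realType) (x : R) : exists m : nat, x < 2 ^+ m.
Proof.
exists (Num.truncn `|x|).+1; apply: le_lt_trans (ler_norm x) _.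
have /andP[_ /lt_le_trans] := truncn_itv (normr_ge0 x); apply.
by rewrite -natrX ler_nat ltnW// ltn_expl.
Qed.

Lemma dyadic_ge0 (R : realType) m k : 0 <= dyadic R m k.
Proof. by rewrite divr_ge0// exprn_ge0. Qed.

Lemma dyadic_floor (R : realType) (x : R) (m : nat) : 0 <= x ->
  dyadic R m (Num.truncn (x * 2 ^+ m)) <= x <
    dyadic R m (Num.truncn (x * 2 ^+ m)).+1.
Proof.
move=> x0; have p0 : 0 < (2 ^+ m : R) by rewrite exprn_gt0.
rewrite /dyadic ler_pdivrMr// ltr_pdivlMr//; apply: truncn_itv.
by rewrite mulr_ge0// ltW.
Qed.

Lemma dyadicS (R : realType) m k : dyadic R m k.+1 = dyadic R m k + (2 ^+ m)^-1.
Proof. by rewrite /dyadic -natr1 mulrDl mul1r. Qed.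

Lemma invr_expr2_lt (R : realType) (e : R) : 0 < e ->
  exists N, forall m, (N <= m)%N -> (2 ^+ m)^-1 < e.
Proof.
move=> e0; have [N Ne] := expr2_gt e^-1; exists N => m Nm.
have p0 : 0 < (2 ^+ m : R) by rewrite exprn_gt0.
rewrite invf_plt ?posrE//; apply: (lt_le_trans Ne).
by rewrite ler_weXn2l// ler1n.
Qed.

Lemma cvg_dyadic_floor (R : realType) (x : R) : 0 <= x ->
  dyadic R m (Num.truncn (x * 2 ^+ m)) @[m --> \oo] --> x.
Proof.
move=> x0; apply/cvgr_ltP => e e0; have [N Ne] := invr_expr2_lt e0.
exists N => m /Ne; have := dyadic_floor m x0; rewrite dyadicS.
by move=> /andP[le_x x_lt] lt_e; rewrite distrC ger0_norm; lra.
Qed.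

Section hunt_measurability.
Context (R : realType) (E : pmetricType R).
Hypotheses (E_lc : locally_compact [set: E]) (E_sep : separable E).
Context (d : measure_display) (Omega : measurableType d).
Variables (X : R -> Omega -> opc E) (theta : R -> Omega -> Omega).
Variable P : R.-pker borel (opc E) ~> Omega.
Hypothesis X_hunt : continuous_hunt_process X theta P.

Local Notation F := (natural_filtration X).

Lemma filtration_sigma t : sigma_algebra setT (F t).
Proof. exact: smallest_sigma_algebra. Qed.

Lemma filtrationC t A : F t A -> F t (~` A).
Proof. by have [_ + _] := filtration_sigma t => /[apply]; rewrite setTD. Qed.

Lemma filtration_bigcup t (A : nat -> set Omega) :
  (forall n, F t (A n)) -> F t (\bigcup_n A n).
Proof. by have [_ _] := filtration_sigma t; apply. Qed.

Lemma filtration0 t : F t set0.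
Proof. by case: (filtration_sigma t). Qed.

Lemma filtrationT t : F t setT.
Proof. by rewrite -setC0; apply: filtrationC; exact: filtration0. Qed.

Lemma filtration_bigcap t (A : nat -> set Omega) :
  (forall n, F t (A n)) -> F t (\bigcap_n A n).
Proof.
move=> FA; rewrite -[X in F t X]setCK setC_bigcap; apply: filtrationC.
by apply: filtration_bigcup => n; exact: filtrationC.
Qed.

Lemma filtrationU t A B : F t A -> F t B -> F t (A `|` B).
Proof.
move=> FA FB; rewrite -bigcup2E; apply: filtration_bigcup => -[|[|n]]//=.
exact: filtration0.
Qed.

Lemma filtrationI t A B : F t A -> F t B -> F t (A `&` B).
Proof.
move=> FA FB; rewrite -[X in F t X]setCK setCI; apply: filtrationC.
by apply: filtrationU; exact: filtrationC.
Qed.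

Lemma filtration_cst t (Q : Prop) : F t [set w | Q].
Proof.
have [q|q] := pselect Q.
  by rewrite (_ : [set _ | _] = setT); [exact: filtrationT|apply/seteqP; split].
by rewrite (_ : [set _ | _] = set0); [exact: filtration0|apply/seteqP; split].
Qed.

Lemma filtration_le s t : s <= t -> F s `<=` F t.
Proof.
move=> st; apply: sub_sigma_algebra2 => A [u/= u0s uA]; exists u => //=.
by move: u0s; rewrite !in_itv/= => /andP[-> /le_trans]; apply.
Qed.

Lemma filtration_X s t (B : set (opc E)) : 0 <= s <= t ->
  @measurable _ (borel (opc E)) B -> F t (X s @^-1` B).
Proof.
move=> st mB; apply: sub_sigma_algebra; exists s; first by rewrite /= in_itv.
by exists B => //; rewrite setTI.
Qed.





Lemma filtration_measurable t : F t `<=` @measurable _ Omega.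
Proof.
rewrite (hunt_measurable X_hunt.1); apply: sub_sigma_algebra2.
move=> A [u/= u0s uA]; exists u => //=; move: u0s; rewrite !in_itv/= andbT.
by case/andP.
Qed.

Lemma measurable_X s : 0 <= s ->
  measurable_fun setT (X s : Omega -> borel (opc E)).
Proof.
move=> s0 _ B mB; rewrite setTI; apply: (@filtration_measurable s).
by apply: filtration_X => //; rewrite s0 lexx.
Qed.

Lemma measurable_continuous (f : opc E -> R) : continuous f ->
  measurable_fun setT (f : borel (opc E) -> R).
Proof.
move=> cf; apply: (measurability (@RGenOpens.G R)).
  exact: RGenOpens.measurableE.
move=> _ [_ [a [b ->]] <-]; rewrite setTI; apply: sub_sigma_algebra.
by move/continuousP : cf; apply; exact: interval_open.
Qed.

Lemma X_near (f : opc E -> R) w t e : continuous f -> 0 <= t -> 0 < e ->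
  exists2 del : R, 0 < del &
    forall s, 0 <= s -> `|s - t| < del -> `|f (X s w) - f (X t w)| < e.
Proof.
move=> cf t0 e0; have := X_hunt.2 w; move/subspace_continuousP => /(_ t).
rewrite /= in_itv/= t0/= => /(_ isT) Xt.
have /cvgrPdist_lt/(_ _ e0) := cvg_comp _ _ Xt (cf (X t w)).
move=> /nbhs_ballP[del/= del0 dP]; exists del => // s s0 st.
by rewrite distrC; apply: dP; rewrite /= ?in_itv/= ?s0// /ball/= distrC.
Qed.

Lemma seq_cont_X (f : opc E -> R) w : continuous f ->
  seq_cont (fun t => f (X t w)).
Proof.
move=> cf t_ t t_0 t0 /cvgr_ltP tt; apply/cvgr_ltP => e e0.
have [del /tt[N Nt] dP] := X_near w cf t0 e0.
by exists N => n /Nt; exact: dP.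
Qed.

Lemma measurable_countable_time d' (Y : measurableType d') (k : Omega -> nat)
    (g : nat -> Omega -> Y) : (forall n, measurable (k @^-1` [set n])) ->
  (forall n, measurable_fun setT (g n)) ->
  measurable_fun setT (fun w => g (k w) w).
Proof.
move=> mk mg _ B mB; rewrite setTI.
rewrite (_ : _ @^-1` _ = \bigcup_n (k @^-1` [set n] `&` g n @^-1` B));
  last first.
  by apply/seteqP; split => [w Bw|w [n _ [/= <-]]//]; exists (k w).
apply: bigcupT_measurable => n; apply: measurableI; first exact: mk.
by rewrite -[X in measurable X]setTI; exact: mg.
Qed.

Lemma closed_measurable_fun (g : Omega -> borel (opc E)) :
  (forall psi : opc E -> R, continuous psi -> measurable_fun setT (psi \o g)) ->
  measurable_fun setT g.
Proof.
move=> mg; apply: (@measurability _ _ Omega (borel (opc E)) setT g (@open (opc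
  E))) => //.
move=> _ [U oU <-].
rewrite setTI -[U]setCK preimage_setC; apply: measurableC.
have [psi [cpsi psi01 psiK psiNK]] :=
  closed_separating_functions E_lc E_sep (open_closedC oU).
rewrite (_ : (fun _ => _) = \bigcap_n ((psi n \o g) @^-1` [set 1])); last first.
  apply/seteqP; split => [w gw n _ /=|w gw /= Ugw]; first exact: psiK.
  have /psiNK[n _ /(_ n (leqnn n))/= psi0] : ~ (~` U) (g w) by move/(_ Ugw).
  by have := gw n I; rewrite /= psi0 => /esym/eqP; rewrite oner_eq0.
apply: bigcapT_measurable => n; rewrite -[X in measurable X]setTI.
exact: mg.
Qed.

Lemma measurable_truncn (r : Omega -> R) : measurable_fun setT r ->
  (forall w, 0 <= r w) ->
  forall n, measurable ((fun w => Num.truncn (r w)) @^-1` [set n]).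
Proof.
move=> mr r0 n; rewrite (_ : _ @^-1` _ = r @^-1` `[n%:R, n.+1%:R[).
  by rewrite -[X in measurable X]setTI; exact: mr.
apply/seteqP; split => w /=; rewrite in_itv/=; last exact: truncn_def.
by move=> <-; exact: truncn_itv.
Qed.

(** The random time is approximated by dyadic times from below. These are not adapted, but only
    measurability is claimed, and continuity of the paths identifies the limit. *)
Lemma measurable_X_time (r : Omega -> R) : measurable_fun setT r ->
  (forall w, 0 <= r w) ->
  measurable_fun setT (fun w => X (r w) w : borel (opc E)).
Proof.
move=> mr r0; apply: closed_measurable_fun => psi cpsi.
apply: (@measurable_fun_cvg _ _ _ _
    (fun m w => psi (X (dyadic R m (Num.truncn (r w * 2 ^+ m))) w))).
  move=> m; apply: (@measurable_countable_time _ _ _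
    (fun k w => psi (X (dyadic R m k) w))).
    apply: measurable_truncn; first exact: measurable_funM.
    by move=> w; rewrite mulr_ge0// exprn_ge0.
  move=> k; apply: (measurableT_comp (measurable_continuous cpsi)).
  exact: measurable_X (dyadic_ge0 _ _ _).
move=> w _; have := @seq_cont_X psi w cpsi
  (fun m => dyadic R m (Num.truncn (r w * 2 ^+ m))) (r w).
apply => //.
  by move=> m; exact: dyadic_ge0.
exact: cvg_dyadic_floor.
Qed.

(** The coordinates of the shifted path are X at the times s + r, and the coordinates generate the
    sigma-algebra of [Omega]. *)
Lemma measurable_theta_time (r : Omega -> R) : measurable_fun setT r ->
  (forall w, 0 <= r w) -> measurable_fun setT (fun w => theta (r w) w).
Proof.
move=> mr r0.
apply: (measurability (\bigcup_(s in `[0, +oo[) events_at X s)).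
  by rewrite (hunt_measurable X_hunt.1).
move=> _ [_ [s/= s0 [B mB <-]] <-]; rewrite !setTI.
rewrite in_itv/= andbT in s0.
rewrite (_ : _ @^-1` _ = (fun w => X (s + r w) w) @^-1` B); last first.
  by apply/seteqP; split => w /=; rewrite (hunt_shift X_hunt.1).
rewrite -[X in measurable X]setTI; apply: measurable_X_time => //.
  exact: measurable_funD.
by move=> w; rewrite addr_ge0.
Qed.

End hunt_measurability.

(** * The strong Markov property for functionals *)

Section strong_markov_functional.
Context (R : realType) (E : pmetricType R).
Hypotheses (E_lc : locally_compact [set: E]) (E_sep : separable E).
Context (d : measure_display) (Omega : measurableType d).
Variables (X : R -> Omega -> opc E) (theta : R -> Omega -> Omega).
Variable P : R.-pker borel (opc E) ~> Omega.
Hypothesis X_hunt : continuous_hunt_process X theta P.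
Variable mu : probability (borel E) R.
Local Notation F := (natural_filtration X).
Local Notation Pm := (prob_from P mu).
Local Open Scope ereal_scope.

Lemma integral_prob_from (f : Omega -> \bar R) : (forall w, 0 <= f w) ->
  measurable_fun setT f ->
  \int[Pm]_w f w = \int[mu]_(x in setT) \int[P (Some x : opc E)]_w f w.
Proof.
move=> f0 mf.
apply: (@integral_mixture _ _ (borel E) Omega R Pm mu setT
  (fun x => P (Some x : opc E))) => //.
move=> A mA; apply: (measurableT_comp (measurable_kernel P A mA)).
exact: measurable_Some.
Qed.

Lemma optional_time_measurable tau : optional_time F tau ->
  measurable_fun setT tau.
Proof.
move=> [tau0 Ftau]; apply: (measurability (@ErealGenInftyO.G R)).
  exact: ErealGenInftyO.measurableE.
move=> _ [_ [r ->] <-]; rewrite setTI.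
have [r0|r0] := leP 0%R r.
  apply: (filtration_measurable X_hunt (t := r)).
  rewrite (_ : _ @^-1` _ = [set w | tau w < r%:E]); first exact: Ftau.
  by apply/seteqP; split => w /=; rewrite in_itv.
rewrite (_ : _ @^-1` _ = set0)//; apply/seteqP; split => // w /=.
by rewrite in_itv/= ltNge (le_trans _ (tau0 w))// lee_fin ltW.
Qed.

Lemma optional_time_cst (t : R) : (0 <= t)%R -> optional_time F (cst t%:E).
Proof.
move=> t0; split => [w|s s0]; first by rewrite lee_fin.
by rewrite /cst/=; exact: filtration_cst.
Qed.

Lemma sigma_after_cst (t : R) A : (0 <= t)%R -> F t A ->
  sigma_after F (cst t%:E) A.
Proof.
move=> t0 FA; split; first exact: (filtration_measurable X_hunt FA).
move=> s s0; rewrite /cst/= lte_fin; have [ts|st] := ltP t s.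
  apply: filtrationI; last exact: filtration_cst.
  exact: (filtration_le (ltW ts)).
rewrite (_ : _ `&` _ = set0); first exact: filtration0.
by apply/seteqP; split => // w [].
Qed.

Lemma sigma_afterT tau : optional_time F tau -> sigma_after F tau setT.
Proof. by move=> otau; split => // t t0; rewrite setTI; apply otau.2. Qed.

Variable eta : Omega -> R.
Hypotheses (meta : measurable_fun setT eta) (eta0 : forall w, (0 <= eta w)%R).

(** Under each P^x the law of the shifted path on D is described twice, by Dirac masses and by the
    strong Markov property on events. This extends the property from events to eta; integrating over
    mu then replaces P^x by P^mu. *)
Lemma strong_markov_prob_from tau A : optional_time F tau ->
  sigma_after F tau A ->
  \int[Pm]_(w in A `&` [set w | tau w < +oo]) (eta (theta (fine (tau w)) w))%:E
    =
  \int[Pm]_(w in A `&` [set w | tau w < +oo])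
    \int[P (X (fine (tau w)) w)]_v (eta v)%:E.
Proof.
move=> otau sA; have mtau := optional_time_measurable otau.
have mr : measurable_fun setT (fine \o tau) by exact: measurableT_comp.
have r0 w : (0 <= (fine \o tau) w)%R by rewrite fine_ge0//; apply otau.1.
have mX := measurable_X_time E_lc E_sep X_hunt mr r0.
have mth := measurable_theta_time E_lc E_sep X_hunt mr r0.
set D := A `&` _.
have mD : measurable D.
  apply: measurableI; first by case: sA.
  by rewrite -[X in measurable X]setTI; exact: emeasurable_fun_infty_o.
have mk B : measurable B -> measurable_fun setT (fun w =>
  P (X (fine (tau w)) w) B).
  by move=> mB; exact: (measurableT_comp (measurable_kernel P B mB) mX).
have meta' : measurable_fun setT (EFin \o eta) by exact/measurable_EFinP.
have mh : measurable_fun setT (fun w =>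
  \int[P (X (fine (tau w)) w)]_v (eta v)%:E).
  apply: (measurable_fun_integral_kernel (l := fun w =>
    P (X (fine (tau w)) w))) => //.
have eq x : \int[P x]_(w in D) (eta (theta (fine (tau w)) w))%:E =
    \int[P x]_(w in D) \int[P (X (fine (tau w)) w)]_v (eta v)%:E.
  pose m := pushforward (mrestr (P x) mD) (fun w => theta (fine (tau w)) w).
  have mE B : measurable B -> m B = P x (D `&` (fun w =>
    theta (fine (tau w)) w) @^-1` B).
    by move=> mB; rewrite /m/= /pushforward /mrestr setIC.
  transitivity (\int[m]_v (eta v)%:E).
    rewrite (@integral_mixture _ _ _ _ _ m (P x) D
      (fun w => dirac (theta (fine (tau w)) w)))//.
    - by apply: eq_integral => w _; rewrite integral_dirac// diracT mul1e.
    - move=> B mB; apply/measurable_EFinP.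
      have m1B : measurable_fun setT (\1_B : Omega ->
        R) by exact: measurable_indic.
      exact: (measurableT_comp m1B mth).
    - move=> B mB; rewrite [LHS]mE// setIC -(integral_indic (P x) mD).
        by apply: eq_integral => w _; rewrite /= /dirac !indicE;
          congr (_%:R%:E).
      by rewrite -[X in measurable X]setTI; exact: mth.
  rewrite (@integral_mixture _ _ _ _ _ m (P x) D
    (fun w => P (X (fine (tau w)) w)))// => B mB.
  rewrite [LHS]mE//; have := hunt_strong_markov X_hunt.1 x otau sA mB.
  rewrite setIA; apply.
rewrite integral_mkcond [RHS]integral_mkcond.
rewrite !integral_prob_from.
- by apply: eq_integral => x _; rewrite -!integral_mkcond.
- move=> w; apply: erestrict_ge0 => v _; apply: integral_ge0 => u _.
  by rewrite lee_fin.
- by apply/(measurable_restrictT _ mD); exact: measurable_funTS.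
- by move=> w; apply: erestrict_ge0 => v _; rewrite lee_fin.
- apply/(measurable_restrictT _ mD); apply: measurable_funTS.
  exact: (measurableT_comp meta' mth).
Qed.

End strong_markov_functional.

(** * Debuts along dyadic times *)

Section bounded_expectation.
Context d (T : measurableType d) (R : realType) (Q : probability T R).

Lemma bounded_integrable (c : R) (f : T -> R) (A : set T) : measurable A ->
  measurable_fun setT f -> (forall w, `|f w| <= c) ->
  Q.-integrable A (EFin \o f).
Proof.
move=> mA mf fc; apply: (@le_integrable _ _ _ Q A mA _ (EFin \o cst c)).
- by apply/measurable_EFinP; exact: measurable_funTS.
- by move=> w _ /=; rewrite lee_fin (le_trans (fc w))// ler_norm.
- exact: finite_measure_integrable_cst.
Qed.

Lemma ge_Rintegral_cst (c c' : R) (f : T -> R) (A : set T) : measurable A ->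
  measurable_fun setT f -> (forall w, `|f w| <= c) ->
  (forall w, A w -> c' <= f w) ->
  c' * fine (Q A) <= \int[Q]_(w in A) f w.
Proof.
move=> mA mf fc c'f; rewrite -Rintegral_cst//; apply: le_Rintegral => //.
- exact: finite_measure_integrable_cst.
- exact: (@bounded_integrable c).
Qed.

Lemma le_Rintegral_cst (c c' : R) (f : T -> R) (A : set T) : measurable A ->
  measurable_fun setT f -> (forall w, `|f w| <= c) ->
  (forall w, A w -> f w <= c') ->
  \int[Q]_(w in A) f w <= c' * fine (Q A).
Proof.
move=> mA mf fc c'f; rewrite -Rintegral_cst//; apply: le_Rintegral => //.
- exact: (@bounded_integrable c).
- exact: finite_measure_integrable_cst.
Qed.

(** Dominated convergence in which the domain moves too, since the events {tau_n < oo} vary with n;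
    pointwise, membership in [A_ n] is eventually that in A. *)
Lemma cvg_Rintegral_bounded (c : R) (f_ : nat -> T -> R) (f : T -> R)
    (A_ : nat -> set T) (A : set T) :
  (forall n, measurable (A_ n)) -> measurable A ->
  (forall n, measurable_fun setT (f_ n)) -> measurable_fun setT f ->
  (forall n w, `|f_ n w| <= c) ->
  (forall w, A w -> f_ n w @[n --> \oo] --> f w) ->
  (forall w, A w -> \forall n \near \oo, A_ n w) ->
  (forall w, ~ A w -> \forall n \near \oo, ~ A_ n w) ->
  \int[Q]_(w in A_ n) f_ n w @[n --> \oo] --> \int[Q]_(w in A) f w.
Proof.
move=> mA_ mA mf_ mf fc ff AA nAA; rewrite /Rintegral.
have intA_ n : Q.-integrable (A_ n) (EFin \o f_ n).
  exact: (@bounded_integrable c).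
have c0 : 0 <= c by rewrite (le_trans _ (fc 0%N point)).
have := @dominated_convergence _ _ _ Q setT measurableT
  (fun n => (EFin \o f_ n) \_ (A_ n)) ((EFin \o f) \_ A) (EFin \o cst c).
case.
- move=> n; apply/(measurable_restrictT _ (mA_ n)).
  by apply/measurable_EFinP; exact: measurable_funTS.
- apply/(measurable_restrictT _ mA).
  by apply/measurable_EFinP; exact: measurable_funTS.
- apply: aeW => w _ /=; rewrite /patch; case: ifPn => [/set_mem|/negP] Aw.
    apply: cvg_EFin; first by apply: nearW => n; case: ifPn.
    apply: (@cvg_trans _ (f_ n w @[n --> \oo])); last exact: ff.
    apply: near_eq_cvg; have := AA w Aw; apply: filterS => n Anw /=.
    by rewrite mem_set.
  have nAw : ~ A w by move=> Aw'; apply: Aw; rewrite inE.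
  apply: cvg_near_cst; have := nAA w nAw; apply: filterS => n Anw.
  by rewrite memNset.
- exact: finite_measure_integrable_cst.
- apply: aeW => w n _ /=; rewrite /patch; case: ifPn => _ /=.
    by rewrite lee_fin.
  by rewrite normr0 lee_fin.
move=> intA _ cvgA; apply: fine_cvg.
rewrite fineK.
  rewrite [X in _ --> X]integral_mkcond.
  rewrite (_ : (fun n => _) = [sequence
    (\int[Q]_x ((EFin \o f_ n) \_ (A_ n)) x)%E]_n)//.
  by apply/funext => n; rewrite integral_mkcond.
by rewrite integrable_fin_num// (integrable_mkcond _ mA).
Qed.

End bounded_expectation.

Section debut.
Context (R : realType) (Omega : Type).
Implicit Types (S : set R) (C : R -> set Omega) (w : Omega).
Local Open Scope ereal_scope.

(** The horizon N bounds all finite debuts, so an increasing sequence of finite debuts has a finite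
    supremum. *)
Definition dyadics (N : R) : set R :=
  [set q | exists m k, q = dyadic R m k /\ (q <= N)%R].

Definition grid (N : R) (m : nat) : set R :=
  [set q | exists k, q = dyadic R m k /\ (q <= N)%R].

(** An infimum over countably many times in the applications, so measurability is elementary; in
    exchange it need be neither attained nor equal to the infimum over all real times. *)
Definition debut S C w : \bar R := ereal_inf [set q%:E | q in [set q | S q /\ C
  q w]].

Lemma debut_ltP S C w x : debut S C w < x <->
  exists q, [/\ S q, C q w & q%:E < x].
Proof.
split=> [/ereal_inf_lt[_ [q [Sq Cq] <-] qx]|[q [Sq Cq]]]; first by exists q.
by apply: le_lt_trans; apply: ereal_inf_lbound; exists q.
Qed.

Lemma debut_le S C w q : S q -> C q w -> debut S C w <= q%:E.
Proof. by move=> Sq Cq; apply: ereal_inf_lbound; exists q. Qed.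

Lemma debut_ge S C w x : (forall q, S q -> C q w -> x <= q%:E) ->
  x <= debut S C w.
Proof. by move=> xq; apply: le_ereal_inf_tmp => _ [q [Sq Cq] <-];
  exact: xq. Qed.

Lemma grid_dyadics N m : grid N m `<=` dyadics N.
Proof. by move=> q [k qk]; exists m, k. Qed.

Lemma dyadics_ge0 N q : dyadics N q -> (0 <= q)%R.
Proof. by move=> [m [k [-> _]]]; exact: dyadic_ge0. Qed.

Lemma le_grid N m n : (m <= n)%N -> grid N m `<=` grid N n.
Proof.
move=> mn q [k [-> qN]]; exists (k * 2 ^ (n - m))%N; split => //.
rewrite /dyadic; have -> : (2 ^+ n = 2 ^+ (n - m) * 2 ^+ m :> R)%R.
  by rewrite -exprD subnK.
by rewrite natrM natrX invfM mulrA mulfK// expf_neq0.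
Qed.

Lemma debut_grid_attained N m C w : debut (grid N m) C w < +oo ->
  exists q, [/\ grid N m q, C q w & debut (grid N m) C w = q%:E].
Proof.
move=> /debut_ltP[_ [[k [-> kN]] Ck _]].
pose Q k := `[< (dyadic R m k <= N)%R /\ C (dyadic R m k) w >].
have exQ : exists k, Q k by exists k; apply/asboolP.
have [j /asboolP[jN Cj] jmin] := ex_minnP exQ.
exists (dyadic R m j); split => //; first by exists j.
apply/eqP; rewrite eq_le debut_le//=; last by exists j.
apply: debut_ge => _ [i [-> iN]] Ci;
  rewrite lee_fin ler_pM2r ?invr_gt0 ?exprn_gt0//.
by rewrite ler_nat; apply: jmin; apply/asboolP.
Qed.

Lemma debut_ge0 N S C w : S `<=` dyadics N -> 0 <= debut S C w.
Proof.
by move=> SN; apply: debut_ge => q /SN/dyadics_ge0; rewrite lee_fin.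
Qed.

Lemma debut_leN N S C w : S `<=` dyadics N -> debut S C w < +oo ->
  debut S C w <= N%:E.
Proof.
move=> SN /debut_ltP[q [Sq Cq _]]; apply: le_trans (debut_le Sq Cq) _.
by have [m [k [_ qN]]] := SN _ Sq; rewrite lee_fin.
Qed.

Lemma debut_fin_num N S C w : S `<=` dyadics N -> debut S C w < +oo ->
  debut S C w \is a fin_num.
Proof. by move=> SN doo; rewrite ge0_fin_numE// (debut_ge0 _ _ SN). Qed.

Lemma debut_grid_lty N C w : debut (dyadics N) C w < +oo ->
  \forall m \near \oo, debut (grid N m) C w < +oo.
Proof.
move=> /debut_ltP[q [[m [k [-> qN]]] Cq _]]; exists m => // n /= mn.
apply/debut_ltP; exists (dyadic R m k); split => //; last exact: ltry.
by apply: (le_grid mn); exists k.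
Qed.

Lemma debut_grid_cvg N C w : debut (dyadics N) C w < +oo ->
  fine (debut (grid N m) C w) @[m --> \oo] --> fine (debut (dyadics N) C w).
Proof.
move=> doo; have dfin := debut_fin_num (@subset_refl _ _) doo.
apply/cvgr_ltP => e e0.
have : debut (dyadics N) C w < (fine (debut (dyadics N) C w) + e)%:E.
  by rewrite EFinD fineK// lteDl// lte_fin.
move=> /debut_ltP[q [[m [k [-> qN]]] Cq qe]]; exists m => n mn.
have gq : grid N n (dyadic R m k) by apply: (le_grid mn); exists k.
have le1 := debut_le gq Cq.
have le2 : debut (dyadics N) C w <= debut (grid N n) C w.
  by apply: debut_ge => r /grid_dyadics; exact: debut_le.
have gfin : debut (grid N n) C w \is a fin_num.
  apply: (debut_fin_num (@grid_dyadics N n)).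
  by rewrite (le_lt_trans le1)// ltry.
rewrite -lte_fin; rewrite -(fineK gfin) -(fineK dfin) !lee_fin in le1 le2.
rewrite lte_fin in qe.
by rewrite lte_fin ger0_norm ?subr_ge0//; lra.
Qed.

End debut.

Section kernel_probability.
Context d d' (T : measurableType d) (T' : measurableType d') (R : realType).
Variable k : R.-pker T ~> T'.

(** A synonym of [k x] that carries a probability structure, so that lemmas stated for probabilities
    apply to each [P x]. *)
Definition kernel_probability (x : T) : set T' -> \bar R := k x.
HB.instance Definition _ x := Measure.on (kernel_probability x).
HB.instance Definition _ x := Measure_isProbability.Build _ _ _
  (kernel_probability x) (prob_kernel x).

End kernel_probability.

(** * Strong Markov identities for functionals with continuous shifts *)

Section shift_functional.
Context (R : realType) (E : pmetricType R).
Hypotheses (E_lc : locally_compact [set: E]) (E_sep : separable E).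
Context (d : measure_display) (Omega : measurableType d).
Variables (X : R -> Omega -> opc E) (theta : R -> Omega -> Omega).
Variable P : R.-pker borel (opc E) ~> Omega.
Hypothesis X_hunt : continuous_hunt_process X theta P.
Variable mu : probability (borel E) R.
Local Notation F := (natural_filtration X).
Local Notation Pm := (prob_from P mu).

Definition mean (eta : Omega -> R) (x : opc E) : R := \int[P x]_w eta w.

Definition shift_continuous (eta : Omega -> R) :=
  [/\ measurable_fun setT eta, forall w, 0 <= eta w <= 1 &
      forall w, seq_cont (fun t => eta (theta t w))].

(** {tau < t} is a countable union of events known at dyadic times before t, whereas {tau <= t} may
    depend on times just after t: hence optional times rather than stopping times. *)
Lemma debut_optional N S (C : R -> set Omega) : S `<=` dyadics N ->
  (forall q, S q -> F q (C q)) -> optional_time F (debut S C).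
Proof.
move=> SN FC; split=> [w|t t0]; first exact: debut_ge0 SN.
rewrite (_ : [set _ | _] = \bigcup_m \bigcup_k
  ([set _ | S (dyadic R m k) /\ dyadic R m k < t] `&` C (dyadic R m k)));
    last first.
  apply/seteqP; split=> [w /= /debut_ltP[q [Sq Cq qt]]|w].
    have [m [k [qE _]]] := SN _ Sq; subst q.
    by exists m => //; exists k.
  move=> [m _ [k _ [[/= Sq qt] Cq]]]; apply/debut_ltP.
  by exists (dyadic R m k).
apply: filtration_bigcup => m; apply: filtration_bigcup => k.
have [[Sq qt]|nSq] := pselect (S (dyadic R m k) /\ dyadic R m k < t).
  apply: filtrationI; first exact: filtration_cst.
  by apply: (filtration_le (ltW qt)); exact: FC.
rewrite (_ : _ `&` _ = set0); first exact: filtration0.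
by apply/seteqP; split => // w [].
Qed.

Variable eta : Omega -> R.
Hypothesis eta_sc : shift_continuous eta.
Let meta : measurable_fun setT eta. Proof. by case: eta_sc. Qed.
Let eta01 w : 0 <= eta w <= 1. Proof. by case: eta_sc. Qed.
Let eta0 w : 0 <= eta w. Proof. by case/andP: (eta01 w). Qed.
Let normeta w : `|eta w| <= 1.
Proof. by rewrite ger0_norm//; case/andP: (eta01 w). Qed.

Local Notation h := (mean eta).

Let eta_int x : (P x).-integrable setT (EFin \o eta).
Proof. exact: (@bounded_integrable _ _ _ (kernel_probability P x) 1). Qed.

Lemma meanE x : (\int[P x]_w (eta w)%:E)%E = (h x)%:E.
Proof. by rewrite /mean /Rintegral fineK// integrable_fin_num. Qed.

Lemma mean01 x : 0 <= h x <= 1.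
Proof.
rewrite Rintegral_ge0//=.
have := @le_Rintegral_cst _ _ _ (kernel_probability P x) 1 1 _ _ measurableT
  meta normeta.
rewrite {2}/kernel_probability prob_kernel mul1r; apply => w _.
by case/andP: (eta01 w).
Qed.

Let normh x : `|h x| <= 1.
Proof. by case/andP: (mean01 x) => ? ?; rewrite ger0_norm. Qed.

Lemma mean_compl x : mean (fun w => 1 - eta w) x = 1 - h x.
Proof.
rewrite /mean RintegralB//; last exact: (finite_measure_integrable_cst
  (kernel_probability P x)).
by rewrite Rintegral_cst// mul1r prob_kernel.
Qed.

Lemma shift_continuous_compl : shift_continuous (fun w => 1 - eta w).
Proof.
split; first exact: measurable_funB.
  by move=> w; case/andP: (eta01 w) => ? ?; apply/andP; split; lra.
move=> w t_ t t_0 t0 tt; apply: cvgB; first exact: cvg_cst.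
by case: eta_sc => _ _; apply.
Qed.

Lemma measurable_mean : measurable_fun setT (h : borel (opc E) -> R).
Proof.
apply/measurable_EFinP; rewrite (_ : _ \o _ = fun x =>
  (\int[P x]_w (eta w)%:E)%E).
  apply: (measurable_fun_integral_kernel (measurable_kernel P)).
    by move=> w; rewrite lee_fin.
  exact/measurable_EFinP.
by apply/funext => x /=; rewrite meanE.
Qed.

Section at_optional_time.
Variable tau : Omega -> \bar R.
Hypothesis otau : optional_time F tau.

Let mr : measurable_fun setT (fine \o tau).
Proof. by apply: measurableT_comp => //;
  exact: (optional_time_measurable X_hunt otau). Qed.
Let r0 w : 0 <= (fine \o tau) w.
Proof. by rewrite fine_ge0//; apply otau.1. Qed.

Lemma optional_time_lty : measurable [set w | (tau w < +oo)%E].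
Proof.
rewrite -[X in measurable X]setTI; apply: emeasurable_fun_infty_o => //.
exact: (optional_time_measurable X_hunt otau).
Qed.

Lemma measurable_shift : measurable_fun setT (fun w =>
  eta (theta (fine (tau w)) w)).
Proof.
apply: (measurableT_comp meta).
exact: (measurable_theta_time E_lc E_sep X_hunt mr).
Qed.

Lemma measurable_mean_X : measurable_fun setT (fun w => h (X (fine (tau w)) w)).
Proof.
apply: (measurableT_comp measurable_mean).
exact: (measurable_X_time E_lc E_sep X_hunt mr).
Qed.

Lemma strong_markov_Rintegral A : sigma_after F tau A ->
  \int[Pm]_(w in A `&` [set w | (tau w < +oo)%E]) eta (theta (fine (tau w)) w) =
  \int[Pm]_(w in A `&` [set w | (tau w < +oo)%E]) h (X (fine (tau w)) w).
Proof.
move=> sA; congr fine.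
apply: (etrans (strong_markov_prob_from E_lc E_sep X_hunt mu meta eta0 otau
  sA)).
by apply: eq_integral => w _; rewrite meanE.
Qed.

Lemma strong_markov_RintegralT :
  \int[Pm]_(w in [set w | (tau w < +oo)%E]) eta (theta (fine (tau w)) w) =
  \int[Pm]_(w in [set w | (tau w < +oo)%E]) h (X (fine (tau w)) w).
Proof.
have := strong_markov_Rintegral (sigma_afterT otau).
by rewrite !setTI.
Qed.

End at_optional_time.

(** Since eta(theta_t w) is continuous in t, its expectation passes to the limit along converging
    times, although h(X) might not converge along them. *)
Lemma cvg_shift_Rintegral (tau_ : nat -> Omega -> \bar R) (tau : Omega ->
  \bar R) :
  (forall n, optional_time F (tau_ n)) -> optional_time F tau ->
  (forall w, (tau w < +oo)%E -> \forall n \near \oo, (tau_ n w < +oo)%E) ->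
  (forall w, ~ (tau w < +oo)%E -> \forall n \near \oo, ~ (tau_ n w < +oo)%E) ->
  (forall w, (tau w < +oo)%E ->
    fine (tau_ n w) @[n --> \oo] --> fine (tau w)) ->
  \int[Pm]_(w in [set w | (tau_ n w < +oo)%E]) eta (theta (fine (tau_ n w)) w)
    @[n --> \oo] -->
  \int[Pm]_(w in [set w | (tau w < +oo)%E]) eta (theta (fine (tau w)) w) /\
  fine (Pm [set w | (tau_ n w < +oo)%E]) @[n --> \oo] -->
  fine (Pm [set w | (tau w < +oo)%E]).
Proof.
move=> otau_ otau yes no cvt; split.
  apply: (@cvg_Rintegral_bounded _ _ _ _ 1) => //.
  - by move=> n; exact: optional_time_lty.
  - exact: optional_time_lty.
  - by move=> n; exact: measurable_shift.
  - exact: measurable_shift.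
  - move=> w /= tauw; case: eta_sc => _ _ /(_ w)/(_ (fun n => fine (tau_ n w))).
    apply; last exact: cvt.
      by move=> n; rewrite fine_ge0//; apply (otau_ n).1.
    by rewrite fine_ge0//; apply otau.1.
have := @cvg_Rintegral_bounded _ _ _ Pm 1 (fun _ _ => 1) (fun=> 1)
  (fun n => [set w | (tau_ n w < +oo)%E]) [set w | (tau w < +oo)%E].
have cstE sig : optional_time F sig ->
    \int[Pm]_(w in [set w | (sig w < +oo)%E]) 1 = fine (Pm [set w | (sig w <
      +oo)%E]).
  by move=> osig; rewrite Rintegral_cst ?mul1r//; exact: optional_time_lty.
rewrite cstE// (_ : (fun n => Rintegral _ _ _) =
  fun n => fine (Pm [set w | (tau_ n w < +oo)%E])); last first.
  by apply/funext => n; rewrite cstE.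
apply => //.
- by move=> n; exact: optional_time_lty.
- exact: optional_time_lty.
- by move=> n w; rewrite normr1.
- by move=> w _; exact: cvg_cst.
Qed.

(** At [tau], an infimum, the bound on h(X) contained in C may fail. It holds at the debuts over the
    grids, which are attained; the strong Markov property turns it into a bound on the integral of
    eta(theta), and this one survives the limit. *)
Lemma debut_Rintegral_bounds N (C : R -> set Omega) a b :
  (forall q, dyadics N q -> F q (C q)) ->
  let tau := debut (dyadics N) C in
  ((forall q w, dyadics N q -> C q w -> b <= h (X q w)) ->
   b * fine (Pm [set w | (tau w < +oo)%E]) <=
   \int[Pm]_(w in [set w | (tau w < +oo)%E]) eta (theta (fine (tau w)) w)) /\
  ((forall q w, dyadics N q -> C q w -> h (X q w) <= a) ->
   \int[Pm]_(w in [set w | (tau w < +oo)%E]) eta (theta (fine (tau w)) w) <=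
   a * fine (Pm [set w | (tau w < +oo)%E])).
Proof.
move=> FC tau; pose tau_ m := debut (grid N m) C.
have otau : optional_time F tau by exact: (@debut_optional N).
have otau_ m : optional_time F (tau_ m).
  apply: (debut_optional (@grid_dyadics R N m)) => q /grid_dyadics.
  exact: FC.
have no w : ~ (tau w < +oo)%E -> \forall m \near \oo, ~ (tau_ m w < +oo)%E.
  move=> tauw; apply: nearW => m tmw; apply: tauw; apply: le_lt_trans tmw.
  by apply: debut_ge => q /grid_dyadics gq Cq; exact: debut_le.
have := @cvg_shift_Rintegral tau_ tau otau_ otau
  (fun w tauw => debut_grid_lty tauw) no (fun w tauw => debut_grid_cvg tauw).
move=> [cvI cvP].
have hX m w : (tau_ m w < +oo)%E -> exists q,
    [/\ dyadics N q, C q w & fine (tau_ m w) = q].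
  move=> tmw; have [q [gq Cq tq]] := debut_grid_attained tmw.
  by exists q; rewrite /tau_ tq; split => //; exact: grid_dyadics gq.
split=> [hb|ha].
  apply: (ler_cvg_to (cvgMl_tmp (a := b) cvP) cvI); apply: nearW => m.
  rewrite strong_markov_RintegralT//.
  apply: (@ge_Rintegral_cst _ _ _ _ 1) => //.
  - exact: optional_time_lty.
  - exact: measurable_mean_X.
  - by move=> w /hX[q [Nq Cq ->]]; exact: hb.
apply: (ler_cvg_to cvI (cvgMl_tmp (a := a) cvP)); apply: nearW => m.
rewrite strong_markov_RintegralT//.
apply: (@le_Rintegral_cst _ _ _ _ 1) => //.
- exact: optional_time_lty.
- exact: measurable_mean_X.
- by move=> w /hX[q [Nq Cq ->]]; exact: ha.
Qed.

End shift_functional.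

Lemma cvgr_subseq (R : realType) (u : nat -> R) (l : R) (k : nat -> nat) :
  (forall n, (n <= k n)%N) -> u n @[n --> \oo] --> l ->
  u (k n) @[n --> \oo] --> l.
Proof.
move=> kn /cvgr_ltP ul; apply/cvgr_ltP => e /ul[M Mu].
by exists M => n Mn; apply: Mu; rewrite (leq_trans Mn).
Qed.

(** * Increasing sequences of optional times and their suprema *)

Section announced_times.
Context (R : realType) (E : pmetricType R).
Hypotheses (E_lc : locally_compact [set: E]) (E_sep : separable E).
Context (d : measure_display) (Omega : measurableType d).
Variables (X : R -> Omega -> opc E) (theta : R -> Omega -> Omega).
Variable P : R.-pker borel (opc E) ~> Omega.
Hypothesis X_hunt : continuous_hunt_process X theta P.
Variable mu : probability (borel E) R.
Local Notation F := (natural_filtration X).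
Local Notation Pm := (prob_from P mu).

Section supremum.
Variables (N : R) (S_ : nat -> Omega -> \bar R).
Hypothesis oS : forall n, optional_time F (S_ n).
Hypothesis ndS : forall n w, (S_ n w <= S_ n.+1 w)%E.
Hypothesis SN : forall n w, (S_ n w < +oo)%E -> (S_ n w <= N%:E)%E.
Local Open Scope ereal_scope.

Let T w := ereal_sup (range (S_ ^~ w)).

Lemma sup_time_ubound n w : S_ n w <= T w.
Proof. by apply: ereal_sup_ubound; exists n. Qed.

(** A supremum of times below t may equal t, hence the margin [j.+1%:R^-1] common to all n. *)
Lemma sup_time_optional : optional_time F T.
Proof.
split=> [w|t t0].
  by apply: le_trans (sup_time_ubound 0%N w); apply (oS 0%N).1.
rewrite (_ : [set _ | _] = \bigcup_j ([set _ | (0 <= t - j.+1%:R^-1)%R] `&`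
   \bigcap_n [set w | S_ n w < (t - j.+1%:R^-1)%:E])); last first.
  apply/seteqP; split => [w /= Tt|w [j _ [/= _ Sj]]]; last first.
    apply: (@le_lt_trans _ _ (t - j.+1%:R^-1)%:E).
      by apply: ge_ereal_sup => _ [n _ <-]; apply: ltW; exact: Sj.
    by rewrite lte_fin ltrBlDr ltrDl invr_gt0.
  have T0 : 0 <= T w by apply: le_trans (sup_time_ubound 0%N w);
    apply (oS 0%N).1.
  have Tfin : T w \is a fin_num by rewrite ge0_fin_numE// (lt_trans Tt) ?ltry.
  move: Tt; rewrite -(fineK Tfin) lte_fin => /ltr_add_invr[j Tj].
  exists j => //; split => /=.
    by rewrite subr_ge0 (le_trans _ (ltW Tj))// lerDr fine_ge0.
  move=> n _ /=; apply: le_lt_trans (sup_time_ubound n w) _.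
  by rewrite -(fineK Tfin) lte_fin ltrBrDr.
apply: filtration_bigcup => j.
have [jt|jt] := leP 0%R (t - j.+1%:R^-1)%R; last first.
  rewrite (_ : _ `&` _ = set0); first exact: filtration0.
  by apply/seteqP; split => // w [].
apply: filtrationI; first exact: filtration_cst.
apply: filtration_bigcap => n.
apply: (@filtration_le _ _ _ _ _ (t - j.+1%:R^-1)%R); last exact: (oS n).2.
by rewrite lerBlDr lerDl invr_ge0.
Qed.

Lemma sup_time_lty w : (T w < +oo) <-> forall n, S_ n w < +oo.
Proof.
split=> [Tw n|Sw]; first exact: le_lt_trans (sup_time_ubound n w) Tw.
apply: (@le_lt_trans _ _ N%:E); last exact: ltry.
by apply: ge_ereal_sup => _ [n _ <-]; exact: SN.
Qed.

Lemma cvg_sup_time w : T w < +oo ->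
  fine (S_ n w) @[n --> \oo] --> fine (T w).
Proof.
move=> Tw; have T0 : 0 <= T w.
  by apply: le_trans (sup_time_ubound 0%N w); apply (oS 0%N).1.
apply: fine_cvg; rewrite fineK ?ge0_fin_numE//.
apply: ereal_nondecreasing_cvgn; apply/nondecreasing_seqP => n.
exact: ndS.
Qed.

Lemma cvg_sup_time_Rintegral eta : shift_continuous theta eta ->
  (\int[Pm]_(w in [set w | (S_ n w < +oo)%E]) eta (theta (fine (S_ n w)) w)
    @[n --> \oo] -->
  \int[Pm]_(w in [set w | (T w < +oo)%E]) eta (theta (fine (T w)) w) /\
  fine (Pm [set w | (S_ n w < +oo)%E]) @[n --> \oo] -->
  fine (Pm [set w | (T w < +oo)%E]))%R.
Proof.
move=> eta_sc; apply: (cvg_shift_Rintegral E_lc E_sep X_hunt _ eta_sc oS).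
- exact: sup_time_optional.
- move=> w Tw; apply: nearW => n; exact: (sup_time_lty w).1 Tw n.
- move=> w /sup_time_lty/existsNP[m Sm]; exists m => // n /= mn Sn; apply: Sm.
  have /nondecreasing_seqP ndSw : forall n, (S_ n w <= S_ n.+1 w)%E by [].
  by apply: le_lt_trans Sn; exact: ndSw.
- exact: cvg_sup_time.
Qed.

End supremum.

Variable eta : Omega -> R.
Hypothesis eta_sc : shift_continuous theta eta.
Local Notation h := (mean P eta).

Let mh := measurable_mean P eta_sc.

Lemma filtration_mean_le q a : 0 <= q -> F q [set w | h (X q w) <= a].
Proof.
move=> q0; rewrite (_ : [set _ | _] = X q @^-1` (h @^-1` `]-oo, a]));
  last first.
  by apply/seteqP; split => w /=; rewrite in_itv.
apply: filtration_X; first by rewrite q0 lexx.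
by rewrite -[X in measurable X]setTI; exact: mh.
Qed.

Lemma filtration_mean_ge q b : 0 <= q -> F q [set w | b <= h (X q w)].
Proof.
move=> q0; rewrite (_ : [set _ | _] = X q @^-1` (h @^-1` `[b, +oo[));
  last first.
  by apply/seteqP; split => w /=; rewrite in_itv/= andbT.
apply: filtration_X; first by rewrite q0 lexx.
by rewrite -[X in measurable X]setTI; exact: mh.
Qed.

(* Times at which X enters smaller and smaller neighbourhoods of K announce the
   hitting time T of K, and X_T is the limit of X along them, so both sides of
   E[eta o theta] agree at T. *)
Lemma negligible_announced (N a b : R) (psi : nat -> opc E ->
  R) (K : set (opc E))
    (C : nat -> R -> set Omega) : a < b ->
  (forall n, continuous (psi n)) ->
  (forall x, ~ K x -> \forall n \near \oo, psi n x = 0) ->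
  (forall n q, dyadics N q -> F q (C n q)) ->
  (forall n q, C n.+1 q `<=` C n q) ->
  (forall n q w, dyadics N q -> C n q w -> h (X q w) <= a) ->
  (forall n i q w, dyadics N q -> (i <= n)%N -> C n q w ->
    2^-1 <= psi i (X q w)) ->
  (forall x, K x -> b <= h x) ->
  Pm.-negligible [set w | forall n, exists q, dyadics N q /\ C n q w].
Proof.
move=> ab cpsi psiK FC decC Ca Cpsi Kb.
pose S_ n := debut (dyadics N) (C n).
have oS n : optional_time F (S_ n) by apply: (debut_optional (N := N)) => //;
  exact: FC.
have ndS n w : (S_ n w <= S_ n.+1 w)%E.
  by apply: debut_ge => q Nq Cq; apply: debut_le => //; exact: decC.
have SN n w : (S_ n w < +oo)%E -> (S_ n w <= N%:E)%E by exact: debut_leN.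
pose T w := ereal_sup (range (S_ ^~ w)).
have oT : optional_time F T by exact: sup_time_optional.
have S0 n w : (0 <= S_ n w)%E by apply (oS n).1.
(* The infimum [S_ n] need not be a time of [C n], but such times approach it from the right, and
   the condition on [psi i] is closed and continuous in time. *)
have psiS n i w : (S_ n w < +oo)%E -> (i <= n)%N ->
    2^-1 <= psi i (X (fine (S_ n w)) w).
  move=> Soo le_in; rewrite leNgt; apply/negP => psi_lt.
  have Sfin : S_ n w \is a fin_num by rewrite ge0_fin_numE.
  have [|del del0 near_psi] := X_near X_hunt w (cpsi i)
    (fine_ge0 (S0 n w)) (e := 2^-1 - psi i (X (fine (S_ n w)) w)).
    by rewrite subr_gt0.
  have : (S_ n w < (fine (S_ n w) + del)%:E)%E.
    by rewrite EFinD fineK// lteDl// lte_fin.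
  move=> /debut_ltP[q [Nq Cq]]; rewrite lte_fin => q_lt.
  have Sq : fine (S_ n w) <= q by rewrite -lee_fin fineK//; exact: debut_le.
  have := near_psi q (dyadics_ge0 Nq).
  rewrite ger0_norm ?subr_ge0// => /(_ _)/ltr_normlW.
  by have := Cpsi _ _ _ _ Nq le_in Cq; move=> ? /(_ _); lra.
have KT w : (T w < +oo)%E -> K (X (fine (T w)) w).
  move=> Tw; apply: contrapT => /psiK[i _ /(_ i (leqnn i))/= psi0].
  have T0 : 0 <= fine (T w) by rewrite fine_ge0//; apply oT.1.
  have := seq_cont_X X_hunt (w := w) (cpsi i) (fun n => fine_ge0 (S0 n w)) T0
    (cvg_sup_time oS ndS Tw).
  move=> /cvgr_ltP/(_ 2^-1); rewrite psi0 invr_gt0 => /(_ (ltr0n _ 2))[M].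
  move=> /(_ (maxn M i) (leq_maxl _ _)); rewrite subr0 => /ltr_normlW.
  apply/negP; rewrite -leNgt; apply: psiS; last exact: leq_maxr.
  by move: Tw => /(sup_time_lty SN).
have [cvI cvP] := cvg_sup_time_Rintegral oS ndS SN eta_sc.
(* Put p = P(T < oo). The announcing times give at most a p in the limit, and X_T in K gives at
   least b p; a < b leaves only p = 0. *)
have lea : \int[Pm]_(w in [set w | (T w < +oo)%E]) eta (theta (fine (T w)) w) <=
    a * fine (Pm [set w | (T w < +oo)%E]).
  apply: (ler_cvg_to cvI (cvgMl_tmp (a := a) cvP)); apply: nearW => n.
  have [_] := debut_Rintegral_bounds E_lc E_sep X_hunt mu eta_sc a b (FC n).
  by apply => q w; exact: Ca.
have mT := optional_time_lty X_hunt oT.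
have leb : b * fine (Pm [set w | (T w < +oo)%E]) <=
    \int[Pm]_(w in [set w | (T w < +oo)%E]) eta (theta (fine (T w)) w).
  rewrite (strong_markov_RintegralT E_lc E_sep X_hunt mu eta_sc oT).
  apply: (@ge_Rintegral_cst _ _ _ _ 1) => //.
  - exact: (measurable_mean_X E_lc E_sep X_hunt eta_sc oT).
  - move=> w; have /andP[h0 h1] := mean01 P eta_sc (X (fine (T w)) w).
    by rewrite ger0_norm.
  - by move=> w /KT; exact: Kb.
exists [set w | (T w < +oo)%E]; split => //.
  have PT0 : 0 <= fine (Pm [set w | (T w < +oo)%E]) by rewrite fine_ge0.
  have PT : fine (Pm [set w | (T w < +oo)%E]) = 0 by nra.
  by rewrite -[LHS]fineK ?fin_num_measure// PT.
move=> w Cw; apply/(sup_time_lty SN) => n; apply/debut_ltP.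
by have [q [Nq Cq]] := Cw n; exists q; split => //; exact: ltry.
Qed.

(** Odd-numbered times are debuts of {h(X) >= b}, even-numbered ones of {h(X) <= a}. The inequality
    with the previous time is strict because that time is only optional: this keeps the event in
    [F q]. *)
Fixpoint crossing (N a b : R) (n : nat) : Omega -> \bar R :=
  if n is n'.+1 then
    debut (dyadics N) (fun q => [set w | (crossing N a b n' w < q%:E)%E /\
      if odd n' then h (X q w) <= a else b <= h (X q w)])
  else cst 0%E.

(** Odd and even crossing times have the same supremum T, so the integral of eta(theta_T) is both at
    least b p and at most a p, with p = P(T < oo). The value h(X_T) itself never enters. *)
Lemma negligible_crossing N a b : 0 <= N -> a < b ->
  Pm.-negligible [set w | forall n, (crossing N a b n w < +oo)%E].
Proof.
move=> N0 ab; pose S_ := crossing N a b.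
pose C n q := [set w | (S_ n w < q%:E)%E /\
  if odd n then h (X q w) <= a else b <= h (X q w)].
have FC n q : optional_time F (S_ n) -> dyadics N q -> F q (C n q).
  move=> oS Nq; have q0 := dyadics_ge0 Nq; apply: filtrationI;
    first exact: oS.2.
  case: (odd n); [exact: filtration_mean_le|exact: filtration_mean_ge].
have oS n : optional_time F (S_ n).
  elim: n => [|n IH]; first exact: optional_time_cst.
  by apply: (debut_optional (N := N)) => // q; exact: FC.
have ndS n w : (S_ n w <= S_ n.+1 w)%E.
  by apply: debut_ge => q Nq [/ltW].
have SN n w : (S_ n w < +oo)%E -> (S_ n w <= N%:E)%E.
  by case: n => [|n]; [rewrite lee_fin|exact: debut_leN].
pose T w := ereal_sup (range (S_ ^~ w)).
have oT : optional_time F T by exact: sup_time_optional.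
have mT := optional_time_lty X_hunt oT.
have [cvI cvP] := cvg_sup_time_Rintegral oS ndS SN eta_sc.
have bnd n := debut_Rintegral_bounds E_lc E_sep X_hunt mu eta_sc a b
  (fun q => FC n q (oS n)).
have lea : \int[Pm]_(w in [set w | (T w < +oo)%E]) eta (theta (fine (T w)) w) <=
    a * fine (Pm [set w | (T w < +oo)%E]).
  (* The crossing time numbered 2n+2 is defined from the odd index 2n+1, hence is a debut of {h(X)
     <= a}. *)
  have dbl n : (n <= n.*2.+2)%N by rewrite -addnn -addn2; lia.
  apply: (ler_cvg_to (cvgr_subseq dbl cvI)
    (cvgMl_tmp (a := a) (cvgr_subseq dbl cvP))); apply: nearW => n.
  have [_] := bnd n.*2.+1; apply => q w Nq [_].
  by rewrite /= odd_double.
have leb : b * fine (Pm [set w | (T w < +oo)%E]) <=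
    \int[Pm]_(w in [set w | (T w < +oo)%E]) eta (theta (fine (T w)) w).
  have dbl n : (n <= n.*2.+1)%N by rewrite -addnn -addn1; lia.
  apply: (ler_cvg_to (cvgMl_tmp (a := b) (cvgr_subseq dbl cvP))
    (cvgr_subseq dbl cvI)); apply: nearW => n.
  have [+ _] := bnd n.*2; apply => q w Nq [_].
  by rewrite odd_double.
exists [set w | (T w < +oo)%E]; split => //.
  have PT0 : 0 <= fine (Pm [set w | (T w < +oo)%E]) by rewrite fine_ge0.
  have PT : fine (Pm [set w | (T w < +oo)%E]) = 0 by nra.
  by rewrite -[LHS]fineK ?fin_num_measure// PT.
by move=> w Cw; apply/(sup_time_lty SN).
Qed.

End announced_times.

(** * Regularity of the optional projection of a shift-continuous functional *)

Lemma dyadic_between (R : realType) (x y : R) : x < y -> 0 < y ->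
  exists m k, x < dyadic R m k /\ dyadic R m k < y.
Proof.
move=> xy y0; pose x' := Num.max x 0.
have x'0 : 0 <= x' by rewrite le_max lexx orbT.
have x'y : x' < y by rewrite gt_max xy.
have [m] : exists m, (2 ^+ m)^-1 < y - x'.
  have [|m /(_ m (leqnn m))] := @invr_expr2_lt R (y - x'); last by exists m.
  by rewrite subr_gt0.
have /andP[] := dyadic_floor m x'0; rewrite dyadicS => le_x lt_x lt_y.
exists m, (Num.truncn (x' * 2 ^+ m)).+1; rewrite dyadicS; split; last lra.
by apply: le_lt_trans lt_x; rewrite /x' le_max lexx.
Qed.

Section jumps_at_debuts.
Context (R : realType) (E : pmetricType R).
Hypotheses (E_lc : locally_compact [set: E]) (E_sep : separable E).
Context (d : measure_display) (Omega : measurableType d).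
Variables (X : R -> Omega -> opc E) (theta : R -> Omega -> Omega).
Variable P : R.-pker borel (opc E) ~> Omega.
Hypothesis X_hunt : continuous_hunt_process X theta P.
Variable mu : probability (borel E) R.
Local Notation F := (natural_filtration X).
Local Notation Pm := (prob_from P mu).

(** U is the union over n of the closed sets on which every [psi i] with i >= n vanishes. *)
Lemma opc_open_Fsigma (U : set (opc E)) : open U ->
  exists2 F : nat -> set (opc E), (forall n, closed (F n)) & U = \bigcup_n F n.
Proof.
move=> oU; have [psi [cpsi _ psiK psiNK]] :=
  closed_separating_functions E_lc E_sep (open_closedC oU).
exists (fun n => \bigcap_(i in [set i | (n <= i)%N]) (psi i @^-1` [set 0])).
  move=> n; apply: closed_bigI => i _; apply: closed_comp => [x _|].
    exact: cpsi.
  exact: closed_eq.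
apply/seteqP; split => [x Ux|x [n _ psi0]].
  by have [n _ psi0] := psiNK x (fun Cx => Cx Ux); exists n => // i;
    exact: psi0.
apply: contrapT => Ux; have /eqP := psi0 n (leqnn n).
by rewrite psiK// oner_eq0.
Qed.

(** Inner regularity is applied to the law of X_tau on D: a level set of h is only Borel, while
    announcing requires a closed K. *)
Lemma negligible_law (tau : Omega ->
  \bar R) (D : set Omega) (B : set (borel (opc E))) :
  optional_time F tau -> measurable D -> measurable B ->
  (forall K : set (opc E), closed K -> K `<=` B ->
    Pm.-negligible (D `&` (fun w => X (fine (tau w)) w) @^-1` K)) ->
  Pm.-negligible (D `&` (fun w => X (fine (tau w)) w) @^-1` B).
Proof.
move=> otau mD mB negK.
have mr : measurable_fun setT (fine \o tau).
  apply: measurableT_comp => //; exact: (optional_time_measurable X_hunt otau).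
have mX : measurable_fun setT (fun w => X (fine (tau w)) w : borel (opc E)).
  apply: (measurable_X_time E_lc E_sep X_hunt mr) => w.
  by rewrite fine_ge0//; apply otau.1.
have mXB (A : set (borel (opc E))) : measurable A -> measurable ((fun w =>
  X (fine (tau w)) w) @^-1` A).
  by move=> mA; rewrite -[X in measurable X]setTI; exact: mX.
pose m := pushforward (mrestr Pm mD)
  (fun w => X (fine (tau w)) w : borel (opc E)).
have mE A : m A = Pm (D `&` (fun w => X (fine (tau w)) w) @^-1` A).
  by rewrite /m/= /pushforward /mrestr setIC.
have : m B = 0%E.
  apply: (measure0_closed_inner opc_open_Fsigma) => //.
    rewrite [X in (X < _)%E]mE preimage_setT setIT.
    by rewrite (le_lt_trans (probability_le1 _ mD))// ltry.
  move=> K clK KB; rewrite [LHS]mE; apply/negligibleP.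
    by apply: measurableI => //; apply: mXB; exact: closed_borel.
  exact: negK.
rewrite [X in X = _]mE => /negligibleP; apply; apply: measurableI => //;
  exact: mXB.
Qed.

Lemma near_psi (psi : nat -> opc E -> R) n w t : 0 <= t ->
  (forall i, continuous (psi i)) -> (forall i, psi i (X t w) = 1) ->
  exists2 del : R, 0 < del & forall s i,
    0 <= s -> `|s - t| < del -> (i <= n)%N ->
    2^-1 <= psi i (X s w).
Proof.
move=> t0 cpsi psi1; elim: n => [|n [del del0 IH]].
  have [|del del0 dP] := X_near X_hunt w (cpsi 0%N) t0 (e := 2^-1).
    by rewrite invr_gt0.
  exists del => // s i s0 st; rewrite leqn0 => /eqP ->.
  by have := dP s s0 st; rewrite psi1 distrC => /ltr_normlW; lra.
have [|del' del'0 dP] := X_near X_hunt w (cpsi n.+1) t0 (e := 2^-1).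
  by rewrite invr_gt0.
exists (Num.min del del'); first by rewrite lt_min del0.
move=> s i s0; rewrite lt_min => /andP[st st'];
  rewrite leq_eqVlt => /orP[/eqP ->|].
  by have := dP s s0 st'; rewrite psi1 distrC => /ltr_normlW; lra.
by rewrite ltnS; exact: IH.
Qed.

Lemma filtration_psi (psi : nat -> opc E -> R) n q : 0 <= q ->
  (forall i, continuous (psi i)) ->
  F q [set w | forall i, (i <= n)%N -> 2^-1 <= psi i (X q w)].
Proof.
move=> q0 cpsi.
rewrite (_ : [set _ | _] = \bigcap_i ([set w | (i <= n)%N ->
  2^-1 <= psi i (X q w)])); last first.
  apply/seteqP; split => w /= wP i; first by move=> _ /=; exact: wP.
  exact: wP i I.
apply: filtration_bigcap => i; have [le_in|le_in] := leqP i n; last first.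
  rewrite (_ : [set _ | _] = setT); first exact: filtrationT.
  by apply/seteqP; split.
rewrite (_ : [set _ | _] = X q @^-1` (psi i @^-1` `[2^-1, +oo[)); last first.
  by apply/seteqP; split => w /=; rewrite in_itv/= andbT => // /(_ isT).
apply: filtration_X; first by rewrite q0 lexx.
by rewrite -[X in measurable X]setTI; exact: measurable_continuous.
Qed.

Section debut_above.
Variable eta : Omega -> R.
Hypothesis eta_sc : shift_continuous theta eta.
Local Notation h := (mean P eta).

Lemma filtration_mean_gt q b : 0 <= q -> F q [set w | b < h (X q w)].
Proof.
move=> q0; rewrite (_ : [set _ | _] = ~` [set w | h (X q w) <= b]).
  by apply: filtrationC; exact: (filtration_mean_le P eta_sc b q0).
by apply/seteqP; split => w /=; rewrite ltNge => /negP.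
Qed.

Variables (N r c : R).

Definition above q := [set w : Omega | r < q /\ c < h (X q w)].
Local Notation tau := (debut (dyadics N) above).

Lemma above_optional : optional_time F tau.
Proof.
apply: (debut_optional (N := N)) => // q Nq; apply: filtrationI.
  exact: filtration_cst.
exact: filtration_mean_gt (dyadics_ge0 Nq).
Qed.

Let tau0 w : 0 <= fine (tau w).
Proof. by rewrite fine_ge0//; apply above_optional.1. Qed.

Let tau_fin w : (tau w < +oo)%E -> tau w \is a fin_num.
Proof. by move=> tw; rewrite ge0_fin_numE//; apply above_optional.1. Qed.

(** Arbitrarily close to tau, and not before it, there are dyadic times with h(X) > c, while h <= c
    - 1/(j+1) on a closed K containing X_tau. The announcing lemma is applied to 1 - eta, which
    exchanges upper and lower bounds of h. *)
Lemma negligible_above_lt :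
  Pm.-negligible [set w | (tau w < +oo)%E /\ h (X (fine (tau w)) w) < c].
Proof.
pose B j := [set x | h x <= c - j.+1%:R^-1] : set (borel (opc E)).
have mB j : measurable (B j).
  rewrite (_ : B j = h @^-1` `]-oo, c - j.+1%:R^-1]).
    rewrite -[X in measurable X]setTI; apply: measurable_mean => //.
    exact: eta_sc.
  by apply/seteqP; split => x /=; rewrite in_itv.
apply: (negligibleS (A := (\bigcup_j ([set w | (tau w < +oo)%E] `&`
    (fun w => X (fine (tau w)) w) @^-1` B j)))).
  move=> w /= [tauw /ltr_add_invr[j hj]]; exists j => //; split => //=.
  by rewrite /B/= lerBrDr ltW.
apply: negligible_bigcup => j; apply: negligible_law => //.
- exact: above_optional.
- exact: (optional_time_lty X_hunt above_optional).
move=> K clK KB.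
have [psi [cpsi _ psiK psiNK]] := closed_separating_functions E_lc E_sep clK.
pose C n q := above q `&` [set w | forall i,
  (i <= n)%N -> 2^-1 <= psi i (X q w)].
apply: (negligibleS (A := [set w | forall n, exists q,
  dyadics N q /\ C n q w])).
  move=> w [/= tauw KX] n.
  have [del del0 near_w] := near_psi n (tau0 w) cpsi (fun i => psiK i _ KX).
  have : (tau w < (fine (tau w) + del)%:E)%E.
    by rewrite EFinD fineK ?tau_fin// lteDl ?tau_fin// lte_fin.
  move=> /debut_ltP[q [Nq Aq]]; rewrite lte_fin => q_lt.
  exists q; split => //; split => // i le_in; apply: near_w => //.
    exact: dyadics_ge0 Nq.
  have tq : fine (tau w) <= q by rewrite -lee_fin fineK ?tau_fin//;
    exact: debut_le.
  by rewrite ger0_norm ?subr_ge0// ltrBlDl.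
apply: (negligible_announced E_lc E_sep X_hunt mu (shift_continuous_compl
  eta_sc)
  (a := 1 - c) (b := 1 - c + j.+1%:R^-1) (K := K) (psi := psi)) => //.
- by rewrite ltrDl invr_gt0.
- move=> n q Nq; have q0 := dyadics_ge0 Nq; apply: filtrationI.
    apply: filtrationI; first exact: filtration_cst.
    exact: filtration_mean_gt.
  exact: filtration_psi.
- by move=> n q w [Aq psiq]; split => // i le_in; apply: psiq; exact: leqW.
- by move=> n q w Nq [[_ cq] _]; rewrite (mean_compl P eta_sc); lra.
- by move=> n i q w Nq le_in [_]; exact.
- move=> x /KB; rewrite /B/= (mean_compl P eta_sc).
  by set e := _^-1; lra.
Qed.

(* Where h(X_tau) > c, tau is announced: before tau one has h(X) <= c,
  and tau is
   the first time after r at which X reaches some closed subset of {h > c}. *)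
Lemma negligible_above_gt : 0 <= r ->
  Pm.-negligible [set w | [/\ (r%:E < tau w)%E, (tau w < +oo)%E &
    c < h (X (fine (tau w)) w)]].
Proof.
move=> r0; pose B j := [set x | c + j.+1%:R^-1 <= h x] : set (borel (opc E)).
have mB j : measurable (B j).
  rewrite (_ : B j = h @^-1` `[c + j.+1%:R^-1, +oo[).
    rewrite -[X in measurable X]setTI; apply: measurable_mean => //.
    exact: eta_sc.
  by apply/seteqP; split => x /=; rewrite in_itv/= andbT.
pose D := [set w | (r%:E < tau w)%E] `&` [set w | (tau w < +oo)%E].
have mD : measurable D.
  apply: measurableI; last exact: (optional_time_lty X_hunt above_optional).
  rewrite -[X in measurable X]setTI; apply: emeasurable_fun_o_infty => //.
  exact: (optional_time_measurable X_hunt above_optional).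
apply: (negligibleS (A := (\bigcup_j (D `&`
    (fun w => X (fine (tau w)) w) @^-1` B j)))).
  by move=> w /= [rw tauw /ltr_add_invr[j /ltW hj]]; exists j.
apply: negligible_bigcup => j; apply: negligible_law => //.
  exact: above_optional.
move=> K clK KB.
have [psi [cpsi _ psiK psiNK]] := closed_separating_functions E_lc E_sep clK.
(* Taking p = q in the first condition gives h(X_q) <= c, the upper bound required of announcing
   events. *)
pose C n q := [set w | r < q /\ forall p, dyadics N p -> r < p -> p <= q ->
    h (X p w) <= c] `&`
  [set w | forall i, (i <= n)%N -> 2^-1 <= psi i (X q w)].
apply: (negligibleS (A := [set w | forall n, exists q,
  dyadics N q /\ C n q w])).
  move=> w [[/= rtau tauw] KX] n.
  have [del del0 near_w] := near_psi n (tau0 w) cpsi (fun i => psiK i _ KX).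
  have tfin := tau_fin tauw.
  have tN : fine (tau w) <= N by rewrite -lee_fin fineK//; exact: debut_leN.
  have rt : r < fine (tau w) by rewrite -lte_fin fineK.
  (* The strict inequality r < tau leaves room for a dyadic time between r and tau, within [del] of
     tau. *)
  have [||m [k []]] := @dyadic_between R (Num.max r (fine (tau w) - del)) (fine
    (tau w)).
  - by rewrite gt_max rt ltrBlDr ltrDl.
  - exact: le_lt_trans rt.
  rewrite gt_max => /andP[rk tk] kt; exists (dyadic R m k).
  have kN : dyadic R m k <= N by lra.
  split; first by exists m, k.
  split=> [|i le_in]; last first.
    apply: near_w => //; first exact: dyadic_ge0.
    by rewrite ler0_norm ?subr_le0 1?ltW//; lra.
  split=> // p Np rp pk; rewrite leNgt; apply/negP => cp.
  have : (tau w <= p%:E)%E by exact: debut_le.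
  by rewrite -(fineK tfin) lee_fin; lra.
apply: (negligible_announced E_lc E_sep X_hunt mu eta_sc
  (a := c) (b := c + j.+1%:R^-1) (K := K) (psi := psi)) => //.
- by rewrite ltrDl invr_gt0.
- move=> n q Nq; have q0 := dyadics_ge0 Nq; apply: filtrationI.
    apply: filtrationI; first exact: filtration_cst.
    rewrite (_ : (fun _ => _) = \bigcap_m \bigcap_k [set w |
      dyadics N (dyadic R m k) -> r < dyadic R m k -> dyadic R m k <= q ->
      h (X (dyadic R m k) w) <= c]); last first.
      apply/seteqP; split => w /= wP; first by move=> m _ k _ /=; exact: wP.
      by move=> p [m [k [-> kN]]]; apply: (wP m I k I); exists m, k.
    apply: filtration_bigcap => m; apply: filtration_bigcap => k.
    have [[Nk rk kq]|nk] := pselect [/\ dyadics N (dyadic R m k),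
        r < dyadic R m k & dyadic R m k <= q]; last first.
      rewrite (_ : [set _ | _] = setT); first exact: filtrationT.
      by apply/seteqP; split => // w _ /= *; case: nk.
    rewrite (_ : [set _ | _] = [set w | h (X (dyadic R m k) w) <= c]).
      apply: (filtration_le kq); exact: (filtration_mean_le P eta_sc c
        (dyadic_ge0 _ _ _)).
    by apply/seteqP; split => w /= wP; [exact: wP|].
  exact: filtration_psi.
- move=> n q w [[rq hp] psiq]; split => // i le_in; apply: psiq; exact: leqW.
- by move=> n q w Nq [[rq hp] _]; exact: hp.
- by move=> n i q w Nq le_in [_]; exact.
Qed.

End debut_above.
End jumps_at_debuts.

(** * Oscillation of a real function along dyadic times *)

Section regular_paths.
Context (R : realType).
Implicit Types (y : R -> R) (t e : R).

Definition dyadic_num (p : R) := exists m k, p = dyadic R m k.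

(** p and q range over both sides of t and may equal t when it is dyadic, so that for small e the
    one-sided limits and a dyadic value at t are compared at once. *)
Definition small_oscillation y t e := exists2 del : R, 0 < del &
  forall p q, dyadic_num p -> dyadic_num q -> `|p - t| < del ->
    `|q - t| < del ->
    `|y p - y q| <= e.

Definition regular y := forall t e, 0 < t -> 0 < e -> small_oscillation y t e.

(** Events over [unit], so that [debut] applies to a single path. *)
Definition path_above y (r c : R) (q : R) : set unit :=
  [set _ | r < q /\ c < y q].

(** The parameters are countably many, so it holds almost surely as soon as each instance does. *)
Definition no_jump_at_debuts y := forall (N m k : nat) (c : rat),
  let r := dyadic R m k in
  let tau := debut (dyadics N%:R) (path_above y r (ratr c)) tt in
  ((tau < +oo)%E -> ratr c <= y (fine tau)) /\
  ((r%:E < tau)%E -> (tau < +oo)%E -> y (fine tau) <= ratr c).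

(** After a dyadic r < t close to t, the debuts above b2 and above b3 both equal t; the first gives
    y t <= b2, the second y t >= b3. *)
Lemma no_upward_jump y t (b2 b3 : rat) : no_jump_at_debuts y -> 0 < t ->
  b2 < b3 ->
  (exists2 del, 0 < del & forall p, dyadic_num p -> t - del < p -> p < t ->
    y p <= ratr b2) ->
  ~ (forall del, 0 < del -> exists p, [/\ dyadic_num p, `|p - t| < del &
    ratr b3 < y p]).
Proof.
move=> Jy t0 b23 [del del0 ley] gty.
have [|//|m [k [+ kt]]] := @dyadic_between R (Num.max 0 (t - del)) t.
  by rewrite gt_max t0/= ltrBlDr ltrDl.
rewrite gt_max => /andP[r0 rdel]; set r := dyadic R m k in kt r0 rdel.
(* The horizon exceeds t + 1, so that dyadic times slightly to the right of t are admissible. *)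
pose N := (Num.truncn (t + 1)).+1.
have tN : t + 1 < N%:R.
  have t10 : 0 <= t + 1 by lra.
  by have /andP[] := truncn_itv t10.
have b23R : ratr b2 < ratr b3 :> R by rewrite ltr_rat.
have tauE (c : rat) : ratr b2 <= ratr c :> R -> ratr c <= ratr b3 :> R ->
    debut (dyadics N%:R) (path_above y r (ratr c)) tt = t%:E.
  move=> b2c cb3; apply/eqP; rewrite eq_le; apply/andP; split; last first.
    apply: debut_ge => q [m' [k' [-> _]]] [rq cq]; rewrite lee_fin leNgt.
    apply/negP => qt; have : y (dyadic R m' k') <= ratr b2.
      by apply: ley => //; [exists m', k'|lra].
    lra.
  apply/lee_addgt0Pr => e e0; rewrite -EFinD.
  have [|p [[m' [k' ->]] pt yp]] := gty (Num.min (Num.min e 1) (t - r)).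
    by rewrite !lt_min e0 ltr01 subr_gt0.
  move: pt; rewrite !lt_min => /andP[/andP[/ltr_normlW pe /ltr_normlW p1] pr].
  have {}pr : r < dyadic R m' k' by have := ler_norm (t - dyadic R m' k');
    rewrite distrC; lra.
  apply: (@le_trans _ _ (dyadic R m' k')%:E); last by rewrite lee_fin; lra.
  apply: debut_le; first by exists m', k'; split => //; lra.
  by split => //; lra.
have [] := Jy N m k b3; rewrite -/r tauE ?ltry//=; last exact: ltW.
move=> /(_ isT) b3y _; have [_] := Jy N m k b2; rewrite -/r tauE ?ltry//=;
  last exact: ltW.
by rewrite lte_fin => /(_ kt isT); lra.
Qed.

Fixpoint path_crossing y (N a b : R) (n : nat) : \bar R :=
  if n is n'.+1 then
    debut (dyadics N) (fun q => [set _ : unit |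
      (path_crossing y N a b n' < q%:E)%E /\
      if odd n' then y q <= a else b <= y q]) tt
  else 0%E.

Definition finitely_many_crossings y := forall (N : nat) (a b : rat), a < b ->
  ~ forall n, (path_crossing y N%:R (ratr a) (ratr b) n < +oo)%E.

(** Oscillation on the left of t keeps every crossing time strictly below t, by induction, hence all
    of them finite. *)
Lemma no_left_oscillation y t (a b : rat) : finitely_many_crossings y ->
  0 < t ->
  a < b ->
  (forall del, 0 < del -> exists p, [/\ dyadic_num p, t - del < p, p < t &
    ratr b < y p]) ->
  ~ (forall del, 0 < del -> exists p, [/\ dyadic_num p, t - del < p, p < t &
    y p < ratr a]).
Proof.
move=> Cy t0 ab hi lo; pose N := (Num.truncn t).+1.
have tN : t < N%:R by have /andP[] := truncn_itv (ltW t0).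
apply: (Cy N a b ab) => n.
suff [S0 St] : (0 <= path_crossing y N%:R (ratr a) (ratr b) n)%E /\
    (path_crossing y N%:R (ratr a) (ratr b) n < t%:E)%E.
  by rewrite (lt_trans St)// ltry.
elim: n => [|n [S0 St]]; first by rewrite /= lte_fin.
split; first exact: debut_ge0 (@subset_refl _ _).
have Sfin : path_crossing y N%:R (ratr a) (ratr b) n \is a fin_num.
  by rewrite ge0_fin_numE// (lt_trans St)// ltry.
have Sdel : 0 < t - fine (path_crossing y N%:R (ratr a) (ratr b) n).
  by rewrite subr_gt0 -lte_fin fineK.
suff [p [[m [k pE]] tp pt yp]] : exists p, [/\ dyadic_num p,
    t - (t - fine (path_crossing y N%:R (ratr a) (ratr b) n)) < p, p < t &
    if odd n then y p <= ratr a else ratr b <= y p].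
  apply/debut_ltP; exists p; split => //.
    by exists m, k; split => //; lra.
  split => //; change (path_crossing y N%:R (ratr a) (ratr b) n < p%:E)%E.
  by rewrite -(fineK Sfin) lte_fin; lra.
by case: (odd n); [have [p [? ? ? /ltW]] := lo _ Sdel|
  have [p [? ? ? /ltW]] := hi _ Sdel]; exists p.
Qed.

Lemma rat_between (x z : R) : x < z -> exists c : rat, x < ratr c < z.
Proof. by move=> /rat_in_itvoo[c]; rewrite in_itv/=; exists c. Qed.

(** sup A and inf B are the upper and lower dyadic limits at t, from both sides. If they are at
    least e apart, four rationals fit between them. Either y stays below b2 on the left of t, and
    there is an upward jump above b3; or, as y does not oscillate there, it stays above b1, and
    there is a downward jump below b0, that is, an upward jump of 1 - y. *)
Lemma regular_of_crossings y : (forall q, 0 <= y q <= 1) ->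
  no_jump_at_debuts y -> no_jump_at_debuts (fun q => 1 - y q) ->
  finitely_many_crossings y -> regular y.
Proof.
move=> y01 Jy Jy' Cy t e t0 e0; apply: contrapT => nreg.
have osc del : 0 < del -> exists p q, [/\ dyadic_num p, dyadic_num q,
    `|p - t| < del, `|q - t| < del & y p + e < y q].
  move=> del0; apply: contrapT => npq; apply: nreg;
    exists del => // p q dp dq pt qt.
  rewrite leNgt; apply/negP; have [pq|pq] := lerP (y p) (y q).
    by move=> le; apply: npq; exists p, q; split => //; lra.
  by move=> le; apply: npq; exists q, p; split => //; lra.
pose A := [set c : R | forall del, 0 < del -> exists p,
  [/\ dyadic_num p, `|p - t| < del & c < y p]].
pose B := [set c : R | forall del, 0 < del -> exists p,
  [/\ dyadic_num p, `|p - t| < del & y p < c]].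
have supA : has_sup A.
  split.
    exists (-1) => del /osc[p [q [dp dq pt qt _]]]; exists p; split => //.
    by have /andP[] := y01 p; lra.
  exists 1 => c /(_ 1 ltr01)[p [_ _]]; have /andP[] := y01 p; lra.
have infB : has_inf B.
  split.
    exists 2 => del /osc[p [q [dp dq pt qt _]]]; exists p; split => //.
    by have /andP[] := y01 p; lra.
  exists 0 => c /(_ 1 ltr01)[p [_ _]]; have /andP[] := y01 p; lra.
have Adown c : c < sup A -> A c.
  move=> /(sup_gt supA.1)[c' Ac' cc'] del /Ac'[p [dp pt c'p]].
  by exists p; split => //; lra.
have Bup c : inf B < c -> B c.
  move=> /(inf_lt infB.1)[c' Bc' cc'] del /Bc'[p [dp pt c'p]].
  by exists p; split => //; lra.
have gap : inf B + e <= sup A.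
  rewrite leNgt; apply/negP => ABlt.
  pose x := (inf B + e - sup A) / 3; have x0 : 0 < x by rewrite /x; lra.
  have nA : ~ A (sup A + x).
    by move=> /(ub_le_sup supA.2); lra.
  have nB : ~ B (inf B - x).
    by move=> /(ge_inf infB.2); lra.
  move: nA nB => /existsNP[d1 /not_implyP[d10 nA]] /existsNP[d2 /not_implyP[d20
    nB]].
  have [|p [q [dp dq]]] := osc (Num.min d1 d2); first by rewrite lt_min d10.
  rewrite !lt_min => /andP[p1 p2] /andP[q1 q2] pq.
  have : y q <= sup A + x.
    by rewrite leNgt; apply/negP => ?; apply: nA; exists q.
  have : inf B - x <= y p.
    by rewrite leNgt; apply/negP => ?; apply: nB; exists p.
  rewrite /x in nA nB *; lra.
have [b0 /andP[b00 b01]] : exists c : rat, inf B < ratr c < inf B + e / 4.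
  by apply: rat_between; lra.
have [b1 /andP[b10 b11]] : exists c : rat,
  inf B + e / 4 < ratr c < inf B + e / 3.
  by apply: rat_between; lra.
have [b2 /andP[b20 b21]] : exists c : rat,
  inf B + e / 3 < ratr c < inf B + e / 2.
  by apply: rat_between; lra.
have [b3 /andP[b30 b31]] : exists c : rat, inf B + e / 2 < ratr c < inf B + e.
  by apply: rat_between; lra.
have b12 : b1 < b2 by rewrite -(ltr_rat R); lra.
have b23 : b2 < b3 by rewrite -(ltr_rat R); lra.
have b01' : 1 - b1 < 1 - b0.
  by rewrite ltrD2l ltrN2 -(ltr_rat R); lra.
have ratrB (c : rat) : ratr (1 - c) = 1 - ratr c :> R by rewrite rmorphB
  rmorph1.
have [hi|/existsNP[del /not_implyP[del0 nhi]]] := pselect (forall del,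
  0 < del ->
    exists p, [/\ dyadic_num p, t - del < p, p < t & ratr b2 < y p]);
      last first.
  apply: (no_upward_jump Jy t0 b23); last by apply: Adown; lra.
  exists del => // p dp tp pt; rewrite leNgt; apply/negP => ?; apply: nhi.
  by exists p.
have /existsNP[del /not_implyP[del0 nlo]] := no_left_oscillation Cy t0 b12 hi.
apply: (no_upward_jump Jy' t0 b01').
  exists del => // p dp tp pt; rewrite ratrB lerD2l lerN2 leNgt.
  by apply/negP => ?; apply: nlo; exists p.
move=> del' /(Bup _ b00)[p [dp pt yp]]; exists p; split => //.
by rewrite ratrB ltrD2l ltrN2.
Qed.

End regular_paths.

Section regular_mean.
Context (R : realType) (E : pmetricType R).
Hypotheses (E_lc : locally_compact [set: E]) (E_sep : separable E).
Context (d : measure_display) (Omega : measurableType d).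
Variables (X : R -> Omega -> opc E) (theta : R -> Omega -> Omega).
Variable P : R.-pker borel (opc E) ~> Omega.
Hypothesis X_hunt : continuous_hunt_process X theta P.
Variable mu : probability (borel E) R.
Local Notation Pm := (prob_from P mu).

Lemma crossing_path eta N a b n w :
  crossing X P eta N a b n w = path_crossing (fun q =>
    mean P eta (X q w)) N a b n.
Proof. by elim: n => //= n IH; rewrite /debut/= IH. Qed.

(** An enumeration of the rationals, since almost sure statements are combined over [nat]. *)
Let rat_of_nat (n : nat) : rat := odflt 0 (unpickle n).

Let rat_of_natK (c : rat) : exists n, rat_of_nat n = c.
Proof. by exists (pickle c); rewrite /rat_of_nat pickleK. Qed.

Lemma ae_no_jump_at_debuts eta : shift_continuous theta eta ->
  \forall w \ae Pm, no_jump_at_debuts (fun q => mean P eta (X q w)).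
Proof.
move=> eta_sc.
have : \forall w \ae Pm, forall N m k c : nat,
    let r := dyadic R m k in
    let tau := debut (dyadics N%:R)
      (path_above (fun q => mean P eta (X q w)) r (ratr (rat_of_nat c))) tt in
  ((tau < +oo)%E -> ratr (rat_of_nat c) <= mean P eta (X (fine tau) w)) /\
  ((r%:E < tau)%E -> (tau < +oo)%E ->
    mean P eta (X (fine tau) w) <= ratr (rat_of_nat c)).
  apply: ae_foralln => N; apply: ae_foralln => m; apply: ae_foralln => k.
  apply: ae_foralln => c; apply: filterI.
    apply: negligibleS (negligible_above_lt E_lc E_sep X_hunt mu eta_sc N%:R
      (dyadic R m k) (ratr (rat_of_nat c))).
    by move=> w /= /not_implyP[tauw /negP]; rewrite -ltNge.
  apply: negligibleS (negligible_above_gt E_lc E_sep X_hunt mu eta_sc N%:R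
    (ratr (rat_of_nat c)) (dyadic_ge0 R m k)).
  by move=> w /= /not_implyP[tr /not_implyP[tauw /negP]]; rewrite -ltNge.
apply: filterS => w Jw N m k c; have [n <-] := rat_of_natK c.
exact: Jw.
Qed.

Lemma ae_finitely_many_crossings eta : shift_continuous theta eta ->
  \forall w \ae Pm, finitely_many_crossings (fun q => mean P eta (X q w)).
Proof.
move=> eta_sc.
have : \forall w \ae Pm, forall N a b : nat, rat_of_nat a < rat_of_nat b ->
    ~ forall n, (path_crossing (fun q => mean P eta (X q w)) N%:R
      (ratr (rat_of_nat a)) (ratr (rat_of_nat b)) n < +oo)%E.
  apply: ae_foralln => N; apply: ae_foralln => a; apply: ae_foralln => b.
  have [ab|ab] := ltP (rat_of_nat a) (rat_of_nat b); last exact: aeW.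
  apply: negligibleS (@negligible_crossing _ _ E_lc E_sep _ _ _ _ _ X_hunt mu _
    eta_sc N%:R (ratr (rat_of_nat a)) (ratr (rat_of_nat b)) _ _) => //.
    move=> w /= /not_implyP[_ /contrapT Cw] n.
    by rewrite crossing_path.
  by rewrite ltr_rat.
apply: filterS => w Cw N a b; have [n <-] := rat_of_natK a.
by have [k <-] := rat_of_natK b; exact: Cw.
Qed.

Lemma ae_regular_mean eta : shift_continuous theta eta ->
  \forall w \ae Pm, regular (fun q => mean P eta (X q w)).
Proof.
move=> eta_sc; have eta_sc' := shift_continuous_compl eta_sc.
apply: filterS (filterI (filterI (ae_no_jump_at_debuts eta_sc)
  (ae_no_jump_at_debuts eta_sc')) (ae_finitely_many_crossings eta_sc)).
move=> w [[Jw Jw'] Cw]; apply: regular_of_crossings => //.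
  by move=> q; exact: (mean01 P eta_sc).
rewrite (_ : (fun q => 1 - _) =
  fun q => mean P (fun w => 1 - eta w) (X q w))//.
by apply/funext => q; rewrite (mean_compl P eta_sc).
Qed.

End regular_mean.

(** * Cylinder functionals *)

Section cylinder_functionals.
Context (R : realType) (E : pmetricType R).
Hypotheses (E_lc : locally_compact [set: E]) (E_sep : separable E).
Context (d : measure_display) (Omega : measurableType d).
Variables (X : R -> Omega -> opc E) (theta : R -> Omega -> Omega).
Variable P : R.-pker borel (opc E) ~> Omega.
Hypothesis X_hunt : continuous_hunt_process X theta P.
Variable mu : probability (borel E) R.
Local Notation F := (natural_filtration X).
Local Notation Pm := (prob_from P mu).

Record test := Test {
  test_time : R;
  test_fun : opc E -> R;
  test_time_ge0 : 0 <= test_time;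
  test_continuous : continuous test_fun;
  test_01 : forall x, 0 <= test_fun x <= 1 }.

Implicit Types (l : seq test) (s : R).

Definition ev l w : R := \prod_(p <- l) test_fun p (X (test_time p) w).

(* [ev l] with the times after s0 delayed by s - s0,
  so that it becomes a function
   of the past of s0 and of the future of s. *)
Definition ev_delay l s0 s w : R := \prod_(p <- l) test_fun p
  (X (if test_time p <= s0 then test_time p else test_time p + (s - s0)) w).

Definition past l s w : R :=
  \prod_(p <- l | test_time p <= s) test_fun p (X (test_time p) w).

Definition future l s w : R :=
  \prod_(p <- l | ~~ (test_time p <= s)) test_fun p (X (test_time p - s) w).

Lemma ev_delay_past_future l s0 s w : 0 <= s ->
  ev_delay l s0 s w = past l s0 w * future l s0 (theta s w).
Proof.
move=> s_ge0; rewrite /ev_delay (bigID (fun p => test_time p <= s0))/=.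
congr (_ * _); first by apply: eq_bigr => p ->.
apply: eq_bigr => p /negPf np; rewrite np (hunt_shift X_hunt.1)//.
  by congr (test_fun p (X _ w)); ring.
by rewrite subr_ge0 ltW// ltNge np.
Qed.

Lemma prod_01 l (Q : pred test) (f : test -> R) : (forall p, 0 <= f p <= 1) ->
  0 <= \prod_(p <- l | Q p) f p <= 1.
Proof.
move=> f01; elim/big_ind : _ => [|x y /andP[x0 x1] /andP[y0 y1]|//].
  by rewrite ler01 lexx.
by rewrite mulr_ge0// mulr_ile1.
Qed.

Lemma ev_01 l w : 0 <= ev l w <= 1.
Proof. by apply: prod_01 => p; exact: test_01. Qed.

Lemma ev_delay_01 l s0 s w : 0 <= ev_delay l s0 s w <= 1.
Proof. by apply: prod_01 => p; exact: test_01. Qed.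

Lemma past_01 l s w : 0 <= past l s w <= 1.
Proof. by apply: prod_01 => p; exact: test_01. Qed.

Lemma measurable_prod_test d' (T : measurableType d') l (Q : pred test)
    (f : test -> T -> R) :
  (forall p, Q p -> measurable_fun setT (f p)) ->
  measurable_fun setT (fun w => \prod_(p <- l | Q p) f p w).
Proof.
move=> mf; elim: l => [|p l IH].
  by under eq_fun do rewrite big_nil; exact: measurable_cst.
under eq_fun do rewrite big_cons; case: (boolP (Q p)) => // Qp.
by apply: measurable_funM => //; exact: mf.
Qed.

Lemma measurable_test (p : test) s : 0 <= s ->
  measurable_fun setT (fun w => test_fun p (X s w)).
Proof.
move=> s0; apply: (measurableT_comp (measurable_continuous (@test_continuous
  p))).
exact: (measurable_X X_hunt s0).
Qed.

Lemma measurable_ev l : measurable_fun setT (ev l).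
Proof.
apply: measurable_prod_test => p _; apply: measurable_test.
exact: test_time_ge0.
Qed.

Lemma measurable_ev_delay l s0 s : s0 <= s ->
  measurable_fun setT (ev_delay l s0 s).
Proof.
move=> s0s; apply: measurable_prod_test => p _; apply: measurable_test.
case: ifPn => _; first exact: test_time_ge0.
by rewrite addr_ge0 ?subr_ge0// test_time_ge0.
Qed.

Lemma measurable_wrt_gen (G : set (set Omega)) (f : Omega -> R) :
  measurable_wrt <<s G >> f <->
  measurable_fun setT (f : g_sigma_algebraType G -> R).
Proof.
split=> [mf _ B mB|mf B mB]; first by rewrite setTI; exact: mf.
by have := mf measurableT B mB; rewrite setTI.
Qed.

Lemma measurable_wrt_past l s : measurable_wrt (F s) (past l s).
Proof.
apply/measurable_wrt_gen; apply: measurable_prod_test => p ps.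
apply/measurable_wrt_gen => B mB.
rewrite (_ : _ @^-1` _ = X (test_time p) @^-1` (test_fun p @^-1` B))//.
apply: filtration_X; first by rewrite test_time_ge0.
rewrite -[X in measurable X]setTI.
exact: (measurable_continuous (@test_continuous p)).
Qed.

(** Continuity of the paths enters here: the shifted functional is a product of continuous functions
    of X at times translated by t. *)
Lemma shift_continuous_future l s : shift_continuous theta (future l s).
Proof.
split.
- apply: measurable_prod_test => p ps; apply: measurable_test.
  by rewrite subr_ge0 ltW// ltNge.
- by move=> w; apply: prod_01 => p; exact: test_01.
move=> w t_ t t_0 t0 tt.
rewrite /future; elim: l => [|p l IH].
  by under eq_fun do rewrite big_nil; rewrite big_nil; exact: cvg_cst.
rewrite big_cons; under eq_fun do rewrite big_cons.
case: ifPn => // ps; apply: cvgM => //.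
have ps0 : 0 <= test_time p - s by rewrite subr_ge0 ltW// ltNge.
rewrite (hunt_shift X_hunt.1)//.
under eq_fun do rewrite (hunt_shift X_hunt.1)//.
apply: (@seq_cont_X _ _ _ _ _ _ _ X_hunt _ w (@test_continuous p)
  (fun n => test_time p - s + t_ n)).
- by move=> n; rewrite addr_ge0.
- by rewrite addr_ge0.
- by apply: cvgD => //; exact: cvg_cst.
Qed.

(** For a fixed path, each time moves by less than [del], whatever s0 is; a product of factors in
    [0,1] changes by at most the sum of the changes of its factors. *)
Lemma ev_delay_near l w a : 0 < a -> exists2 del, 0 < del &
  forall s0 s, s0 <= s -> s - s0 < del -> `|ev l w - ev_delay l s0 s w| <= a.
Proof.
rewrite /ev /ev_delay; elim: l a => [|p l IH] a a0.
  by exists 1 => // s0 s _ _; rewrite !big_nil subrr normr0 ltW.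
have a20 : 0 < a / 2 by rewrite divr_gt0.
have [d1 d10 P1] := IH _ a20.
have [d2 d20 P2] := X_near X_hunt w (@test_continuous p) (test_time_ge0 p) a20.
exists (Num.min d1 d2); first by rewrite lt_min d10.
move=> s0 s s0s; rewrite lt_min => /andP[sd1 sd2]; rewrite !big_cons.
set x := test_fun p _; set y := test_fun p _; set u := \prod_(_ <- _) _.
set v := \prod_(_ <- _) _.
have uv : `|u - v| <= a / 2 by exact: P1.
have xy : `|x - y| <= a / 2.
  rewrite /x /y; case: ifPn => _; first by rewrite subrr normr0 ltW.
  rewrite distrC ltW//; apply: P2.
    by rewrite addr_ge0 ?subr_ge0// test_time_ge0.
  by rewrite addrAC subrr add0r ger0_norm ?subr_ge0.
have [u0 u1] : 0 <= u /\ u <= 1 by apply/andP; apply: ev_01.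
have [y0 y1] : 0 <= y /\ y <= 1 by apply/andP; exact: test_01.
rewrite (_ : x * u - y * v = (x - y) * u + y * (u - v)); last by ring.
rewrite (le_trans (ler_normD _ _))// !normrM (ger0_norm u0) (ger0_norm y0).
rewrite [leRHS](splitr a) lerD//.
  by rewrite (le_trans _ xy)// ler_piMr.
by rewrite (le_trans _ uv)// ler_piMl.
Qed.

End cylinder_functionals.

(** * Pulling an adapted factor out of a conditional expectation *)

Section weighted_expectation.
Context d (T : measurableType d) (R : realType) (Q : probability T R).
Variables (G : set (set T)) (f g : T -> R).
Hypotheses (sG : sigma_algebra setT G) (Gm : G `<=` measurable).
Hypotheses (mf : measurable_fun setT f) (mg : measurable_fun setT g).
Hypotheses (f01 : forall w, 0 <= f w <= 1) (g01 : forall w, 0 <= g w <= 1).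
Hypothesis fg : forall A, G A -> \int[Q]_(w in A) f w = \int[Q]_(w in A) g w.

Lemma measurable_wrt_measurable (W : T -> R) : measurable_wrt G W ->
  measurable_fun setT W.
Proof. by move=> GW _ B mB; rewrite setTI; apply: Gm; exact: GW. Qed.

Let sub_setI A B : G A -> G B -> G (A `&` B).
Proof.
move=> GA GB; have -> : A `&` B = ~` (~` A `|` ~` B) by rewrite setCU !setCK.
have GC C : G C -> G (~` C) by rewrite -setTD; apply sG.
apply: (GC); rewrite -bigcup2E; apply sG => -[|[|n]]/=; [exact: GC|exact: GC|].
by apply sG.
Qed.

Let mul_01 (x y : R) : 0 <= x <= 1 -> 0 <= y <= 1 -> 0 <= x * y <= 1.
Proof.
by move=> /andP[x0 x1] /andP[y0 y1]; rewrite mulr_ge0//= mulr_ile1.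
Qed.

Let int01 (k : T -> R) A : measurable A -> measurable_fun setT k ->
  (forall w, 0 <= k w <= 1) -> Q.-integrable A (EFin \o k).
Proof.
move=> mA mk k01; apply: (@bounded_integrable _ _ _ _ 1) => // w.
by have /andP[k0 k1] := k01 w; rewrite ger0_norm.
Qed.

(* W = 1_B/2 + W'/2 for B = {W >= 1/2} and some W' of the same kind, so that the
   error is halved at each step. *)
Let weight_halving n : forall (W : T -> R) A, measurable_wrt G W ->
  (forall w, 0 <= W w <= 1) -> G A ->
  `|\int[Q]_(w in A) (W w * f w) - \int[Q]_(w in A) (W w * g w)| <= 2^-1 ^+ n.
Proof.
elim: n => [|n IH] W A GW W01 GA.
  have mA := Gm GA.
  have bnd (k : T -> R) : measurable_fun setT k -> (forall w, 0 <= k w <= 1) ->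
      0 <= \int[Q]_(w in A) k w <= 1.
    move=> mk k01; apply/andP; split.
      by apply: Rintegral_ge0 => w _; case/andP: (k01 w).
    have := @le_Rintegral_cst _ _ _ Q 1 1 k A mA mk.
    rewrite mul1r => le1; apply: le_trans (le1 _ _) _.
    - by move=> w; have /andP[? ?] := k01 w; rewrite ger0_norm.
    - by move=> w _; case/andP: (k01 w).
    - rewrite -[leRHS]/(fine 1%E) fine_le ?fin_num_measure// ?probability_le1//.
  have mW := measurable_wrt_measurable GW.
  have /andP[? ?] := bnd _ (measurable_funM mW mf) (fun w =>
    mul_01 (W01 w) (f01 w)).
  have /andP[? ?] := bnd _ (measurable_funM mW mg) (fun w =>
    mul_01 (W01 w) (g01 w)).
  by rewrite expr0 ler_norml; apply/andP; split; lra.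
pose B := W @^-1` `[2^-1, +oo[.
have GB : G B by apply: GW.
have mB := Gm GB; have mA := Gm GA.
pose W' w := 2 * W w - \1_B w.
have W'01 w : 0 <= W' w <= 1.
  have /andP[W0 W1] := W01 w.
  rewrite /W' indicE; case: (boolP (w \in B)) => wB.
    move: wB; rewrite inE /B/= in_itv/= andbT => wB.
    by rewrite mulr1n; apply/andP; split; lra.
  have : W w < 2^-1.
    by rewrite ltNge; apply/negP => h; move/negP: wB; apply;
      rewrite inE /B/= in_itv/= andbT.
  by move=> h; rewrite mulr0n; apply/andP; split; lra.
have GW' : measurable_wrt G W'.
  rewrite -(sigma_algebra_id sG); apply/measurable_wrt_gen.
  apply: measurable_funB; last first.
    apply: (@measurable_indic _ (g_sigma_algebraType G) R setT B).
    exact: sub_sigma_algebra.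
  apply: measurable_funM => //; apply/measurable_wrt_gen.
  by rewrite (sigma_algebra_id sG).
have mW' := measurable_wrt_measurable GW'.
have split_int (k : T -> R) : measurable_fun setT k -> (forall w,
  0 <= k w <= 1) ->
    \int[Q]_(w in A) (W w * k w) =
    2^-1 * (\int[Q]_(w in A `&` B) k w + \int[Q]_(w in A) (W' w * k w)).
  move=> mk k01.
  have mBk : measurable_fun setT (fun w => \1_B w * k w).
    by apply: measurable_funM => //; exact: measurable_indic.
  have Bk01 w : 0 <= \1_B w * k w <= 1.
    by apply: mul_01 => //; rewrite indicE; case: (_ \in _);
      rewrite ?lexx ler01.
  have mWk : measurable_fun setT (fun w =>
    W' w * k w) by exact: measurable_funM.
  have Wk01 w : 0 <= W' w * k w <= 1 by exact: mul_01.
  have -> : \int[Q]_(w in A `&` B) k w = \int[Q]_(w in A) (\1_B w * k w).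
    rewrite Rintegral_mkcondr; apply: eq_Rintegral => w _.
    by rewrite /patch indicE; case: (w \in B); rewrite ?mul1r ?mul0r.
  rewrite -RintegralD//; [|exact: int01|exact: int01].
  rewrite -RintegralZl//.
    apply: eq_Rintegral => w _; rewrite /W'; set u := \1_B w.
    by rewrite -mulrDl addrCA subrr addr0 mulrA mulrA mulVf ?mul1r// pnatr_eq0.
  apply: (@bounded_integrable _ _ _ _ 2) => //; first exact: measurable_funD.
  move=> w; have /andP[? ?] := Bk01 w; have /andP[? ?] := Wk01 w.
  by rewrite ger0_norm; lra.
rewrite !split_int// fg; last exact: sub_setI.
rewrite -mulrBr opprD addrACA subrr add0r normrM exprS ger0_norm//.
by rewrite ler_wpM2l// IH.
Qed.

Lemma eq_Rintegral_weight (W : T -> R) A : measurable_wrt G W -> (forall w,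
  0 <= W w <= 1) ->
  G A -> \int[Q]_(w in A) (W w * f w) = \int[Q]_(w in A) (W w * g w).
Proof.
move=> GW W01 GA; apply/eqP; rewrite -subr_eq0 -normr_eq0 eq_le normr_ge0 andbT.
apply/ler_addgt0Pl => e e0; rewrite addr0.
have [n /(_ n (leqnn n)) ne] := invr_expr2_lt e0.
by rewrite (le_trans (weight_halving n GW W01 GA))// exprVn ltW.
Qed.

End weighted_expectation.

(** * The Markov property of cylinder functionals at fixed times *)

Section markov_cylinder.
Context (R : realType) (E : pmetricType R).
Hypotheses (E_lc : locally_compact [set: E]) (E_sep : separable E).
Context (d : measure_display) (Omega : measurableType d).
Variables (X : R -> Omega -> opc E) (theta : R -> Omega -> Omega).
Variable P : R.-pker borel (opc E) ~> Omega.
Hypothesis X_hunt : continuous_hunt_process X theta P.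
Variable mu : probability (borel E) R.
Local Notation F := (natural_filtration X).
Local Notation Pm := (prob_from P mu).

Definition mean_delay (l : seq (test E)) s0 s w :=
  past X l s0 w * mean P (future X l s0) (X s w).

Lemma measurable_wrt_mean_delay l s0 s : 0 <= s0 <= s ->
  measurable_wrt (F s) (mean_delay l s0 s).
Proof.
move=> /andP[s00 s0s]; apply/measurable_wrt_gen; apply: measurable_funM.
  apply/measurable_wrt_gen => B mB; apply: (filtration_le s0s).
  exact: measurable_wrt_past.
apply/measurable_wrt_gen => B mB.
rewrite (_ : _ @^-1` _ = X s @^-1` (mean P (future X l s0) @^-1` B))//.
apply: filtration_X; first by rewrite (le_trans s00 s0s) lexx.
rewrite -[X in measurable X]setTI; apply: measurable_mean => //.
exact: (shift_continuous_future X_hunt l s0).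
Qed.

Lemma mean_delay_01 l s0 s w : 0 <= mean_delay l s0 s w <= 1.
Proof.
have /andP[p0 p1] := past_01 X l s0 w.
have /andP[m0 m1] := mean01 P (shift_continuous_future X_hunt l s0) (X s w).
by rewrite mulr_ge0//= mulr_ile1.
Qed.

(** The past factor is known at s0, hence at s, and is pulled out. The future factor is the shift of
    a fixed functional, to which the strong Markov identity at the constant time s applies. *)
Lemma markov_cylinder l s0 s A : 0 <= s0 <= s -> F s A ->
  \int[Pm]_(w in A) ev_delay X l s0 s w = \int[Pm]_(w in A) mean_delay l s0 s w.
Proof.
move=> /andP[s00 s0s] FA; have s_ge0 := le_trans s00 s0s.
have eta_sc := shift_continuous_future X_hunt l s0.
have otau := optional_time_cst X s_ge0.
under eq_Rintegral do rewrite (ev_delay_past_future X_hunt)//.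
apply: (@eq_Rintegral_weight _ _ _ Pm (F s)) => //.
- exact: filtration_sigma.
- exact: (filtration_measurable X_hunt).
- exact: (measurable_shift E_lc E_sep X_hunt eta_sc otau).
- exact: (measurable_mean_X E_lc E_sep X_hunt eta_sc otau).
- by move=> w; case: eta_sc => _ + _; exact.
- by move=> w; exact: (mean01 P eta_sc).
- move=> B FB.
  have := strong_markov_Rintegral E_lc E_sep X_hunt mu eta_sc otau
    (sigma_after_cst X_hunt s_ge0 FB).
  rewrite (_ : B `&` _ = B)//; apply/seteqP; split => [w []//|w Bw].
  by split => //=; exact: ltry.
- by move=> B mB; apply: (filtration_le s0s); exact: measurable_wrt_past.
- by move=> w; exact: past_01.
Qed.

End markov_cylinder.

(** * Completion and the maximal inequality *)

Section null_modification.
Context d (T : measurableType d) (R : realType) (P : probability T R).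
Local Notation cT := (completion_type P).
Local Notation Pc := (completion P : probability (completion_type P) R).

(** Every set of a completed sigma-algebra gets a representative in H; integrals over sets of the
    augmented filtration are computed on representatives. *)
Definition null_modification (H : set (set T)) : set (set T) :=
  [set A | exists2 B, H B & P.-negligible ((A `\` B) `|` (B `\` A))].

Lemma sigma_algebra_null_modification (H : set (set T)) : sigma_algebra setT H
  ->
  sigma_algebra setT (null_modification H).
Proof.
move=> [H0 HC HU]; split => [|A [B HB negl]|A HA].
- by exists set0 => //; rewrite setD0 setU0; exact: negligible_set0.
- exists (~` B); first by rewrite -setTD; exact: HC.
  apply: negligibleS negl => w [[[_ nAw] /contrapT Bw]|[nBw nnA]].
    by right.
  by left; split => //; apply: contrapT => nAw; apply: nnA; split.
- have /choice[B HB] n : exists B,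
  H B /\ P.-negligible ((A n `\` B) `|` (B `\` A n)).
    by have [B] := HA n; exists B.
  exists (\bigcup_n B n); first by apply: HU => n; case: (HB n).
  apply: negligibleS (negligible_bigcup (fun n => (HB n).2)).
  move=> w [[[n _ Anw] nB]|[[n _ Bnw] nA]]; exists n => //.
    by left; split => // Bnw; apply: nB; exists n.
  by right; split => // Anw; apply: nA; exists n.
Qed.

Lemma sub_null_modification (H : set (set T)) : H `<=` null_modification H.
Proof. by move=> A HA; exists A => //; rewrite !setDv setU0;
  exact: negligible_set0. Qed.

Lemma negligible_null_modification (H : set (set T)) A : H set0 ->
  P.-negligible A -> null_modification H A.
Proof. by move=> H0 negA; exists set0 => //; rewrite setD0 set0D setU0. Qed.

#[global] Instance ae_completion_filter :
  Filter (nbhs (almost_everywhere (completion P))).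
Proof. exact: (ae_filter_ringOfSetsType Pc). Qed.

Lemma completion_measurable (A : set T) : measurable A -> @measurable _ cT A.
Proof. by move=> mA; apply: sub_sigma_algebra; left. Qed.

Lemma completion_negligible A : P.-negligible A -> Pc.-negligible A.
Proof.
move=> [B [mB PB0 AB]]; exists B; split => //;
  first exact: completion_measurable.
by rewrite -[RHS]PB0; exact: completionE.
Qed.

Lemma ae_completion (Q : T -> Prop) :
  (\forall w \ae P, Q w) -> \forall w \ae Pc, Q w.
Proof. exact: completion_negligible. Qed.

Lemma measurable_completion_modification (A : set cT) : measurable A ->
  null_modification measurable A.
Proof.
move: A; apply: smallest_sub.
  apply: sigma_algebra_null_modification.
  split => [//|A mA|A mA]; first by rewrite setTD; exact: measurableC.
  exact: bigcupT_measurable.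
move=> A [mA|negA]; first exact: sub_null_modification.
exact: negligible_null_modification.
Qed.

(** A differs from a measurable B inside a null set C, and B lies in the union of A and C, so B is
    null for P itself. *)
Lemma completion_eq0 (A : set cT) : measurable A -> Pc A = 0%E ->
  P.-negligible A.
Proof.
move=> mA PA0; have [B mB negl] := measurable_completion_modification mA.
have mBc : @measurable _ cT B by exact: completion_measurable.
have PB0 : P B = 0%E.
  have -> : P B = Pc B by rewrite -[LHS]completionE.
  apply/eqP; rewrite eq_le measure_ge0 andbT.
  have [C [mC PC0 ABC]] := completion_negligible negl.
  have PAC : (Pc (A `|` C) <= Pc A + Pc C)%E by exact: measureU2.
  have : (Pc B <= Pc (A `|` C))%E.
    apply: le_measure; rewrite ?inE//; first exact: measurableU.
    move=> w Bw; have [Aw|nAw] := pselect (A w); [by left|right].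
    by apply: ABC; right.
  by move=> /le_trans/(_ PAC); rewrite PA0 PC0 adde0.
apply: (@negligibleS _ _ _ P (B `|` ((A `\` B) `|` (B `\` A)))).
  by move=> w Aw; have [Bw|nBw] := pselect (B w); [left|right; left].
by apply: negligibleU => //; exact/negligibleP.
Qed.

Lemma measurable_fun_completion d' (T' : measurableType d') (f : T -> T') :
  measurable_fun setT f -> measurable_fun setT (f : cT -> T').
Proof.
move=> mf _ B mB; rewrite setTI; apply: completion_measurable.
by rewrite -[X in measurable X]setTI; exact: mf.
Qed.

Lemma Rintegral_completion (A : set T) (f : T -> R) : measurable A ->
  measurable_fun setT f -> (forall w, 0 <= f w) ->
  \int[Pc]_(w in A) f w = \int[P]_(w in A) f w.
Proof.
move=> mA mf f0; congr fine.
have mid : measurable_fun setT (id : cT -> T).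
  by move=> _ B mB; rewrite setTI; exact: completion_measurable.
have := @ge0_integral_pushforward _ _ cT T R id mid Pc A (EFin \o f) mA.
move=> <-.
- apply: eq_measure_integral => B mB _.
  exact: completionE mB.
- by apply/measurable_EFinP; exact: measurable_funTS.
- by move=> w _; rewrite lee_fin.
Qed.

Lemma Rintegral_null_modification (A B : set T) (f : T -> R) :
  @measurable _ cT A -> measurable B ->
  P.-negligible ((A `\` B) `|` (B `\` A)) ->
  measurable_fun setT (f : cT -> R) ->
  \int[Pc]_(w in A) f w = \int[Pc]_(w in B) f w.
Proof.
move=> mA mB negl mf; have mBc := completion_measurable mB.
rewrite [LHS]Rintegral_mkcond [RHS]Rintegral_mkcond; congr fine.
apply: ae_eq_integral => //.
- apply/measurable_EFinP/(measurable_restrictT _ mA); exact: measurable_funTS.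
- apply/measurable_EFinP/(measurable_restrictT _ mBc); exact: measurable_funTS.
apply: negligibleS (completion_negligible negl) => w /= /not_implyP[_ neq].
apply: contrapT => /not_orP[nAB nBA]; apply: neq; congr EFin; rewrite /patch.
have [Aw|nAw] := pselect (A w).
  have Bw : B w by apply: contrapT => ?; exact: nAB.
  by rewrite !mem_set.
have nBw : ~ B w by move=> ?; exact: nBA.
by rewrite !memNset.
Qed.

End null_modification.

Section maximal_inequality.
Context d (T : measurableType d) (R : realType) (Q : probability T R).
Variables (G : R -> set (set T)) (D : R -> T -> R) (W : T -> R) (N c : R).
Hypotheses (sG : forall t, sigma_algebra setT (G t))
  (Gm : forall t, G t `<=` measurable)
  (G_le : forall s t, s <= t -> G s `<=` G t).
Hypotheses (GD : forall q, dyadics N q -> measurable_wrt (G q) (D q))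
  (iD : forall q, dyadics N q -> Q.-integrable setT (EFin \o D q))
  (iW : Q.-integrable setT (EFin \o W)).
Hypothesis DW : forall q A, dyadics N q -> G q A ->
  `|\int[Q]_(w in A) D q w| <= \int[Q]_(w in A) W w.
Hypotheses (W0 : forall w, 0 <= W w) (c0 : 0 < c).

Definition exceed_before m k := [set w | exists j, [/\ (j < k)%N,
  dyadics N (dyadic R m j) & c < `|D (dyadic R m j) w|]].

Let GC t A : G t A -> G t (~` A).
Proof. by rewrite -setTD; case: (sG t) => _ + _; apply. Qed.

Let GU t A B : G t A -> G t B -> G t (A `|` B).
Proof.
move=> GA GB; rewrite -bigcup2E; case: (sG t) => G0 _; apply => -[|[|n]]//=.
Qed.

Let GI t A B : G t A -> G t B -> G t (A `&` B).
Proof.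
move=> GA GB; rewrite -[X in G t X]setCK setCI.
by apply: (GC _); apply: (GU _ _); exact: GC.
Qed.

Let bound_setU A B : measurable A -> measurable B -> A `&` B = set0 ->
  c * fine (Q A) <= \int[Q]_(w in A) W w ->
  c * fine (Q B) <= \int[Q]_(w in B) W w ->
  c * fine (Q (A `|` B)) <= \int[Q]_(w in A `|` B) W w.
Proof.
move=> mA mB AB leA leB; rewrite measureU// fineD ?fin_num_measure// mulrDr.
rewrite Rintegral_setU ?lerD//; last exact/disj_set2P.
by apply: integrableS iW => //; exact: measurableU.
Qed.

Lemma exceed_beforeS m k : dyadics N (dyadic R m k) ->
  exceed_before m k.+1 = exceed_before m k `|`
    (~` exceed_before m k `&` [set w | c < `|D (dyadic R m k) w|]).
Proof.
move=> Nk; apply/seteqP; split => [w [j [jk Nj cD]]|w].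
  have [bw|nbw] := pselect (exceed_before m k w); [by left|right; split => //].
  move: jk; rewrite ltnS leq_eqVlt => /orP[/eqP <-//|jk].
  by exfalso; apply: nbw; exists j.
move=> [[j [jk Nj cD]]|[_ cD]]; last by exists k.
by exists j; split => //; rewrite ltnS ltnW.
Qed.

(** Doob's argument: the induction on k adds the event that the first exceedance occurs at the k-th
    dyadic time, split by the sign of D so that [DW] bounds each half. D need not be a martingale:
    only its integrals at one time, over events known at that time, are used. *)
Lemma exceed_before_le m k : c * fine (Q (exceed_before m k)) <=
    \int[Q]_(w in exceed_before m k) W w /\
  (forall t, dyadic R m k <= t -> G t (exceed_before m k)) /\
  measurable (exceed_before m k).
Proof.
elim: k => [|k [IH [GE mE]]].
  have -> : exceed_before m 0 = set0 by apply/seteqP; split => // w [j []].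
  rewrite measure0 mulr0 Rintegral_set0; split => //; split => // t _.
  by case: (sG t).
have dk : dyadic R m k <= dyadic R m k.+1 by rewrite dyadicS lerDl invr_ge0
  exprn_ge0.
have [Nk|nNk] := pselect (dyadics N (dyadic R m k)); last first.
  have -> : exceed_before m k.+1 = exceed_before m k.
    apply/seteqP; split => w [j [jk Nj cD]]; exists j; split => //.
      move: jk; rewrite ltnS leq_eqVlt => /orP[/eqP jk|//].
      by exfalso; apply: nNk; rewrite -jk.
    by rewrite ltnS ltnW.
  by split => //; split => // t kt; apply: GE; exact: le_trans kt.
pose q := dyadic R m k.
have GEq : G q (exceed_before m k) by exact: GE.
have GDq := GD Nk.
pose Ap := ~` exceed_before m k `&` [set w | c < D q w].
pose An := ~` exceed_before m k `&` [set w | D q w < - c].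
have GAp : G q Ap.
  apply: (GI _ _); first exact: GC.
  rewrite (_ : [set _ | _] = D q @^-1` `]c, +oo[); first exact: GDq.
  by apply/seteqP; split => w /=; rewrite in_itv/= andbT.
have GAn : G q An.
  apply: (GI _ _); first exact: GC.
  rewrite (_ : [set _ | _] = D q @^-1` `]-oo, - c[); first exact: GDq.
  by apply/seteqP; split => w /=; rewrite in_itv.
have mAp := Gm GAp; have mAn := Gm GAn.
have EE : exceed_before m k.+1 = exceed_before m k `|` (Ap `|` An).
  rewrite exceed_beforeS// -setIUr; congr (_ `|` (_ `&` _)).
  apply/seteqP; split => w /=; rewrite ltr_normr -/q.
    by move=> /orP[|]; [left|rewrite ltrNr; right].
  by move=> [->//|]; rewrite ltrNr => ->; rewrite orbT.
have mEA : measurable (Ap `|` An) by exact: measurableU.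
have iD' A : measurable A -> Q.-integrable A (EFin \o D q).
  by move=> mA; apply: integrableS (iD Nk).
rewrite EE; split; last split => [t kt|]; last exact: measurableU.
- apply: bound_setU => //.
    by apply/seteqP; split => // w [Ew [[nE _]|[nE _]]].
  apply: bound_setU => //.
  + apply/seteqP; split => // w [[_ /= Dp] [_ /= Dn]].
    have := lt_trans c0 (lt_trans Dp Dn).
    by rewrite oppr_gt0 => /(lt_trans c0); rewrite ltxx.
  + apply: le_trans (le_trans (ler_norm _) (DW Nk GAp)).
    rewrite -Rintegral_cst//; apply: le_Rintegral => //;
      last by move=> w [_ /ltW].
    * exact: finite_measure_integrable_cst.
    * exact: iD'.
  + apply: le_trans (le_trans _ (DW Nk GAn)); last first.
      by rewrite -normrN; exact: ler_norm.
    rewrite lerNr -mulNr -Rintegral_cst//; apply: le_Rintegral => //.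
    * exact: iD'.
    * exact: finite_measure_integrable_cst.
    * by move=> w [_ /ltW].
- apply: (G_le (le_trans dk kt)); apply: (GU _ _); first exact: GEq.
  exact: (GU _ _).
Qed.

Lemma maximal_inequality :
  let B := [set w | exists q, dyadics N q /\ c < `|D q w|] in
  measurable B /\ c * fine (Q B) <= \int[Q]_w W w.
Proof.
move=> B; pose K m := (Num.truncn (N * 2 ^+ m)).+1.
pose B_ m := exceed_before m (K m).
have ltK m k : dyadic R m k <= N -> (k < K m)%N.
  rewrite /dyadic ler_pdivrMr ?exprn_gt0// => kN.
  by rewrite /K ltnS truncn_ge_nat// (le_trans _ kN).
have mB_ m : measurable (B_ m) by have [_ []] := exceed_before_le m (K m).
have BE : B = \bigcup_m B_ m.
  apply/seteqP; split => [w [q [[m [k [-> kN]]] cD]]|w [m _ [j [jK Nj cD]]]].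
    by exists m => //; exists k; split => //; [exact: ltK|exists m, k].
  by exists (dyadic R m j).
have mB : measurable B by rewrite BE; exact: bigcupT_measurable.
split => //.
have ndB : {homo B_ : n m / (n <= m)%N >-> (n <= m)%O}.
  move=> n m nm; apply/subsetPset => w [j [jK Nj cD]].
  have [k [kE kN]] : grid N m (dyadic R n j).
    by apply: (le_grid nm); exists j; split => //; case: Nj => ? [? []].
  by exists k; rewrite -kE; split => //; apply: ltK; rewrite -kE.
have cvB : fine (Q (B_ m)) @[m --> \oo] --> fine (Q B).
  apply: fine_cvg; rewrite fineK ?fin_num_measure// BE.
  by apply: nondecreasing_cvg_mu => //; rewrite -BE.
apply: (ler_cvg_to (cvgMl_tmp (a := c) cvB) (cvg_cst _)); apply: nearW => m.
have [le_m _] := exceed_before_le m (K m); apply: (le_trans le_m).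
rewrite Rintegral_mkcond; apply: le_Rintegral => //.
  rewrite (_ : EFin \o _ = (EFin \o W) \_ (B_ m)).
    by apply/(integrable_mkcond _ (mB_ m)); apply: integrableS iW.
  by apply/funext => w; rewrite /patch/=; case: ifPn.
by move=> w _; rewrite /patch; case: ifPn.
Qed.

End maximal_inequality.

(** * Density of cylinder functionals *)

Section L1_span.
Context d (T : measurableType d) (R : realType) (Q : probability T R).
Variable V : set (T -> R).
Hypotheses (V_integrable : forall v, V v -> Q.-integrable setT (EFin \o v))
  (VD : forall u v, V u -> V v -> V (fun w => u w + v w))
  (VZ : forall k u, V u -> V (fun w => k * u w)).

Local Notation L1 f := (Q.-integrable setT (EFin \o f)).

Lemma integrableRD (f g : T -> R) : L1 f -> L1 g -> L1 (fun w => f w + g w).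
Proof. by move=> fi gi; have := integrableD measurableT fi gi. Qed.

Lemma integrableRZ (k : R) (f : T -> R) : L1 f -> L1 (fun w => k * f w).
Proof. by move=> fi; have := integrableZl measurableT k fi. Qed.

Lemma integrableRB (f g : T -> R) : L1 f -> L1 g -> L1 (fun w => f w - g w).
Proof. by move=> fi gi; have := integrableB measurableT fi gi. Qed.

Lemma integrableRabs (f : T -> R) : L1 f -> L1 (fun w => `|f w|).
Proof. by move=> fi; have := integrable_abse fi. Qed.

Lemma le_RintegralT (f g : T -> R) : L1 f -> L1 g -> (forall w, f w <= g w) ->
  \int[Q]_w f w <= \int[Q]_w g w.
Proof. by move=> fi gi fg; apply: le_Rintegral => // w _; exact: fg. Qed.

Definition L1_closure : set (T -> R) := [set f : T -> R | L1 f /\ forall e,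
  0 < e ->
  exists2 v, V v & \int[Q]_w `|f w - v w| <= e].

Lemma L1_closure_sub : V `<=` L1_closure.
Proof.
move=> v Vv; split; first exact: V_integrable.
move=> e e0; exists v => //.
by under eq_Rintegral do rewrite subrr normr0;
  rewrite Rintegral_cst// mul0r ltW.
Qed.

Lemma L1_closureD f g : L1_closure f -> L1_closure g ->
  L1_closure (fun w => f w + g w).
Proof.
move=> [fi fP] [gi gP]; split; first exact: integrableRD.
move=> e e0; have e20 : 0 < e / 2 by rewrite divr_gt0.
have [u Vu fu] := fP _ e20; have [v Vv gv] := gP _ e20.
have ui := V_integrable Vu; have vi := V_integrable Vv.
exists (fun w => u w + v w); first exact: VD.
rewrite (le_trans _ (le_trans (lerD fu gv) _))//; last by rewrite -splitr.
rewrite -RintegralD//; [|exact/integrableRabs/integrableRB..].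
apply: le_RintegralT.
- by apply/integrableRabs/integrableRB; exact: integrableRD.
- by apply: integrableRD; apply/integrableRabs/integrableRB.
- by move=> w; rewrite opprD addrACA; exact: ler_normD.
Qed.

Lemma L1_closureZ k f : L1_closure f -> L1_closure (fun w => k * f w).
Proof.
move=> [fi fP]; split; first exact: integrableRZ.
move=> e e0; have k0 : 0 < `|k| + 1 by rewrite ltr_wpDl.
have [u Vu fu] := fP _ (divr_gt0 e0 k0); have ui := V_integrable Vu.
exists (fun w => k * u w); first exact: VZ.
under eq_Rintegral do rewrite -mulrBr normrM.
rewrite RintegralZl//; last exact/integrableRabs/integrableRB.
rewrite (le_trans (ler_wpM2l _ fu))// mulrA ler_pdivrMr// mulrC.
by rewrite ler_pM2l// lerDl.
Qed.

Lemma L1_closure_lim f : L1 f ->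
  (forall e, 0 < e -> exists2 g, L1_closure g & \int[Q]_w `|f w - g w| <= e) ->
  L1_closure f.
Proof.
move=> fi fP; split => // e e0; have e20 : 0 < e / 2 by rewrite divr_gt0.
have [g [gi gP] fg] := fP _ e20; have [u Vu gu] := gP _ e20.
have ui := V_integrable Vu; exists u => //.
rewrite (le_trans _ (le_trans (lerD fg gu) _))//; last by rewrite -splitr.
rewrite -RintegralD//; [|exact/integrableRabs/integrableRB..].
apply: le_RintegralT.
- exact/integrableRabs/integrableRB.
- by apply: integrableRD; apply/integrableRabs/integrableRB.
- by move=> w; rewrite -[f w - u w](subrKA (g w)); exact: ler_normD.
Qed.

Lemma L1_closure_cvg_bounded (c : R) (f_ : nat -> T -> R) (f : T ->
  R) : (forall n, L1_closure (f_ n)) ->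
  (forall n, measurable_fun setT (f_ n)) -> measurable_fun setT f ->
  (forall n w, `|f_ n w| <= c) -> (forall w, `|f w| <= c) ->
  (forall w, f_ n w @[n --> \oo] --> f w) -> L1_closure f.
Proof.
move=> Vf mf_ mf f_c fc cvf; apply: L1_closure_lim.
  exact: (@bounded_integrable _ _ _ _ c).
move=> e e0.
have int0 : \int[Q]_(w in setT) (0 : R) = 0.
  by rewrite Rintegral_cst// mul0r.
have : \int[Q]_w `|f w - f_ n w| @[n --> \oo] --> (0 : R).
  rewrite -int0.
  apply: (@cvg_Rintegral_bounded _ _ _ Q (c + c) (fun n w => `|f w - f_ n w|)
    (fun=> 0) (fun=> setT) setT) => //.
  - by move=> n; apply: measurableT_comp => //; exact: measurable_funB.
  - by move=> n w; rewrite normr_id (le_trans (ler_normB _ _))// lerD.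
  - move=> w _; rewrite -(normr0 R) -(subrr (f w)).
    by apply: cvg_norm; apply: cvgB; [exact: cvg_cst|exact: cvf].
  - by move=> w _; exact: nearW.
  - by move=> w /(_ I).
move=> cv0; have [n /(_ n (leqnn n)) lt_e] := (cvgr_ltP _ _).2 cv0 _ e0.
exists (f_ n) => //; apply: le_trans (ltW lt_e); rewrite subr0.
exact: ler_norm.
Qed.

Lemma L1_closure_ae (f g : T -> R) : L1_closure f -> L1 g ->
  (\forall w \ae Q, f w = g w) -> L1_closure g.
Proof.
move=> [fi fP] gi fg; split => // e e0; have [u Vu fu] := fP _ e0.
exists u => //; apply: le_trans fu; have ui := V_integrable Vu.
rewrite le_eqVlt; apply/orP; left; apply/eqP; congr fine.
apply: ae_eq_integral => //.
- by have /integrableP[] := integrableRabs (integrableRB gi ui).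
- by have /integrableP[] := integrableRabs (integrableRB fi ui).
- by apply: filterS fg => w fgw _ /=; rewrite fgw.
Qed.

(** Dynkin's pi-lambda theorem: the sets with indicator in the closure form a lambda-system,
    disjoint unions being treated by bounded convergence of the partial sums. *)
Lemma L1_closure_indic (G : set (set T)) : <<s G >> `<=` measurable ->
  setI_closed G -> L1_closure (cst 1) ->
  (forall A, G A -> L1_closure \1_A) ->
  forall A, <<s G >> A -> L1_closure \1_A.
Proof.
move=> Gm GI V1 VG.
have m1 (A : set T) : <<s G >> A -> measurable_fun setT (\1_A : T -> R).
  by move=> /Gm mA; exact: measurable_indic.
have normI (A : set T) w : `|\1_A w : R| <= 1.
  by rewrite indicE; case: (_ \in _); rewrite ?normr1 ?normr0.
have sG := @smallest_sigma_algebra _ setT G.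
suff : <<s G >> `<=` [set A | <<s G >> A /\ L1_closure (\1_A : T -> R)].
  by move=> GL A /GL[].
apply: lambda_system_subset => //; last first.
  by move=> A GA; split; [exact: sub_sigma_algebra|exact: VG].
apply/dynkin_lambda_system; split => [|A [sA VA]|F tF FP].
- split; first by case: sG => s0 sC _; have := sC _ s0; rewrite setD0.
  by rewrite indicT.
- split; first by rewrite -setTD; apply sG.
  rewrite (_ : \1_(~` A) = fun w => cst 1 w + (-1) * \1_A w).
    by apply: L1_closureD => //; exact: L1_closureZ.
  apply/funext => w; rewrite !indicE in_setC /cst.
  by case: (w \in A); rewrite /= ?mulr1 ?mulr0 ?subrr ?addr0.
split; first by apply sG => n; case: (FP n).
apply: (@L1_closure_cvg_bounded 1 (fun n => \1_(\big[setU/set0]_(i < n) F i))).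
- elim=> [|n IH].
    rewrite big_ord0 indic0 (_ : cst 0 = fun w => 0 * cst 1 w).
      exact: L1_closureZ.
    by apply/funext => w; rewrite mul0r.
  rewrite big_ord_recr/= (_ : \1_(_ `|` _) = fun w =>
    \1_(\big[setU/set0]_(i < n) F i) w + \1_(F n) w).
    by apply: L1_closureD => //; case: (FP n).
  apply/funext => w; rewrite !indicE in_setU.
  have [wFn|] := boolP (w \in F n); last by rewrite orbF addr0.
  suff /negPf -> : w \notin \big[setU/set0]_(i < n) F i by rewrite add0r.
  apply/negP; rewrite inE -bigcup_mkord => -[i/= lt_in Fiw].
  rewrite inE in wFn; have ni : n = i by apply: tF => //; exists w.
  by move: lt_in; rewrite ni ltnn.
- by move=> n; apply: m1; rewrite -bigcup_mkord bigcup_mkcond;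
    apply sG => i; case: ifP => _; [case: (FP i)|case: sG].
- by apply: m1; apply sG => n; case: (FP n).
- by move=> n w; exact: normI.
- by move=> w; exact: normI.
move=> w; apply: cvg_near_cst; have [Fw|nFw] := pselect ((\bigcup_k F k) w).
  have [k _ Fkw] := Fw; exists k.+1 => // n /= kn; rewrite !indicE !mem_set//.
  by rewrite -bigcup_mkord; exists k.
apply: nearW => n; rewrite !indicE !memNset//.
by rewrite -bigcup_mkord => -[i _ Fiw]; apply: nFw; exists i.
Qed.

Lemma L1_closure_sum (I : Type) (s : seq I) (f : I -> T -> R) :
  L1_closure (cst 0) -> (forall i, L1_closure (f i)) ->
  L1_closure (fun w => \sum_(i <- s) f i w).
Proof.
move=> V0 Vf; elim: s => [|i s IH]; first by under eq_fun do rewrite big_nil.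
by under eq_fun do rewrite big_cons; exact: L1_closureD.
Qed.

Import HBSimple.

Lemma L1_closure_integrable : L1_closure (cst 1) ->
  (forall A, measurable A -> L1_closure \1_A) ->
  forall f, L1 f -> L1_closure f.
Proof.
move=> V1 VA f fi; apply: L1_closure_lim => // e e0.
have [g [gi _ fg]] := approximation_sfun_integrable measurableT fi.
have /fine_cvgP[_] : (fun n => (\int[Q]_w `|(EFin \o f) w - (g n w)%:E|)%E) @
  \oo --> 0%:E.
  exact: fg.
move=> cv0; have [n /(_ n (leqnn n)) lt_e] := (cvgr_ltP _ _).2 cv0 _ e0.
exists (g n); last first.
  by apply: le_trans (ltW lt_e); rewrite subr0; exact: ler_norm.
have V0 : L1_closure (cst 0).
  rewrite (_ : cst 0 = fun w => 0 * cst 1 w); first exact: L1_closureZ.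
  by apply/funext => w; rewrite mul0r.
have -> : (g n : T -> R) = fun w =>
    \sum_(y \in range (g n)) (y * \1_(g n @^-1` [set y]) w).
  by apply/funext => w; rewrite fimfunE.
under eq_fun do rewrite fsbig_finite//=.
apply: L1_closure_sum => // y; apply: L1_closureZ; apply: VA.
by rewrite -[X in measurable X]setTI; exact: measurable_funP.
Qed.

End L1_span.

Section cylinder_density.
Context (R : realType) (E : pmetricType R).
Hypotheses (E_lc : locally_compact [set: E]) (E_sep : separable E).
Context (d : measure_display) (Omega : measurableType d).
Variables (X : R -> Omega -> opc E) (theta : R -> Omega -> Omega).
Variable P : R.-pker borel (opc E) ~> Omega.
Hypothesis X_hunt : continuous_hunt_process X theta P.
Variable mu : probability (borel E) R.
Local Notation Pm := (prob_from P mu).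
Local Notation cT := (completion_type Pm).
Local Notation Pc := (completion Pm : probability (completion_type Pm) R).

Definition comb (L : seq (R * seq (test E))) (w : Omega) : R :=
  \sum_(p <- L) p.1 * ev X p.2 w.

Definition comb_bound (L : seq (R * seq (test E))) : R := \sum_(p <- L) `|p.1|.

Lemma comb_bound_ge0 L : 0 <= comb_bound L.
Proof. by apply: sumr_ge0 => p _. Qed.

Lemma norm_sum_le (L : seq (R * seq (test E))) (f : seq (test E) -> R) :
  (forall l, 0 <= f l <= 1) -> `|\sum_(p <- L) p.1 * f p.2| <= comb_bound L.
Proof.
move=> f01; apply: le_trans (ler_norm_sum _ _ _) _; apply: ler_sum => p _.
by have /andP[f0 f1] := f01 p.2; rewrite normrM (ger0_norm f0) ler_piMr.
Qed.

Lemma norm_comb L w : `|comb L w| <= comb_bound L.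
Proof. by apply: (@norm_sum_le L (fun l => ev X l w)) => l; exact: ev_01. Qed.

Lemma measurable_comb_fun d' (T : measurableType d') (L : seq (R * seq (test
  E)))
    (f : seq (test E) -> T -> R) : (forall l, measurable_fun setT (f l)) ->
  measurable_fun setT (fun w => \sum_(p <- L) p.1 * f p.2 w).
Proof.
move=> mf; elim: L => [|p L IH].
  by under eq_fun do rewrite big_nil; exact: measurable_cst.
under eq_fun do rewrite big_cons; apply: measurable_funD => //.
exact: measurable_funM.
Qed.

Lemma measurable_comb L : measurable_fun setT (comb L).
Proof. apply: (@measurable_comb_fun _ Omega L (ev X)) => l;
  exact: (measurable_ev X_hunt l). Qed.

(** Defined by pointwise limits of products rather than as sets {X_s in B}: concatenating lists
    multiplies the products, which makes the class stable under intersections, and closed sets enter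
    through their separating functions. *)
Definition cylinders : set (set Omega) := [set A | exists l_ : nat ->
  seq (test E),
  forall w, ev X (l_ n) w @[n --> \oo] --> (\1_A w : R)].

Lemma cylinders_measurable : cylinders `<=` measurable.
Proof.
move=> A [l_ cvl].
have m1 : measurable_fun setT (\1_A : Omega -> R).
  apply: (measurable_fun_cvg (h := fun n => ev X (l_ n))) => [n|w _].
    exact: measurable_ev X_hunt _.
  exact: cvl.
have -> : A = setT `&` \1_A @^-1` [set (1 : R)].
  rewrite setTI; apply/seteqP; split => w /=; rewrite indicE.
    by move=> Aw; rewrite mem_set.
  by case: (boolP (w \in A)) => [/set_mem//|_ /esym/eqP]; rewrite oner_eq0.
exact: m1.
Qed.

Lemma cylindersI : setI_closed cylinders.
Proof.
move=> A B [l_ cvl] [m_ cvm]; exists (fun n => l_ n ++ m_ n) => w.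
rewrite indicI /= ; under eq_fun do rewrite /ev big_cat/=.
by apply: cvgM; [exact: cvl|exact: cvm].
Qed.

Lemma cylinders_closed s K : 0 <= s -> closed K -> cylinders (X s @^-1` K).
Proof.
move=> s0 clK; have [psi [cpsi psi01 psiK psiNK]] :=
  closed_separating_functions E_lc E_sep clK.
exists (fun n => [:: Test s0 (cpsi n) (psi01 n)]) => w.
under eq_fun do rewrite /ev big_seq1/=.
apply: cvg_near_cst; rewrite indicE; have [Kw|nKw] := pselect (K (X s w)).
  by apply: nearW => n; rewrite mem_set// psiK.
by have := psiNK _ nKw; apply: filterS => n ->; rewrite memNset.
Qed.

Lemma cylinders_generate : <<s cylinders >> = @measurable _ Omega.
Proof.
apply/seteqP; split.
  apply: smallest_sub => //; last exact: cylinders_measurable.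
  split => // [A mA|A mA]; first by rewrite setTD; exact: measurableC.
  exact: bigcupT_measurable.
rewrite (hunt_measurable X_hunt.1); apply: smallest_sub.
  exact: smallest_sigma_algebra.
move=> _ [s/= s0 [B mB <-]]; rewrite setTI.
rewrite in_itv/= andbT in s0.
have [h0 hC hU] := @smallest_sigma_algebra _ setT cylinders.
have hC' A : <<s cylinders >> A -> <<s cylinders >> (~` A).
  by move=> /hC; rewrite setTD.
suff : @measurable _ (borel (opc E)) `<=`
    [set B | <<s cylinders >> (X s @^-1` B)] by apply.
apply: smallest_sub => [|U oU /=]; last first.
  rewrite -[U]setCK; apply: (hC' (X s @^-1` (~` U))); apply: sub_sigma_algebra.
  by apply: cylinders_closed => //; exact: open_closedC.
split => [//|A hA|A hA]; first by rewrite setTD; exact: hC' hA.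
by rewrite /= preimage_bigcup; exact: hU.
Qed.

(** The closure grows from cylinders to measurable events, then to completed events through
    representatives, then to integrable variables through simple functions. *)
Lemma comb_dense (xi : cT -> R) (e : R) : Pc.-integrable setT (EFin \o xi) ->
  0 < e -> exists L, \int[Pc]_w `|xi w - comb L w| <= e.
Proof.
move=> xii; pose V : set (cT -> R) := [set v | exists L, v = comb L].
have V_int v : V v -> Pc.-integrable setT (EFin \o v).
  move=> [L ->]; apply: (@bounded_integrable _ _ _ _ (comb_bound L)) => //.
    exact: measurable_fun_completion (measurable_comb L).
  exact: norm_comb.
have VD u v : V u -> V v -> V (fun w => u w + v w).
  move=> [L ->] [L' ->]; exists (L ++ L').
  by apply/funext => w; rewrite /comb big_cat.
have VZ k u : V u -> V (fun w => k * u w).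
  move=> [L ->]; exists [seq (k * p.1, p.2) | p <- L].
  apply/funext => w; rewrite /comb big_map mulr_sumr.
  by apply: eq_bigr => p _; rewrite mulrA.
have ev_V l : V (ev X l).
  by exists [:: (1, l)]; apply/funext => w; rewrite /comb big_seq1 mul1r.
have cl1 : L1_closure Pc V (cst 1).
  apply: L1_closure_sub => //; rewrite (_ : cst 1 = ev X [::]);
    first exact: ev_V.
  by apply/funext => w; rewrite /ev big_nil.
have clm (A : set Omega) : measurable A -> L1_closure Pc V \1_A.
  move=> mA; have : <<s cylinders >> A by rewrite cylinders_generate.
  move: A {mA}.
  apply: (@L1_closure_indic _ cT R Pc V V_int VD VZ cylinders) => //.
  - by rewrite cylinders_generate => B mB; exact: completion_measurable.
  - exact: cylindersI.
  move=> B cB; have [l_ cvl] := cB.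
  apply: (@L1_closure_cvg_bounded _ cT R Pc V V_int 1 (fun n => ev X (l_ n))).
  - by move=> n; apply: L1_closure_sub => //; exact: ev_V.
  - by move=> n; exact: measurable_fun_completion (measurable_ev X_hunt _).
  - apply: measurable_indic; apply: completion_measurable.
    exact: cylinders_measurable.
  - by move=> n w; have /andP[? ?] := ev_01 X (l_ n) w; rewrite ger0_norm.
  - by move=> w; rewrite indicE; case: (_ \in _); rewrite ?normr1 ?normr0.
  - exact: cvl.
have clc (A : set cT) : measurable A -> L1_closure Pc V \1_A.
  move=> mA; have [B mB negl] := measurable_completion_modification mA.
  apply: (@L1_closure_ae _ cT R Pc V V_int \1_B) => //; first exact: clm.
    apply: (@bounded_integrable _ _ _ _ 1) => //.
    by move=> w; rewrite indicE; case: (_ \in _); rewrite ?normr1 ?normr0.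
  apply: negligibleS (completion_negligible negl) => w /= neq.
  apply: contrapT => /not_orP[nAB nBA]; apply: neq; rewrite !indicE.
  have [Aw|nAw] := pselect (A w).
    have Bw : B w by apply: contrapT => ?; exact: nAB.
    by rewrite !mem_set.
  have nBw : ~ B w by move=> ?; exact: nBA.
  by rewrite !memNset.
move=> e0; have [_ /(_ _ e0)[_ [L ->] le_e]] := L1_closure_integrable V_int VD
  VZ cl1 clc xii.
by exists L.
Qed.

End cylinder_density.

(** * Continuity of martingales *)

Section augmented_filtration_martingale.
Context (R : realType) (E : pmetricType R).
Hypotheses (E_lc : locally_compact [set: E]) (E_sep : separable E).
Context (d : measure_display) (Omega : measurableType d).
Variables (X : R -> Omega -> opc E) (theta : R -> Omega -> Omega).
Variable P : R.-pker borel (opc E) ~> Omega.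
Hypothesis X_hunt : continuous_hunt_process X theta P.
Variable mu : probability (borel E) R.
Local Notation F := (natural_filtration X).
Local Notation Pm := (prob_from P mu).
Local Notation cT := (completion_type Pm).
Local Notation Pc := (completion Pm : probability (completion_type Pm) R).
Local Notation Fmu := (augmented_filtration X P mu).

Lemma augmented_sigma t : sigma_algebra setT (Fmu t).
Proof. exact: smallest_sigma_algebra. Qed.

Lemma sub_augmented t : F t `<=` Fmu t.
Proof. by move=> A FA; apply: sub_sigma_algebra; left. Qed.

Lemma augmented_measurable t : Fmu t `<=` @measurable _ cT.
Proof.
apply: smallest_sub; first exact: sigma_algebra_measurable.
move=> A [/(filtration_measurable X_hunt)|[]//]; exact: completion_measurable.
Qed.

Lemma augmented_le s t : s <= t -> Fmu s `<=` Fmu t.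
Proof.
move=> st; apply: sub_sigma_algebra2 => A [FA|]; last by right.
by left; exact: (filtration_le st).
Qed.

Lemma augmented_modification t : Fmu t `<=` null_modification Pm (F t).
Proof.
apply: smallest_sub.
  by apply: sigma_algebra_null_modification; exact: filtration_sigma.
move=> A [FA|[mA A0]]; first exact: sub_null_modification.
apply: negligible_null_modification; first exact: filtration0.
exact: completion_eq0.
Qed.

Definition comb_delay (L : seq (R * seq (test E))) s0 s w :=
  \sum_(p <- L) p.1 * ev_delay X p.2 s0 s w.

Definition comb_mean (L : seq (R * seq (test E))) s0 s w :=
  \sum_(p <- L) p.1 * mean_delay X P p.2 s0 s w.

Lemma norm_comb_delay L s0 s w : `|comb_delay L s0 s w| <= comb_bound L.
Proof. by apply: (@norm_sum_le _ _ L (fun l => ev_delay X l s0 s w)) => l;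
  exact: (ev_delay_01 X l s0 s w). Qed.

Lemma norm_comb_mean L s0 s w : `|comb_mean L s0 s w| <= comb_bound L.
Proof.
apply: (@norm_sum_le _ _ L (fun l => mean_delay X P l s0 s w)) => l.
exact: (mean_delay_01 X_hunt l s0 s w).
Qed.

Lemma measurable_comb_delay L s0 s : s0 <= s ->
  measurable_fun setT (comb_delay L s0 s).
Proof.
move=> s0s; apply: (@measurable_comb_fun _ _ _ Omega L (fun l =>
  ev_delay X l s0 s)) => l.
exact: (measurable_ev_delay X_hunt).
Qed.

Lemma measurable_wrt_comb_mean L s0 s : 0 <= s0 <= s ->
  measurable_wrt (F s) (comb_mean L s0 s).
Proof.
move=> s0s; apply/measurable_wrt_gen.
apply: (@measurable_comb_fun _ _ _ (g_sigma_algebraType _) L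
  (fun l => mean_delay X P l s0 s)) => l.
by apply/measurable_wrt_gen; exact: (measurable_wrt_mean_delay X_hunt).
Qed.

Lemma measurable_comb_mean L s0 s : 0 <= s0 <= s ->
  measurable_fun setT (comb_mean L s0 s).
Proof.
move=> s0s _ B mB; rewrite setTI;
  apply: (filtration_measurable X_hunt (t := s)).
exact: measurable_wrt_comb_mean.
Qed.

Lemma markov_augmented l s0 s A : 0 <= s0 <= s -> Fmu s A ->
  \int[Pc]_(w in A) ev_delay X l s0 s w = \int[Pc]_(w in A) mean_delay X P l s0
    s w.
Proof.
move=> s0s FA; have /andP[s00 s0s'] := s0s.
have mA := augmented_measurable FA.
have [B FB negl] := augmented_modification FA.
have mB := filtration_measurable X_hunt FB.
have me := measurable_ev_delay X_hunt l s0s'.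
have mm : measurable_fun setT (mean_delay X P l s0 s).
  move=> _ C mC; rewrite setTI; apply: (filtration_measurable X_hunt (t := s)).
  exact: (measurable_wrt_mean_delay X_hunt).
rewrite (Rintegral_null_modification mA mB negl (measurable_fun_completion me)).
rewrite (Rintegral_null_modification mA mB negl (measurable_fun_completion mm)).
rewrite !Rintegral_completion//.
- exact: (markov_cylinder E_lc E_sep X_hunt).
- by move=> w; have /andP[] := mean_delay_01 X_hunt l s0 s w.
- by move=> w; have /andP[] := ev_delay_01 X l s0 s w.
Qed.

Lemma markov_comb L s0 s A : 0 <= s0 <= s -> Fmu s A ->
  \int[Pc]_(w in A) comb_delay L s0 s w = \int[Pc]_(w in A) comb_mean L s0 s w.
Proof.
move=> s0s FA; have /andP[s00 s0s'] := s0s.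
have mA := augmented_measurable FA.
rewrite /comb_delay /comb_mean; elim: L => [|[k l] L IH].
  by apply: eq_Rintegral => w _; rewrite !big_nil.
have int1 L' : Pc.-integrable A (EFin \o comb_delay L' s0 s).
  apply: (@bounded_integrable _ _ _ _ (comb_bound L')) => //.
    exact: measurable_fun_completion (measurable_comb_delay L' s0s').
  exact: norm_comb_delay.
have int2 L' : Pc.-integrable A (EFin \o comb_mean L' s0 s).
  apply: (@bounded_integrable _ _ _ _ (comb_bound L')) => //.
    exact: measurable_fun_completion (measurable_comb_mean L' s0s).
  exact: norm_comb_mean.
have int1k : Pc.-integrable A (EFin \o (fun w => k * ev_delay X l s0 s w)).
  have := int1 [:: (k, l)]; congr (Pc.-integrable A (EFin \o _)).
  by apply/funext => w; rewrite /comb_delay big_seq1.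
have int2k : Pc.-integrable A (EFin \o (fun w => k * mean_delay X P l s0 s w)).
  have := int2 [:: (k, l)]; congr (Pc.-integrable A (EFin \o _)).
  by apply/funext => w; rewrite /comb_mean big_seq1.
under eq_Rintegral do rewrite big_cons/=.
under [RHS]eq_Rintegral do rewrite big_cons/=.
rewrite RintegralD//; last exact: int1.
rewrite RintegralD//; last exact: int2.
rewrite IH; congr (_ + _); rewrite !RintegralZl//.
- by rewrite markov_augmented.
- have := int2 [:: (1, l)]; congr (Pc.-integrable A (EFin \o _)).
  by apply/funext => w; rewrite /comb_mean big_seq1 mul1r.
- have := int1 [:: (1, l)]; congr (Pc.-integrable A (EFin \o _)).
  by apply/funext => w; rewrite /comb_delay big_seq1 mul1r.
Qed.

Lemma regularD (y z : R -> R) : regular y -> regular z -> regular (fun t =>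
  y t + z t).
Proof.
move=> ry rz t e t0 e0; have e20 : 0 < e / 2 by rewrite divr_gt0.
have [d1 d10 P1] := ry t _ t0 e20; have [d2 d20 P2] := rz t _ t0 e20.
exists (Num.min d1 d2); first by rewrite lt_min d10.
move=> p q dp dq; rewrite !lt_min => /andP[p1 p2] /andP[q1 q2].
rewrite opprD addrACA (le_trans (ler_normD _ _))// [leRHS](splitr e) lerD//.
  exact: P1.
exact: P2.
Qed.

Lemma regularZ (k : R) (y : R -> R) : regular y -> regular (fun t => k * y t).
Proof.
move=> ry t e t0 e0; have k0 : 0 < `|k| + 1 by rewrite ltr_wpDl.
have [d1 d10 P1] := ry t _ t0 (divr_gt0 e0 k0).
exists d1 => // p q dp dq p1 q1; rewrite -mulrBr normrM.
rewrite (le_trans (ler_wpM2l _ (P1 p q dp dq p1 q1)))// mulrA ler_pdivrMr//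
  mulrC.
by rewrite ler_pM2l// lerDl.
Qed.

(** In each summand the past factor is constant in s, and h(X_s) is almost surely regular. The null
    set depends on s0, which is later restricted to a grid. *)
Lemma ae_regular_comb_mean L s0 :
  \forall w \ae Pm, regular (fun s => comb_mean L s0 s w).
Proof.
rewrite /comb_mean; elim: L => [|[k l] L IH].
  apply: aeW => w t e t0 e0; exists 1 => // p q _ _ _ _.
  by rewrite !big_nil subrr normr0 ltW.
have := ae_regular_mean E_lc E_sep X_hunt mu (shift_continuous_future X_hunt l
  s0).
apply: filterS2 IH => w rL rl.
under eq_fun do rewrite big_cons/=.
apply: regularD => //; apply: regularZ; exact: regularZ.
Qed.

End augmented_filtration_martingale.

Section continuity_of_martingales.
Context (R : realType) (E : pmetricType R).
Hypotheses (E_lc : locally_compact [set: E]) (E_sep : separable E).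
Context (d : measure_display) (Omega : measurableType d).
Variables (X : R -> Omega -> opc E) (theta : R -> Omega -> Omega).
Variable P : R.-pker borel (opc E) ~> Omega.
Hypothesis X_hunt : continuous_hunt_process X theta P.
Variable mu : probability (borel E) R.
Local Notation F := (natural_filtration X).
Local Notation Pm := (prob_from P mu).
Local Notation cT := (completion_type Pm).
Local Notation Pc := (completion Pm : probability (completion_type Pm) R).
Local Notation Fmu := (augmented_filtration X P mu).

(** Twice the grid step, because s is compared with its floor on the grid and also with the
    preceding grid point. *)
Definition mesh (k : nat) : R := 2 * (2 ^+ k)^-1.

(** Restricting s0 and s to dyadic times makes this event measurable. *)
Definition delay_bad L a k : set Omega := [set w | exists s0 s,
  [/\ dyadic_num s0, dyadic_num s, s0 <= s, s - s0 <= mesh k &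
      a < `|comb X L w - comb_delay X L s0 s w|]].

Lemma measurable_delay_bad L a k : measurable (delay_bad L a k).
Proof.
rewrite (_ : delay_bad L a k = \bigcup_m \bigcup_i \bigcup_n \bigcup_j
  [set w | [/\ dyadic R m i <= dyadic R n j,
    dyadic R n j - dyadic R m i <= mesh k &
    a < `|comb X L w - comb_delay X L (dyadic R m i) (dyadic R n j) w|]]);
      last first.
  apply/seteqP; split.
    move=> w [_ [_ [[m [i ->]] [n [j ->]] le1 le2 lta]]].
    by exists m => //; exists i => //; exists n => //; exists j.
  move=> w [m _ [i _ [n _ [j _ [le1 le2 lta]]]]].
  by exists (dyadic R m i), (dyadic R n j); split => //;
    [exists m, i|exists n, j].
apply: bigcupT_measurable => m; apply: bigcupT_measurable => i.
apply: bigcupT_measurable => n; apply: bigcupT_measurable => j.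
have [[le1 le2]|nle] := pselect (dyadic R m i <= dyadic R n j /\
    dyadic R n j - dyadic R m i <= mesh k); last first.
  rewrite (_ : [set _ | _] = set0)//; apply/seteqP;
    split => // w /= [le1 le2 _].
  by apply: nle.
rewrite (_ : [set _ | _] = (fun w => `|comb X L w -
  comb_delay X L (dyadic R m i) (dyadic R n j) w|) @^-1` `]a, +oo[); last first.
  apply/seteqP; split => w /=; rewrite in_itv/= andbT; first by case.
  by split.
rewrite -[X in measurable X]setTI.
apply: (measurableT_comp (@normr_measurable R setT)) => //.
apply: measurable_funB; first exact: (measurable_comb X_hunt).
exact: (measurable_comb_delay X_hunt).
Qed.

Lemma comb_near L w a : 0 < a -> exists2 del, 0 < del &
  forall s0 s, s0 <= s -> s - s0 < del ->
    `|comb X L w - comb_delay X L s0 s w| <= a.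
Proof.
rewrite /comb /comb_delay; elim: L a => [|[k l] L IH] a a0.
  by exists 1 => // s0 s _ _; rewrite !big_nil subrr normr0 ltW.
have a20 : 0 < a / 2 by rewrite divr_gt0.
have k0 : 0 < `|k| + 1 by rewrite ltr_wpDl.
have [d1 d10 P1] := IH _ a20.
have [d2 d20 P2] := ev_delay_near X_hunt l w (divr_gt0 a20 k0).
exists (Num.min d1 d2); first by rewrite lt_min d10.
move=> s0 s s0s; rewrite lt_min => /andP[sd1 sd2]; rewrite !big_cons/=.
rewrite opprD addrACA (le_trans (ler_normD _ _))// [leRHS](splitr a) lerD//.
  rewrite -mulrBr normrM (le_trans (ler_wpM2l _ (P2 s0 s s0s sd2)))//.
  by rewrite mulrA ler_pdivrMr// mulrC ler_pM2l// lerDl.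
exact: P1.
Qed.

(** Each path has its own [del] in [comb_near] and leaves the bad event once the mesh is below it;
    dominated convergence turns this into small probability. *)
Lemma cvg_delay_bad L a : 0 < a ->
  fine (Pc (delay_bad L a k)) @[k --> \oo] --> (0 : R).
Proof.
move=> a0.
have mB k : @measurable _ cT (delay_bad L a k).
  by apply: completion_measurable; exact: measurable_delay_bad.
have := @cvg_Rintegral_bounded _ cT R Pc 1 (fun _ _ => 1) (fun=> 1)
  (delay_bad L a) set0 mB measurable0.
rewrite Rintegral_set0 (_ : (fun n => Rintegral _ _ _) =
  fun k => fine (Pc (delay_bad L a k))); last first.
  by apply/funext => k; rewrite Rintegral_cst// mul1r.
apply => //.
- by move=> n w; rewrite normr1.
- move=> w _; have [del del0 near_w] := comb_near L w a0.
  have [M MP] := @invr_expr2_lt R (del / 2) (divr_gt0 del0 (ltr0n _ 2)).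
  exists M => // k /= Mk [s0 [s [_ _ s0s sk lta]]].
  have := near_w s0 s s0s; rewrite leNgt lta => /(_ _)/negP; apply => //.
  by apply: le_lt_trans sk _; have := MP k Mk; rewrite /mesh; lra.
Qed.

Variables (xi : Omega -> R) (M : R -> Omega -> R) (N : R).
Hypothesis xi_int : Pc.-integrable setT (EFin \o xi).
(** Only up to N, because a martingale is closed on a bounded interval by its final value. *)
Hypothesis M_ce : forall s, 0 <= s -> s <= N -> is_cond_exp Pc (Fmu s) xi (M s).

Let comb_int L : Pc.-integrable setT (EFin \o comb X L).
Proof.
apply: (@bounded_integrable _ _ _ _ (comb_bound L)) => //.
  exact: measurable_fun_completion (measurable_comb X_hunt L).
exact: norm_comb.
Qed.

(** One integrable variable dominating |xi - comb_delay| for all dyadic s0 <= s with s - s0 <=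
    [mesh k]: off the bad event the delay costs a, on it the trivial bound 2 [comb_bound L]. *)
Definition majorant L a k (w : Omega) : R :=
  `|xi w - comb X L w| + (a + 2 * comb_bound L * \1_(delay_bad L a k) w).

Let majorant_int L a k : Pc.-integrable setT (EFin \o majorant L a k).
Proof.
apply: integrableRD; first exact/integrableRabs/integrableRB.
apply: (@bounded_integrable _ _ _ _ (`|a| + 2 * comb_bound L)) => //.
  apply: measurable_funD => //; apply: measurable_funM => //.
  apply: (@measurable_indic _ cT R setT); apply: completion_measurable.
  exact: measurable_delay_bad.
move=> w; rewrite (le_trans (ler_normD _ _))// lerD2l.
rewrite ger0_norm ?mulr_ge0 ?comb_bound_ge0//.
by rewrite ler_piMr ?mulr_ge0 ?comb_bound_ge0// indicE; case: (_ \in _).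
Qed.

Lemma Rintegral_majorant L a k : \int[Pc]_w majorant L a k w =
  \int[Pc]_w `|xi w - comb X L w| + (a + 2 * comb_bound L * fine (Pc (delay_bad
    L a k))).
Proof.
have mB : @measurable _ cT (delay_bad L a k).
  by apply: completion_measurable; exact: measurable_delay_bad.
have iB : Pc.-integrable setT (EFin \o (\1_(delay_bad L a k) : cT -> R)).
  apply: (@bounded_integrable _ _ _ _ 1) => //.
  by move=> w; rewrite indicE; case: (_ \in _); rewrite ?normr1 ?normr0.
have iZ := integrableRZ (2 * comb_bound L) iB.
have iC : Pc.-integrable setT (EFin \o (fun=> a)).
  exact: finite_measure_integrable_cst.
rewrite RintegralD//; last 2 first.
- exact/integrableRabs/integrableRB.
- exact: integrableRD.
congr (_ + _); rewrite RintegralD// RintegralZl//; congr (_ + _ * _).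
  by rewrite Rintegral_cst// [X in fine X](probability_setT Pc) mulr1.
by rewrite /Rintegral integral_indic// setIT.
Qed.

Lemma cond_exp_maximal (sig : R -> R) L a k c : 0 < c -> 0 < a ->
  (forall s, dyadics N s -> [/\ dyadic_num (sig s), 0 <= sig s <= s &
     s - sig s <= mesh k]) ->
  exists2 B : set cT, measurable B &
    c * fine (Pc B) <= \int[Pc]_w majorant L a k w /\
    forall w, ~ B w -> forall s, dyadics N s ->
      `|M s w - comb_mean X P L (sig s) s w| <= c.
Proof.
move=> c0 a0 sigP.
have bound_ge0 := comb_bound_ge0 L.
have [|||||||||mB leB] := @maximal_inequality _ cT R Pc Fmu
  (fun s w => M s w - comb_mean X P L (sig s) s w) (majorant L a k) N c.
- exact: augmented_sigma.
- exact: (augmented_measurable X_hunt).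
- exact: augmented_le.
- move=> q Nq; have [_ sq _] := sigP q Nq.
  have [m [i [qE qN]]] := Nq; have q0 := dyadics_ge0 Nq.
  have [GM _ _] := M_ce q0 qN.
  apply/measurable_wrt_gen; apply: measurable_funB;
    apply/measurable_wrt_gen => //.
  move=> B mB; apply: (@sub_augmented _ _ _ _ X P mu q).
  exact: (measurable_wrt_comb_mean X_hunt L sq mB).
- move=> q Nq; have [_ sq _] := sigP q Nq.
  have [m [i [qE qN]]] := Nq; have q0 := dyadics_ge0 Nq.
  have [_ iM _] := M_ce q0 qN.
  apply: integrableRB => //.
  apply: (@bounded_integrable _ _ _ _ (comb_bound L)) => //.
    exact: measurable_fun_completion (measurable_comb_mean X_hunt L sq).
  exact: (norm_comb_mean X_hunt).
- exact: majorant_int.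
- move=> q A Nq GA; have [dsq sq meshq] := sigP q Nq.
  have [m [i [qE qN]]] := Nq; have q0 := dyadics_ge0 Nq.
  have [GM iM ceM] := M_ce q0 qN.
  have mA := augmented_measurable X_hunt GA.
  have sq' : sig q <= q by case/andP: sq.
  have iA f : Pc.-integrable setT (EFin \o f) -> Pc.-integrable A (EFin \o f).
    exact: integrableS.
  have icm : Pc.-integrable setT (EFin \o comb_mean X P L (sig q) q).
    apply: (@bounded_integrable _ _ _ _ (comb_bound L)) => //.
      exact: measurable_fun_completion (measurable_comb_mean X_hunt L sq).
    exact: (norm_comb_mean X_hunt).
  have icd : Pc.-integrable setT (EFin \o comb_delay X L (sig q) q).
    apply: (@bounded_integrable _ _ _ _ (comb_bound L)) => //.
      exact: measurable_fun_completion (measurable_comb_delay X_hunt L sq').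
    exact: norm_comb_delay.
  have -> : \int[Pc]_(w in A) (M q w - comb_mean X P L (sig q) q w) =
      \int[Pc]_(w in A) (xi w - comb_delay X L (sig q) q w).
    rewrite RintegralB//; [|exact: iA|exact: iA].
    rewrite RintegralB//; [|exact: iA|exact: iA].
    rewrite (markov_comb E_lc E_sep X_hunt L sq GA); congr (_ - _).
    by rewrite /Rintegral ceM.
  have iD : Pc.-integrable setT (EFin \o (fun w =>
    xi w - comb_delay X L (sig q) q w)).
    exact: integrableRB.
  apply: (le_trans (le_normr_Rintegral mA (iA _ iD))).
  apply: le_Rintegral => //.
  + by apply: iA; exact: integrableRabs.
  + exact: iA.
  move=> w _; rewrite /majorant -[xi w - comb_delay _ _ _ _ _](subrKA (comb X L
    w)).
  rewrite (le_trans (ler_normD _ _))// lerD2l indicE.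
  have [wB|wB] := boolP (w \in delay_bad L a k).
    rewrite mulr1 (le_trans (ler_normB _ _))//.
    have := norm_comb X L w; have := norm_comb_delay X L (sig q) q w; lra.
  rewrite mulr0 addr0 leNgt; apply/negP => lta; move/negP: wB; apply;
    rewrite inE.
  by exists (sig q), q; split => //; exists m, i.
- move=> w; rewrite /majorant addr_ge0// addr_ge0 ?(ltW a0)//.
  by rewrite mulr_ge0// mulr_ge0.
- exact: c0.
exists [set w | exists q, dyadics N q /\ c < `|M q w - comb_mean X P L (sig q)
  q w|] => //.
split => // w nB s Ns; rewrite leNgt; apply/negP => lts; apply: nB.
by exists s.
Qed.

Lemma mesh_floor k (s : R) : 0 <= s -> let i := Num.truncn (s * 2 ^+ k) in
  [/\ 0 <= dyadic R k i <= s, s - dyadic R k i <= mesh k,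
      0 <= dyadic R k i.-1 <= s & s - dyadic R k i.-1 <= mesh k].
Proof.
move=> s0 i; have /andP[le_s] := dyadic_floor k s0; rewrite -/i dyadicS => lt_s.
have pi0 : 0 <= (2 ^+ k)^-1 :> R by rewrite invr_ge0 exprn_ge0.
have le1 : dyadic R k i.-1 <= dyadic R k i.
  by rewrite ler_pM2r ?invr_gt0 ?exprn_gt0// ler_nat leq_pred.
have le2 : dyadic R k i <= dyadic R k i.-1 + (2 ^+ k)^-1.
  by rewrite -dyadicS ler_pM2r ?invr_gt0 ?exprn_gt0// ler_nat leqSpred.
by rewrite /mesh !dyadic_ge0; split => //=; lra.
Qed.

(** Near t, M is within c of one regular process, frozen at a grid point strictly before t. When t
    is itself a grid point its neighbours lie in two cells, so two maximal inequalities are used,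
    freezing at the floor and at its predecessor; on consecutive cells j and j+1 these give the same
    grid point j. *)
Lemma ae_small_oscillation_outside (kap e : R) : 0 < kap -> 0 < e ->
  exists2 B : set cT, measurable B & fine (Pc B) <= kap /\
    \forall w \ae Pc, ~ B w -> forall t, 0 < t -> t < N ->
      small_oscillation (M ^~ w) t e.
Proof.
(* Two approximations and one oscillation of the regular process add up to 3 c < e. The integral of
   the majorant is at most 4 a = c kap / 2, so each of the two exceptional sets has probability at
   most kap / 2. *)
move=> kap0 e0; pose c := e / 4; have c0 : 0 < c by rewrite divr_gt0.
pose a := kap * c / 8; have a0 : 0 < a by rewrite divr_gt0// mulr_gt0.
have [L Lxi] := comb_dense E_lc E_sep X_hunt xi_int a0.
have b0 : 0 < 2 * comb_bound L + 1 by rewrite ltr_wpDl// mulr_ge0//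
  comb_bound_ge0.
have [k /(_ k (leqnn k))] := (cvgr_ltP _ _).2 (cvg_delay_bad L a0) _ (divr_gt0
  a0 b0).
rewrite subr0 => /ltr_normlW; rewrite ltr_pdivlMr// => bad_le.
have intW : \int[Pc]_w majorant L a k w <= kap / 2 * c.
  have Pbad0 : 0 <= fine (Pc (delay_bad L a k)) by rewrite fine_ge0.
  have aE : kap / 2 * c = 4 * a by rewrite /a; move: (kap) (c) => u v; field.
  rewrite Rintegral_majorant aE.
  have bad_le' : 2 * comb_bound L * fine (Pc (delay_bad L a k)) <= a.
    by apply: le_trans (ltW bad_le); rewrite mulrDr mulr1 mulrC lerDl.
  rewrite (_ : 4 * a = a + (a + a) + a); last by rewrite -!mulr2n -mulr_natl;
    ring.
  by rewrite ler_wpDr ?(ltW a0)// lerD// lerD.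
have N_ge0 s : dyadics N s -> 0 <= s by move=> /dyadics_ge0.
have [B1 mB1 [PB1 hB1]] := @cond_exp_maximal
  (fun s => dyadic R k (Num.truncn (s * 2 ^+ k))) L a k c c0 a0
  (fun s Ns => let: And4 h1 h2 _ _ := mesh_floor k (N_ge0 s Ns) in
    And3 (ex_intro _ k (ex_intro _ _ erefl)) h1 h2).
have [B2 mB2 [PB2 hB2]] := @cond_exp_maximal
  (fun s => dyadic R k (Num.truncn (s * 2 ^+ k)).-1) L a k c c0 a0
  (fun s Ns => let: And4 _ _ h1 h2 := mesh_floor k (N_ge0 s Ns) in
    And3 (ex_intro _ k (ex_intro _ _ erefl)) h1 h2).
exists (B1 `|` B2); first exact: measurableU.
split.
  have PB1' : fine (Pc B1) <= kap / 2 by rewrite -(ler_pM2r c0) mulrC (le_trans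
    PB1).
  have PB2' : fine (Pc B2) <= kap / 2 by rewrite -(ler_pM2r c0) mulrC (le_trans
    PB2).
  rewrite [leRHS](splitr kap) (le_trans _ (lerD PB1' PB2'))//.
  rewrite -fineD ?fin_num_measure// fine_le ?fin_num_measure//;
    first exact: measurableU.
    by rewrite fin_numD !fin_num_measure.
  exact: measureU2.
have : \forall w \ae Pc, forall i, regular (fun s =>
  comb_mean X P L (dyadic R k i) s w).
  apply: ae_foralln => i; apply: ae_completion.
  exact: (ae_regular_comb_mean E_lc E_sep X_hunt).
apply: filterS => w reg_w /not_orP[nB1 nB2] t t0 tN.
have p0 : 0 < (2 ^+ k : R) by rewrite exprn_gt0.
have dyE i x : (dyadic R k i < x) = (i%:R < x * 2 ^+ k) by rewrite ltr_pdivrMr.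
have dyE' i x : (x < dyadic R k i) = (x * 2 ^+ k < i%:R) by rewrite ltr_pdivlMr.
(* t has to be interior to the union of the cells j and j+1: j is the cell of t, or the preceding
   one when t is a grid point. *)
have [j [jt tj]] : exists j, dyadic R k j < t /\ t < dyadic R k j.+2.
  have /andP[] := dyadic_floor k (ltW t0); set i := Num.truncn _.
  rewrite le_eqVlt => /orP[/eqP it|it] ti; last first.
    by exists i; split => //; apply: (lt_trans ti);
      rewrite [ltRHS]dyadicS ltrDl invr_gt0.
  have i0 : (0 < i)%N.
    rewrite lt0n; apply/eqP => i0; move: t0;
      rewrite -it i0 /dyadic mul0r ltxx //.
  exists i.-1; rewrite prednK//; split => //;
    rewrite -it -{2}(prednK i0) dyadicS.
  by rewrite ltrDl invr_gt0.
have [d1 d10 reg_j] := reg_w j t c t0 c0.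
exists (Num.min (Num.min d1 (N - t)) (Num.min (t - dyadic R k j) (dyadic R k
  j.+2 - t))).
  by rewrite !lt_min d10 !subr_gt0 tN jt tj.
have close p : dyadic_num p -> `|p - t| < N - t ->
  `|p - t| < t - dyadic R k j ->
    `|p - t| < dyadic R k j.+2 - t ->
    `|M p w - comb_mean X P L (dyadic R k j) p w| <= c.
  move=> [m [i pE]] /ltr_normlW pN pj /ltr_normlW pj2.
  have {}pj : dyadic R k j < p.
    by move: pj; rewrite ltr_distl opprB addrCA subrr addr0 => /andP[].
  have Np : dyadics N p by exists m, i; split => //; lra.
  have jp : j%:R < p * 2 ^+ k by rewrite -dyE.
  have pj2' : p * 2 ^+ k < j.+2%:R by rewrite -dyE'; lra.
  have [lt1|ge1] := ltP (p * 2 ^+ k) j.+1%:R.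
    by have := hB1 w nB1 p Np; rewrite (@truncn_def _ _ j)// (ltW jp).
  by have := hB2 w nB2 p Np; rewrite (@truncn_def _ _ j.+1)// ge1.
move=> p q dp dq; rewrite !lt_min => /andP[/andP[p1 p2] /andP[p3 p4]].
move=> /andP[/andP[q1 q2] /andP[q3 q4]].
have := close p dp p2 p3 p4; have := close q dq q2 q3 q4;
  have := reg_j p q dp dq p1 q1.
set x := comb_mean _ _ _ _ p w; set y := comb_mean _ _ _ _ q w.
rewrite !ler_norml => /andP[? ?] /andP[? ?] /andP[? ?].
have cE : e = 4 * c by rewrite /c mulrC divfK// pnatr_eq0.
by rewrite cE; apply/andP; split; lra.
Qed.

(** Exceptional sets of probability at most 1/(n+1) have a null intersection; afterwards e runs
    through the values 1/(n+1). *)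
Lemma ae_regular_martingale :
  \forall w \ae Pc, forall t e, 0 < t -> t < N -> 0 < e ->
    small_oscillation (M ^~ w) t e.
Proof.
have small e : 0 < e -> \forall w \ae Pc, forall t, 0 < t -> t < N ->
    small_oscillation (M ^~ w) t e.
  move=> e0.
  have /choice[B BP] n : exists B : set cT, [/\ measurable B,
      fine (Pc B) <= n.+1%:R^-1 & \forall w \ae Pc, ~ B w -> forall t,
        0 < t -> t < N ->
      small_oscillation (M ^~ w) t e].
    have n0 : 0 < (n.+1%:R^-1 : R) by rewrite invr_gt0.
    by have [B mB [PB aeB]] := ae_small_oscillation_outside n0 e0; exists B.
  have mB n : measurable (B n) by case: (BP n).
  have mcap : measurable (\bigcap_n B n) by exact: bigcapT_measurable.
  have negB : \forall w \ae Pc, ~ (\bigcap_n B n) w.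
    apply: (negligibleS (A := \bigcap_n B n)) => [w /contrapT//|].
    apply/negligibleP => //.
    have : 0 <= fine (Pc (\bigcap_n B n)) by rewrite fine_ge0.
    rewrite le_eqVlt => /orP[/eqP P0|Pgt0].
      by rewrite -[LHS]fineK ?fin_num_measure// -P0.
    exfalso; have [n] := ltr_invS Pgt0; apply/negP; rewrite -leNgt.
    have [_ + _] := BP n; apply: le_trans; rewrite fine_le ?fin_num_measure//.
    by apply: le_measure; rewrite ?inE//; exact: bigcap_inf.
  have : \forall w \ae Pc, forall n, ~ B n w -> forall t, 0 < t -> t < N ->
      small_oscillation (M ^~ w) t e.
    by apply: ae_foralln => n; case: (BP n).
  apply: filterS2 negB => w nBw Bw.
  by have /existsNP[n /not_implyP[_ nBn]] := nBw; exact: Bw nBn.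
have : \forall w \ae Pc, forall (n : nat) t, 0 < t -> t < N ->
    small_oscillation (M ^~ w) t n.+1%:R^-1.
  by apply: ae_foralln => n; apply: small; rewrite invr_gt0.
apply: filterS => w osc_w t e t0 tN e0; have [n ne] := ltr_invS e0.
have [del del0 delP] := osc_w n t t0 tN; exists del => // p q dp dq pt qt.
by apply: le_trans (ltW ne); exact: delP.
Qed.

End continuity_of_martingales.

(** * From dyadic oscillation to continuity *)

Section path_continuity.
Context (R : realType).
Implicit Types (y : R -> R) (s t e : R).

Lemma right_continuous_dist y t e : y s @[s --> t^'+] --> y t -> 0 < e ->
  exists2 del, 0 < del & forall s, t < s -> s < t + del -> `|y s - y t| < e.
Proof.
move=> /cvgrPdist_lt yt e0; have /nbhs_ballP[del/= del0 delP] := yt _ e0.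
exists del => // s ts st; rewrite distrC; apply: delP => //.
by rewrite /ball/= distrC gtr0_norm ?subr_gt0//; lra.
Qed.

(** Right-continuity approximates y s by a dyadic value slightly to the right of s; the three thirds
    of e are two such approximations and one dyadic oscillation. At t = 0 right-continuity
    suffices. *)
Lemma small_oscillation_continuous y t :
  (forall s, 0 <= s -> y u @[u --> s^'+] --> y s) -> 0 <= t ->
  (forall e, 0 < t -> 0 < e -> small_oscillation y t e) ->
  y s @[s --> within `[0, +oo[ (nbhs t)] --> y t.
Proof.
move=> rcy t0 osc; apply/cvgrPdist_le => e e0; apply/nbhs_ballP => /=.
have [t_gt0|] := ltP 0 t; last first.
  move=> t_le0; have tE : t = 0 by apply/eqP; rewrite eq_le t_le0.
  have [del del0 delP] := right_continuous_dist (rcy t t0) e0.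
  exists del => // s; rewrite /ball/= => ts; rewrite in_itv/= andbT => s0.
  have [->|st] := eqVneq s t; first by rewrite subrr normr0 ltW.
  have ts' : t < s by rewrite lt_neqAle eq_sym st tE.
  rewrite distrC ltW// delP//.
  by move: ts; rewrite distrC gtr0_norm ?subr_gt0//; lra.
have e30 : 0 < e / 3 by rewrite divr_gt0.
have [del del0 delP] := osc _ t_gt0 e30.
have approx s : 0 <= s -> `|s - t| < del -> exists q,
    [/\ dyadic_num q, `|q - t| < del & `|y q - y s| < e / 3].
  move=> s0 st; have [d1 d10 P1] := right_continuous_dist (rcy s s0) e30.
  pose d2 := Num.min d1 (del - `|s - t|).
  have d20 : 0 < d2 by rewrite lt_min d10 subr_gt0.
  have [||m [k [sk ks]]] := @dyadic_between R s (s + d2).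
  - by rewrite ltrDl.
  - by rewrite ltr_wpDl.
  exists (dyadic R m k); split; first by exists m, k.
    rewrite -[dyadic R m k - t](subrKA s) (le_lt_trans (ler_normD _ _))//.
    rewrite -ltrBrDr gtr0_norm ?subr_gt0// ltrBlDl (lt_le_trans ks)//.
    by rewrite lerD2l ge_min lexx orbT.
  apply: P1 => //; apply: (lt_le_trans ks); rewrite lerD2l ge_min lexx //.
exists del => // s; rewrite /ball/= distrC => st; rewrite in_itv/= andbT => s0.
have [q [dq qt yq]] := approx s s0 st.
have [|p [dp pt yp]] := approx t t0; first by rewrite subrr normr0.
have := delP q p dq dp qt pt; move: yq yp => /ltW yq /ltW yp.
have eE : e = 3 * (e / 3) by rewrite mulrC divfK// pnatr_eq0.
rewrite eE; move: yq yp; set f := e / 3.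
rewrite !ler_norml => /andP[? ?] /andP[? ?] /andP[? ?].
by apply/andP; split; lra.
Qed.

End path_continuity.

(** * Closed and local martingales *)

Section continuity.
Context (R : realType) (E : pmetricType R).
Hypotheses (E_lc : locally_compact [set: E]) (E_sep : separable E).
Context (d : measure_display) (Omega : measurableType d).
Variables (X : R -> Omega -> opc E) (theta : R -> Omega -> Omega).
Variable P : R.-pker borel (opc E) ~> Omega.
Hypothesis X_hunt : continuous_hunt_process X theta P.
Variable mu : probability (borel E) R.
Local Notation Pm := (prob_from P mu).
Local Notation Pc := (completion Pm : probability (completion_type Pm) R).
Local Notation Fmu := (augmented_filtration X P mu).

(** A closing variable is asked for on each interval [0, n] separately, which also covers
    martingales without a terminal variable at infinity. *)
Lemma closed_martingale_continuous (M : R -> Omega -> R) :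
  ae_right_continuous Pc M ->
  (forall n : nat, exists2 xi, Pc.-integrable setT (EFin \o xi) &
    forall s, 0 <= s -> s <= n%:R -> is_cond_exp Pc (Fmu s) xi (M s)) ->
  ae_continuous Pc M.
Proof.
move=> rcM ceM.
have : \forall w \ae Pc, forall (n : nat) t e, 0 < t -> t < n%:R -> 0 < e ->
    small_oscillation (M ^~ w) t e.
  apply: ae_foralln => n; have [xi xi_int xi_ce] := ceM n.
  exact: (ae_regular_martingale E_lc E_sep X_hunt xi_int xi_ce).
apply: filterS2 rcM => w rcw oscw; apply/subspace_continuousP => t.
rewrite /= in_itv/= andbT => t0.
apply: small_oscillation_continuous => // e t_gt0 e0.
apply: (oscw (Num.truncn t).+1) => //.
by have /andP[] := truncn_itv t0.
Qed.

Lemma local_martingale_continuous (M : R -> Omega -> R) :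
  local_martingale Pc Fmu M -> ae_continuous Pc M.
Proof.
move=> [rcM _ [tau [otau tauoo mM]]].
have : \forall w \ae Pc, forall n,
    {within `[0, +oo[, continuous (fun t => stopped M (tau n) t w - M 0 w)}.
  apply: ae_foralln => n; have [rcS intS ceS] := mM n.
  apply: (closed_martingale_continuous (M := fun t w =>
    stopped M (tau n) t w - M 0 w)) => //.
  move=> k; exists (fun w => stopped M (tau n) k%:R w - M 0 w).
    exact: intS.
  by move=> s s0 sk; exact: ceS.
apply: filterS2 tauoo => w [_ tw] contS; apply/subspace_continuousP => t /= t0.
(* Once [tau n w] exceeds t + 1, stopping changes nothing in a neighbourhood of t. *)
have [n tn] : exists n, ((t + 1)%:E < tau n w)%E.
  have : \forall n \near \oo, ((t + 1)%:E < tau n w)%E.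
    by apply: (tw [set x | ((t + 1)%:E < x)%E]); exact: nbhs_open_ereal_pinfty.
  by move=> [n _ /(_ n (leqnn n))]; exists n.
have stopE s : s < t + 1 -> stopped M (tau n) s w = M s w.
  move=> st; rewrite /stopped min_l//.
  by rewrite ltW// (lt_trans _ tn)// lte_fin.
have /subspace_continuousP/(_ t t0) := contS n.
have st1 : t < t + 1 by rewrite ltrDl.
move=> cvS.
have : (stopped M (tau n) s w - M 0 w) + M 0 w @[s --> within `[0,
  +oo[ (nbhs t)] -->
    (stopped M (tau n) t w - M 0 w) + M 0 w.
  by apply: cvgD => //; exact: cvg_cst.
rewrite subrK stopE//; apply: cvg_trans; apply: near_eq_cvg.
have : \forall s \near nbhs t, s < t + 1 by exact: lt_nbhsl.
by move=> near_lt; apply: cvg_within; apply: filterS near_lt => s st;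
  rewrite subrK stopE.
Qed.

End continuity.

Theorem theorem2p8 (R : realType) (E : pmetricType R)
    (E_lc : locally_compact [set: E]) (E_sep : separable E)
    (d : measure_display) (Omega : measurableType d)
    (X : R -> Omega -> opc E) (theta : R -> Omega -> Omega)
    (P : R.-pker borel (opc E) ~> Omega)
    (X_hunt : continuous_hunt_process X theta P)
    (mu : probability (borel E) R) :
  let Pmu : probability (completion_type (prob_from P mu)) R :=
    completion (prob_from P mu) in
  let Fmu := augmented_filtration X P mu in
  [/\ forall xi : Omega -> R, xi \in Lfun Pmu 2%:E ->
        forall M : R -> Omega -> R, ae_right_continuous Pmu M ->
          (forall t, 0 <= t -> is_cond_exp Pmu (Fmu t) xi (M t)) ->
          ae_continuous Pmu M,
      forall M : R -> Omega -> R,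
        square_integrable_martingale Pmu Fmu M -> ae_continuous Pmu M &
      forall M : R -> Omega -> R,
        local_martingale Pmu Fmu M -> ae_continuous Pmu M].
Proof.
move=> Pmu Fmu.
have L2 (xi : Omega -> R) (M : R -> Omega -> R) : xi \in Lfun Pmu 2%:E ->
    ae_right_continuous Pmu M ->
    (forall t, 0 <= t -> is_cond_exp Pmu (Fmu t) xi (M t)) -> ae_continuous Pmu M.
  move=> xiL rcM ceM; apply: (closed_martingale_continuous E_lc E_sep X_hunt) => // n.
  exists xi; last by move=> s s0 _; exact: ceM.
  apply/Lfun1_integrable; apply: Lfun_subset12 xiL.
  by rewrite fin_num_measure.
split=> [xi xiL M rcM ceM|M [rcM [xi xiL ceM]]|M].
- exact: L2 xiL rcM ceM.
- exact: L2 xiL rcM ceM.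
- exact: (local_martingale_continuous E_lc E_sep X_hunt).
Qed.
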